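(* For each dimension $d$ there is a constant $C>0$, depending on no parameter of the process below, such that the following holds. Let $\Xi$ be a translation invariant point process on $\mathbb{R}^d$ or $\mathbb{Z}^d$ with intensity $\rho>0$ which is stealthy hyperuniform, i.e. whose structure function $S$ vanishes in a neighbourhood of the origin of the wave space, and let $b>0$ be the radius of the maximal ball, centred at the origin of the wave space, on which $S$ vanishes. Then with $r_0=Cb^{-1}$ one has, for every $x$ (in $\mathbb{R}^d$, respectively $\mathbb{Z}^d$), $$\mathbb{P}\big[\,|\Xi\cap B(x;r_0)|=0\,\big]=0,$$ where $B(x;r)$ denotes the ball with centre $x$ and radius $r$.
   Context: A point process on $\mathbb{R}^d$ (resp. $\mathbb{Z}^d$) is a random locally finite point configuration $\Xi$, identified with its counting measure; $|\Xi\cap A|$ is the number of points in $A$. It is assumed that $\mathbb{E}[|\Xi\cap K|^2]<\infty$ for every bounded $K$. The process is translation invariant if its law is invariant under all translations by elements of $\mathbb{R}^d$ (resp. $\mathbb{Z}^d$); then $\mathbb{E}[\mathrm{d}\Xi]=\rho\,\mathrm{d}u$ with $\mathrm{d}u$ Lebesgue measure (resp. counting measure), and $\rho$ is the intensity. The covariance functional $\beta$ of $\Xi$ is defined by $$\mathrm{Cov}\Big[\int\varphi\,\mathrm{d}\Xi,\int\psi\,\mathrm{d}\Xi\Big]=\iint\varphi(s)\,\overline{\psi(t)}\,\beta(s-t)\,\mathrm{d}s\,\mathrm{d}t$$ for test functions $\varphi,\psi$ (sums replace integrals on $\mathbb{Z}^d$; in general $\beta$ may be a measure or distribution; for a simple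 point process on $\mathbb{R}^d$ with two-point correlation function $\rho_2$ one has $\beta(x)=\rho_2(x)-\rho^2+\rho\,\delta(x)$). The structure function $S$ is the Fourier transform $\hat\beta$, with convention $\hat f(k)=\int f(x)e^{-i\langle k,x\rangle}\mathrm{d}x$; it lives on the wave space, which is $\mathbb{R}^d$ when the physical space is $\mathbb{R}^d$ and the torus $\mathbb{T}^d=\mathbb{R}^d/(2\pi\mathbb{Z})^d$, identified with $[-\pi,\pi)^d$, when the physical space is $\mathbb{Z}^d$ (so that the radius $b$ of a ball in $\mathbb{T}^d$ around the origin is at most $\pi$). In general $S$ may be a nonnegative measure, in which case ''vanishes on $U$'' means $S(U)=0$. *)

(* Defs.v *)
From HB Require Import structures.
From mathcomp Require Import all_boot all_order all_algebra.
From mathcomp Require Import complex.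
From mathcomp Require Import all_classical all_reals all_analysis.
From mathcomp Require Import measurable_realfun.

Set Implicit Arguments.
Unset Strict Implicit.
Unset Printing Implicit Defensive.

Import Order.TTheory GRing.Theory Num.Theory.
Import numFieldNormedType.Exports.
Import ComplexField.Normc.

Local Open Scope classical_set_scope.
Local Open Scope complex_scope.
Local Open Scope ring_scope.

(* R^d is 'rV[R]_n with the sigma-algebra generated by the coordinates, i.e.
   the Borel sigma-algebra (same construction as the library's instance for
   n.-tuple). *)
Section measurable_rV.
Context (R : realType) (n : nat).

Definition coord_rV (i : 'I_n) (x : 'rV[R]_n) : R := x ord0 i.

Let rV_set0 : g_sigma_preimage coord_rV set0.
Proof. exact: sigma_algebra0. Qed.

Let rV_setC A : g_sigma_preimage coord_rV A -> g_sigma_preimage coord_rV (~` A).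
Proof. exact: sigma_algebraC. Qed.

Let rV_bigcup (F : _^nat) : (forall i, g_sigma_preimage coord_rV (F i)) ->
  g_sigma_preimage coord_rV (\bigcup_i (F i)).
Proof. exact: sigma_algebra_bigcup. Qed.

HB.instance Definition _ := @isMeasurable.Build default_measure_display
  'rV[R]_n (g_sigma_preimage coord_rV) rV_set0 rV_setC rV_bigcup.

End measurable_rV.

(* Z^d is {ffun 'I_n -> int} with the discrete sigma-algebra. *)
HB.instance Definition _ (n : nat) := isPointed.Build {ffun 'I_n -> int} 0.
HB.instance Definition _ (n : nat) :=
  @isMeasurable.Build default_measure_display {ffun 'I_n -> int}
    discrete_measurable discrete_measurable0
    discrete_measurableC discrete_measurableU.

(* Lebesgue measure on R^n, as an iterated product of the Lebesgue measure
   on R. *)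
Section lebesgue_rV.
Context (R : realType).

Definition cons_rV n (p : measurableTypeR R * 'rV[R]_n) : 'rV[R]_n.+1 :=
  \row_i (if unlift ord0 i is Some j then p.2 ord0 j else p.1).

Lemma measurable_coord_rV n (i : 'I_n) :
  measurable_fun [set: 'rV[R]_n] (@coord_rV R n i).
Proof.
move=> _ Y mY; rewrite setTI; apply: sub_sigma_algebra => /=.
rewrite -bigcup_seq/=; exists i => /=; first by rewrite mem_index_enum.
by exists Y => //; rewrite setTI.
Qed.

Lemma measurable_fun_rV d (T : measurableType d) n (f : T -> 'rV[R]_n) :
  (forall i, measurable_fun [set: T] (fun t => f t ord0 i)) ->
  measurable_fun [set: T] f.
Proof.
move=> mf _ A mA; rewrite setTI.
suff: g_sigma_preimage (@coord_rV R n) `<=` [set B | measurable (f @^-1` B)].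
  by apply.
apply: smallest_sub.
  split => /=.
  - by rewrite preimage_set0.
  - by move=> B mB; rewrite setTD -preimage_setC; exact: measurableC.
  - by move=> F mF; rewrite preimage_bigcup; exact: bigcup_measurable.
move=> B; rewrite -bigcup_seq => -[i _ [C mC <-]] /=.
by rewrite setTI -comp_preimage -[X in measurable X]setTI; exact: (mf i).
Qed.

Lemma measurable_cons_rV n : measurable_fun setT (@cons_rV n).
Proof.
apply: measurable_fun_rV => i; rewrite /cons_rV.
under eq_fun do rewrite mxE.
case: unliftP => [j _|_]; last exact: measurable_fst.
exact: (measurableT_comp (@measurable_coord_rV n j) measurable_snd).
Qed.

(* The library's instance is shadowed by the one for subprobabilities. *)
Lemma sigma_finite_product_measure d1 d2
    (T1 : measurableType d1) (T2 : measurableType d2)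
    (m1 : {sigma_finite_measure set T1 -> \bar R})
    (m2 : {sigma_finite_measure set T2 -> \bar R}) :
  sigma_finite setT (m1 \x m2)%E.
Proof.
have /sigma_finiteP[F [TF ndF Foo]] := sigma_finiteT m1.
have /sigma_finiteP[G [TG ndG Goo]] := sigma_finiteT m2.
exists (fun n => F n `*` G n).
  rewrite -setXTT TF TG predeqE => -[x y]; split.
    move=> [/= [n _ Fnx] [k _ Gky]]; exists (maxn n k) => //; split.
    - by move: x Fnx; exact/subsetPset/ndF/leq_maxl.
    - by move: y Gky; exact/subsetPset/ndG/leq_maxr.
  by move=> [n _ []/= ? ?]; split; exists n.
move=> k; have [? ?] := Foo k; have [? ?] := Goo k.
split; first exact: measurableX.
by rewrite product_measure1E// lte_mul_pinfty// ge0_fin_numE.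
Qed.

Section step.
Context (n : nat) (m : {sigma_finite_measure set 'rV[R]_n -> \bar R}).

Definition lebesgue_step : set 'rV[R]_n.+1 -> \bar R :=
  pushforward (lebesgue_measure \x m)%E (@cons_rV n).

Let step0 : lebesgue_step set0 = 0%E.
Proof. by rewrite /lebesgue_step /pushforward preimage_set0 measure0. Qed.

Let step_ge0 A : (0 <= lebesgue_step A)%E.
Proof. by rewrite /lebesgue_step /pushforward measure_ge0. Qed.

Let step_sigma_additive : semi_sigma_additive lebesgue_step.
Proof.
move=> F mF tF mUF; rewrite /lebesgue_step /pushforward preimage_bigcup.
have mcons A : measurable A -> measurable (@cons_rV n @^-1` A).
  by move=> mA; rewrite -[X in measurable X]setTI; exact: measurable_cons_rV.
apply: measure_semi_sigma_additive.
- by move=> k; exact: mcons.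
- apply/trivIsetP => /= i j _ _ ij; rewrite -preimage_setI.
  by move/trivIsetP : tF => /(_ _ _ _ _ ij) ->//; rewrite preimage_set0.
- by rewrite -preimage_bigcup; exact: mcons.
Qed.

HB.instance Definition _ := isMeasure.Build _ _ _ lebesgue_step
  step0 step_ge0 step_sigma_additive.

Let uncons (x : 'rV[R]_n.+1) : measurableTypeR R * 'rV[R]_n :=
  (x ord0 ord0, \row_j x ord0 (lift ord0 j)).

Let cons_rVK : cancel (@cons_rV n) uncons.
Proof.
case=> a v; rewrite /uncons /cons_rV mxE unlift_none/=; congr pair.
by apply/rowP => j; rewrite !mxE liftK.
Qed.

Let step_sigma_finite : sigma_finite setT lebesgue_step.
Proof.
have [F TF Foo] : sigma_finite setT (lebesgue_measure \x m)%E.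
  exact: sigma_finite_product_measure.
have muncons : measurable_fun setT uncons.
  apply: measurable_fun_pair.
    exact: (@measurable_coord_rV n.+1 ord0).
  apply: measurable_fun_rV => i /=.
  under eq_fun do rewrite mxE.
  exact: (@measurable_coord_rV n.+1 (lift ord0 i)).
exists (fun k => uncons @^-1` F k); first by rewrite -preimage_bigcup -TF.
move=> k; have [mFk Fkoo] := Foo k; split.
  by rewrite -[X in measurable X]setTI; exact: muncons.
rewrite /lebesgue_step /pushforward -comp_preimage.
by rewrite (_ : uncons \o @cons_rV n = id)//; apply/funext => p /=.
Qed.

HB.instance Definition _ := Measure_isSigmaFinite.Build _ _ _ lebesgue_step
  step_sigma_finite.

End step.

Fixpoint lebesgue_rV (n : nat) : {sigma_finite_measure set 'rV[R]_n -> \bar R} :=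
  if n is k.+1 then lebesgue_step (lebesgue_rV k) else dirac (0 : 'rV[R]_0).

End lebesgue_rV.

Section euclidean.
Context {R : realType} {n : nat}.

Definition dot (x y : 'rV[R]_n) : R := \sum_i x ord0 i * y ord0 i.

(* The library's norm and [ball] on 'rV[R]_n are those of the sup norm. *)
Definition enorm (x : 'rV[R]_n) : R := Num.sqrt (dot x x).

Definition eball (c : 'rV[R]_n) (r : R) : set 'rV[R]_n :=
  [set x | enorm (x - c) < r].

Definition ebounded (K : set 'rV[R]_n) : Prop :=
  exists M : R, forall x, K x -> enorm x <= M.

Definition rV_of_Zn (x : {ffun 'I_n -> int}) : 'rV[R]_n := \row_i (x i)%:~R.

(* The fundamental domain [-pi, pi)^n of the torus. *)
Definition torus : set 'rV[R]_n :=
  [set k | forall i, - pi <= k ord0 i /\ k ord0 i < pi].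

End euclidean.

Section complex_integral.
Context {R : realType}.

Definition expi (t : R) : R[i] := cos t +i* sin t.

Definition cintegral d (T : measurableType d) (mu : {measure set T -> \bar R})
    (D : set T) (f : T -> R[i]) : R[i] :=
  (\int[mu]_(x in D) complex.Re (f x)) +i* (\int[mu]_(x in D) complex.Im (f x)).

Definition cintegrable d (T : measurableType d)
    (mu : {measure set T -> \bar R}) (D : set T) (f : T -> R[i]) : Prop :=
  mu.-integrable D (fun x => (complex.Re (f x))%:E) /\
  mu.-integrable D (fun x => (complex.Im (f x))%:E).

Definition ccovariance d (T : measurableType d) (P : probability T R)
    (X Y : T -> R[i]) : R[i] :=
  cintegral P setT (fun w =>
    (X w - cintegral P setT X) * conjc (Y w - cintegral P setT Y)).

End complex_integral.

Section point_process.
Context {R : realType} {dO dE : measure_display}.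
Context {Omega : measurableType dO} {E : measurableType dE}.
Variables (P : probability Omega R) (Xi : R.-ker Omega ~> E).

(* [Xi w] is the counting measure of the configuration, possibly with
   multiplicities. *)
Definition point_process (bnd : set (set E)) : Prop :=
  forall K, measurable K -> bnd K ->
    (forall w, exists m : nat, Xi w K = m%:R%:E) /\
    (\int[P]_w (Xi w K * Xi w K) < +oo)%E.

(* The law of Xi lives on the sigma-algebra generated by the evaluations
   mu |-> mu A. *)
Definition evaluation_sets : set (set (set E -> \bar R)) :=
  [set F | exists (A : set E) (B : set (\bar R)),
    [/\ measurable A, measurable B & F = [set mu : set E -> \bar R | B (mu A)]]].

Definition translation_invariant (add : E -> E -> E) : Prop :=
  forall v F, <<s evaluation_sets >> F ->
    P [set w | F (fun A => Xi w [set x | A (add x v)])] =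
    P [set w | F (fun A => Xi w A)].

Definition has_intensity (mu : {measure set E -> \bar R}) (rho : R) : Prop :=
  forall A, measurable A -> (\int[P]_w Xi w A = rho%:E * mu A)%E.

Definition linear_statistic (phi : E -> R[i]) (w : Omega) : R[i] :=
  cintegral (Xi w) setT phi.

End point_process.

Section test_functions.
Context {R : realType} {n : nat}.

(* pderiv [:: i1; ...; ik] g is the partial derivative d_i1 ... d_ik g. *)
Fixpoint pderiv (s : seq 'I_n) (g : 'rV[R]_n -> R) : 'rV[R]_n -> R :=
  if s is i :: s' then fun x => 'D_(delta_mx ord0 i) (pderiv s' g) x else g.

Definition smooth (g : 'rV[R]_n -> R) : Prop :=
  forall s, continuous (pderiv s g) /\
    forall i x, derivable (pderiv s g) x (delta_mx ord0 i).

Definition csmooth (f : 'rV[R]_n -> R[i]) : Prop :=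
  smooth (fun x => complex.Re (f x)) /\ smooth (fun x => complex.Im (f x)).

Definition cpderiv (s : seq 'I_n) (f : 'rV[R]_n -> R[i]) (x : 'rV[R]_n) : R[i] :=
  pderiv s (fun y => complex.Re (f y)) x +i*
  pderiv s (fun y => complex.Im (f y)) x.

Definition schwartz (f : 'rV[R]_n -> R[i]) : Prop :=
  csmooth f /\
  forall s N, exists M, forall x,
    (1 + enorm x) ^+ N * normc (cpderiv s f x) <= M.

Definition tempered_distribution (T : ('rV[R]_n -> R[i]) -> R[i]) : Prop :=
  (forall (a : R[i]) f g, schwartz f -> schwartz g ->
    T (fun x => a * f x + g x) = a * T f + T g) /\
  (exists (N : nat) (C : R), forall f (M : R), schwartz f ->
    (forall s x, (size s <= N)%N ->
      (1 + enorm x) ^+ N * normc (cpderiv s f x) <= M) ->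
    normc (T f) <= C * M).

(* The test functions on Z^n: the discrete analogue of the Schwartz space. *)
Definition rapidly_decreasing (f : {ffun 'I_n -> int} -> R[i]) : Prop :=
  forall N : nat, exists M, forall x,
    (1 + enorm (rV_of_Zn x)) ^+ N * normc (f x) <= M.

(* The test functions on the torus, as 2 pi-periodic functions on R^n. *)
Definition periodic_smooth (f : 'rV[R]_n -> R[i]) : Prop :=
  csmooth f /\ forall i k, f (k + (2 * pi) *: delta_mx ord0 i) = f k.

End test_functions.

Section structure_function.
Context {R : realType} {n : nat}.
Local Notation Zn := {ffun 'I_n -> int}.

Definition fourier (f : 'rV[R]_n -> R[i]) (k : 'rV[R]_n) : R[i] :=
  cintegral (lebesgue_rV R n) setT (fun x => f x * expi (- dot k x)).

Definition fourier_torus (f : 'rV[R]_n -> R[i]) (x : Zn) : R[i] :=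
  cintegral (lebesgue_rV R n) torus
    (fun k => f k * expi (- dot (rV_of_Zn x) k)).

Definition Zn_sum (f : Zn -> R[i]) : R[i] :=
  cintegral (@counting Zn R) setT f.

Section covariance_functional.
Context {dO : measure_display} {Omega : measurableType dO}.
Variable P : probability Omega R.

(* beta is a distribution: the substitution s = u + t turns
   \iint phi(s) (psi(t))^* beta(s - t) ds dt into beta applied to
   u |-> \int phi(u + t) (psi(t))^* dt. *)
Definition covariance_functional (Xi : R.-ker Omega ~> 'rV[R]_n)
    (beta : ('rV[R]_n -> R[i]) -> R[i]) : Prop :=
  tempered_distribution beta /\
  forall phi psi, schwartz phi -> schwartz psi ->
    ccovariance P (linear_statistic Xi phi) (linear_statistic Xi psi) =
    beta (fun u => cintegral (lebesgue_rV R n) setT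
                     (fun t => phi (u + t) * conjc (psi t))).

Definition covariance_functional_Zn (Xi : R.-ker Omega ~> Zn)
    (beta : Zn -> R[i]) : Prop :=
  forall phi psi, rapidly_decreasing phi -> rapidly_decreasing psi ->
    ccovariance P (linear_statistic Xi phi) (linear_statistic Xi psi) =
    Zn_sum (fun s => Zn_sum (fun t => phi s * conjc (psi t) * beta (s - t))).

End covariance_functional.

(* S is the Fourier transform of beta in the sense of distributions:
   <S, f> = <beta, fourier f>. *)
Definition structure_function (beta : ('rV[R]_n -> R[i]) -> R[i])
    (S : {measure set 'rV[R]_n -> \bar R}) : Prop :=
  forall f, schwartz f ->
    cintegrable S setT f /\ cintegral S setT f = beta (fourier f).

(* Only the restriction of S to the fundamental domain [torus] matters. *)
Definition structure_function_Zn (beta : Zn -> R[i])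
    (S : {measure set 'rV[R]_n -> \bar R}) : Prop :=
  forall f, periodic_smooth f ->
    cintegrable S torus f /\
    cintegral S torus f = Zn_sum (fun x => beta x * fourier_torus f x).

(* The wave space is W = setT for R^n and W = torus for Z^n. *)
Definition stealthy (W : set 'rV[R]_n)
    (S : {measure set 'rV[R]_n -> \bar R}) : Prop :=
  exists U : set 'rV[R]_n, [/\ nbhs (0 : 'rV[R]_n) U, measurable U & S (U `&` W) = 0%E].

Definition max_vanishing_radius (S : {measure set 'rV[R]_n -> \bar R})
    (b : R) : Prop :=
  [/\ 0 < b, S (eball 0 b) = 0%E &
      forall r, S (eball 0 r) = 0%E -> r <= b].

(* Balls of the torus around the origin have radius at most pi, and are then
   contained in [torus]. *)
Definition max_vanishing_radius_torus (S : {measure set 'rV[R]_n -> \bar R})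
    (b : R) : Prop :=
  [/\ 0 < b <= pi, S (eball 0 b) = 0%E &
      forall r, r <= pi -> S (eball 0 r) = 0%E -> r <= b].

End structure_function.

(* Main.v *)
(** Let p >= 0 be a function on R whose Fourier transform is smooth and supported
in [-c, c] with c = b / (d + 2): the square of the Fourier transform of a bump.
The test function phi(x) = (1 - |x|^2 / r^2) p(x_1) ... p(x_d) is nonpositive
outside the ball B(0; r), its Fourier transform is supported where S vanishes,
and int phi > 0 as soon as r = C / b with C large enough.  The variance of
int phi dXi is int |phi^|^2 dS = 0, so int phi dXi = rho int phi > 0 almost
surely; but int phi dXi <= 0 when Xi has no point in B(0; r).  On Z^d the
integrals of phi become sums, computed by Poisson summation instead of Fourier
inversion; both are the case of
  int F(iota t) dt = 2 pi A(0), with F the Fourier transform of A,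
where iota is the identity or the floor function, and follow from the
convergence of Fejer means. *)

Require Import Defs.
From HB Require Import structures.
From mathcomp Require Import all_boot all_order all_algebra.
From mathcomp Require Import complex.
From mathcomp Require Import all_classical all_reals all_analysis.
From mathcomp Require Import measurable_realfun.
From mathcomp Require Import ring lra.
Import Order.TTheory GRing.Theory Num.Theory.
Import numFieldNormedType.Exports.
Set Implicit Arguments.
Unset Strict Implicit.
Unset Printing Implicit Defensive.
Local Open Scope classical_set_scope.
Local Open Scope complex_scope.
Local Open Scope ring_scope.

(** * Smooth functions and integrals on the line *)

(** Multiplying [p] by x^2 replaces its spectrum [W] by V = -W'', which does not enlarge the
    support. This makes a quadratic cutoff affordable, and makes [phi] a sum of n + 1 separable
    terms whose factors have spectrum [W] or [V]. Its integral is proportional to W 0 - n V 0 / r^2,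
    and V 0 / W 0 scales like c^-2, which forces r to be of order 1 / b. One obstacle is that [beta]
    is known only through its action on test functions. The variance is therefore reached through a
    test function [fhat], the squared spectrum up to a constant, whose Fourier transform is the
    autocorrelation of [phi]: the variance is [beta] applied to that transform, that is, the
    integral of [fhat] against [S]. Another obstacle is that integrals take default values: a
    vanishing covariance says nothing until the linear statistic is known to be square integrable.
    This is obtained by cutting space into unit cells, whose counts have the same second moment by
    invariance, and weighting the cells by a summable sequence. *)

Section smooth_functions.
Context {R : realType}.
Implicit Types f g : R -> R.

Record cinf f : Prop := Cinf { cinfP : forall n (x : R), derivable (derive1n n f) x 1 }.
Arguments cinfP {f} _ n x.

(** Coinduction for smoothness: a class stable under derivation contains only smooth functions. Each
    use below chooses a class whose general member has an explicit form, so that no formula for a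
    higher derivative is ever needed. *)
Lemma cinf_class (C : set (R -> R)) :
  (forall f, C f -> exists2 g, C g & forall x : R, is_derive x 1 f (g x)) ->
  forall f, C f -> cinf f.
Proof.
move=> CC f Cf; split => n; suff : C (derive1n n f).
  by move=> /CC[g _ dg] x; have [] := dg x.
elim: n => [|n IH]; first by rewrite derive1n0.
have [g Cg dg] := CC _ IH.
rewrite derive1nS (_ : derive1 _ = g)//; apply/funext => x.
by rewrite derive1E; have [_ ->] := dg x.
Qed.

Lemma cinf_is_derive f (x : R) : cinf f -> is_derive x 1 f ((derive1 f) x).
Proof.
move=> /cinfP/(_ 0%N x); rewrite derive1n0 => df; rewrite derive1E.
exact: DeriveDef.
Qed.

Lemma cinf_derive f : cinf f -> cinf (derive1 f).
Proof. by move=> cf; split => n x; have := cinfP cf n.+1 x; rewrite /derive1n iterSr. Qed.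

Lemma cinf_derive1n f n : cinf f -> cinf (derive1n n f).
Proof.
by move=> cf; elim: n => [//|n IH]; rewrite derive1nS; exact: cinf_derive.
Qed.

Lemma cinf_continuous f : cinf f -> continuous f.
Proof.
move=> cf x; apply: differentiable_continuous; apply/derivable1_diffP.
exact: cinfP cf 0%N x.
Qed.

Lemma is_derive_cinf f g : (forall x : R, is_derive x 1 f (g x)) -> cinf g -> cinf f.
Proof.
move=> dfg cg; apply: (@cinf_class [set h | h = f \/ cinf h]); last by left.
move=> h [->|ch]; first by exists g => //; right.
exists (derive1 h); first by right; exact: cinf_derive.
by move=> x; exact: cinf_is_derive.
Qed.

Lemma derive1_is_derive f g : (forall x : R, is_derive x 1 f (g x)) -> (derive1 f) = g.
Proof.
by move=> dfg; apply/funext => x; rewrite derive1E; have [_ ->] := dfg x.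
Qed.

Lemma cinf_cst (a : R) : cinf (fun=> a).
Proof.
apply: (@cinf_class [set h | exists a, h = fun=> a]); last by exists a.
move=> _ [b ->]; exists (fun=> 0); first by exists 0.
by move=> x; exact: is_derive_cst.
Qed.

Lemma cinf_id : cinf (@id R).
Proof.
apply: (@is_derive_cinf _ (fun=> 1)); last exact: cinf_cst.
Qed.

(** Products of smooth functions are not stable under derivation, but by the Leibniz rule their sums
    are; this is the class to give to [cinf_class]. *)
Inductive sums_of_products : set (R -> R) :=
| sop_mul f g : cinf f -> cinf g -> sums_of_products (fun x => f x * g x)
| sop_add f g : sums_of_products f -> sums_of_products g ->
    sums_of_products (fun x => f x + g x).

Let cinf_sop f : sums_of_products f -> cinf f.
Proof.
apply: cinf_class => {}f; elim => {f} [f g cf cg|f g _ [f' Cf' df] _ [g' Cg' dg]].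
- exists (fun x => (derive1 f) x * g x + f x * (derive1 g) x).
    by apply: sop_add; apply: sop_mul => //; exact: cinf_derive.
  move=> x; have := cinf_is_derive x cf; have := cinf_is_derive x cg => ? ?.
  apply: is_derive_eq.
  by rewrite /GRing.scale/= addrC mulrC.
- exists (fun x => f' x + g' x); first exact: sop_add.
  by move=> x; exact: is_deriveD.
Qed.

Lemma cinfM f g : cinf f -> cinf g -> cinf (fun x => f x * g x).
Proof. by move=> cf cg; apply: cinf_sop; exact: sop_mul. Qed.

Lemma cinfZ a f : cinf f -> cinf (fun x => a * f x).
Proof. by move=> cf; apply: cinfM => //; exact: cinf_cst. Qed.

Lemma is_derive_affine f (a b x : R) : cinf f ->
  is_derive x 1 (fun y => f (a * y + b)) (a * (derive1 f) (a * x + b)).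
Proof.
move=> cf; have := cinf_is_derive (a * x + b) cf => ?.
have : is_derive x 1 (fun y => a * y + b) a.
  by apply: is_derive_eq; rewrite addr0 /GRing.scale/= mulr1.
move=> ?.
rewrite mulrC; exact: (@is_derive1_comp _ f (fun y => a * y + b) x).
Qed.

Lemma cinf_affine f (a b : R) : cinf f -> cinf (fun x => f (a * x + b)).
Proof.
move=> cf; apply: (@cinf_class
    [set h | exists2 g, cinf g & h = fun x => g (a * x + b)]); last by exists f.
move=> _ [g cg ->]; exists (fun x => (a * (derive1 g) (a * x + b))).
  exists (fun y => a * (derive1 g) y) => //; apply: cinfZ; exact: cinf_derive.
move=> x; exact: is_derive_affine.
Qed.

End smooth_functions.

Arguments cinfP {R f} _ n x.

(** * Change of variables along a measure-preserving map *)

Section measure_preserving.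
Context d1 d2 (X : measurableType d1) (Y : measurableType d2) (R : realType).
Variables (mu : {measure set X -> \bar R}) (nu : {measure set Y -> \bar R}).
Variable phi : X -> Y.
Hypothesis mphi : measurable_fun [set: X] phi.
Hypothesis mp : forall A, measurable A -> mu (phi @^-1` A) = nu A.

Lemma ge0_integral_mp (f : Y -> \bar R) : measurable_fun [set: Y] f ->
  (forall y, 0 <= f y)%E -> (\int[nu]_y f y = \int[mu]_x f (phi x))%E.
Proof.
move=> mf f0; rewrite -[RHS](@ge0_integral_pushforward _ _ _ _ _ _ mphi mu setT f)//.
by apply: eq_measure_integral => A mA _; rewrite -mp.
Qed.

Lemma integral_mp (f : Y -> \bar R) : measurable_fun [set: Y] f ->
  (\int[nu]_y f y = \int[mu]_x f (phi x))%E.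
Proof.
move=> mf; rewrite integralE [RHS]integralE.
rewrite (ge0_integral_mp (measurable_funepos mf))//.
rewrite (ge0_integral_mp (measurable_funeneg mf))//.
by congr (_ - _)%E; apply: eq_integral => x _; rewrite !(funeposE, funenegE).
Qed.

Lemma Rintegral_mp (f : Y -> R) : measurable_fun [set: Y] f ->
  \int[nu]_y f y = \int[mu]_x f (phi x).
Proof.
by move=> mf; rewrite /Rintegral integral_mp//; exact/measurable_EFinP.
Qed.

Lemma integrable_mp (f : Y -> \bar R) : measurable_fun [set: Y] f ->
  nu.-integrable setT f <-> mu.-integrable setT (f \o phi).
Proof.
move=> mf; split => /integrableP[_ foo]; apply/integrableP.
- split; first exact: measurableT_comp.
  rewrite -[X in (X < _)%E](ge0_integral_mp (f := abse \o f))//.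
    by apply: (measurableT_comp _ mf).
  by move=> y; exact: abse_ge0.
- split => //; rewrite (ge0_integral_mp (f := abse \o f))//.
    by apply: (measurableT_comp _ mf).
  by move=> y; exact: abse_ge0.
Qed.

End measure_preserving.

Section integrable_real.
Context d (T : measurableType d) (R : realType).
Variable mu : {measure set T -> \bar R}.
Implicit Types f g : T -> R.

Lemma integrableM_bounded f g (M : R) : mu.-integrable setT (EFin \o f) ->
  measurable_fun setT g -> (forall x, `|g x| <= M) ->
  mu.-integrable setT (EFin \o (fun x => f x * g x)).
Proof.
move=> fi mg gM; have := @integrableMl _ _ _ mu setT measurableT (EFin \o f) g fi mg _.
rewrite /comp/=; apply.
exists M; split; first exact: num_real.
by move=> x /ltW Mx y _ /=; apply: le_trans Mx.
Qed.

Lemma integrableZlR f (a : R) : mu.-integrable setT (EFin \o f) ->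
  mu.-integrable setT (EFin \o (fun x => a * f x)).
Proof. by move=> fi; have := integrableZl measurableT a fi. Qed.

Lemma integrableDR f g : mu.-integrable setT (EFin \o f) ->
  mu.-integrable setT (EFin \o g) ->
  mu.-integrable setT (EFin \o (fun x => f x + g x)).
Proof. by move=> fi gi; have := integrableD measurableT fi gi. Qed.

Lemma integrable_measurableR f : mu.-integrable setT (EFin \o f) ->
  measurable_fun setT f.
Proof. by move=> /measurable_int/measurable_EFinP. Qed.

Lemma le_integrableR f g : measurable_fun setT f ->
  (forall x, `|f x| <= g x) -> mu.-integrable setT (EFin \o g) ->
  mu.-integrable setT (EFin \o f).
Proof.
move=> mf fg; apply: le_integrable => //; first exact/measurable_EFinP.
by move=> x _; rewrite /= lee_fin (le_trans (fg x))// ler_norm.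
Qed.

Lemma eq_RintegralT f g : f =1 g -> \int[mu]_x f x = \int[mu]_x g x.
Proof. by move=> fg; apply: eq_Rintegral => x _. Qed.

Lemma RintegralDT f g : mu.-integrable setT (EFin \o f) ->
  mu.-integrable setT (EFin \o g) ->
  \int[mu]_x (f x + g x) = \int[mu]_x f x + \int[mu]_x g x.
Proof. by move=> ? ?; rewrite RintegralD. Qed.

End integrable_real.

(** * Lebesgue integration on the line and compact supports *)

Section lebesgue_line.
Context {R : realType}.
Local Notation mu := (@lebesgue_measure R).
Implicit Types f g A : R -> R.

Let shift (a : R) : measurableTypeR R -> measurableTypeR R := fun x => x + a.

Let measurable_shift a : measurable_fun [set: measurableTypeR R] (shift a).
Proof. exact: measurable_funD. Qed.

Let shift_mp a (B : set (measurableTypeR R)) : measurable B ->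
  mu (shift a @^-1` B) = mu B.
Proof.
move=> mB.
pose mixin := isMeasurableFun.Build _ _ _ _ _ (measurable_shift a).
pose pack : {mfun _ >-> _} := HB.pack (shift a) mixin.
apply/esym; rewrite -[RHS]/(pushforward mu pack B).
apply: lebesgue_measure_unique => //= _ [[b c]] _ <-.
rewrite /pushforward (_ : _ @^-1` _ = `]b - a, c - a]%classic); last first.
  by apply/seteqP; split => x /=; rewrite !in_itv/= ltrBlDr lerBrDr.
rewrite /= !lebesgue_measure_itv/= !lte_fin ltrD2r.
by case: ifP => // _; rewrite -!EFinB; congr (_%:E); ring.
Qed.

Lemma Rintegral_shift f (a : R) : measurable_fun setT f ->
  \int[mu]_x f (x + a) = \int[mu]_x f x.
Proof.
move=> mf; apply/esym; exact: (Rintegral_mp (measurable_shift a) (@shift_mp a)).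
Qed.

Lemma integrable_shift f (a : R) : mu.-integrable setT (EFin \o f) ->
  mu.-integrable setT (EFin \o (fun x => f (x + a))).
Proof.
move=> fi.
by have := (integrable_mp (measurable_shift a) (@shift_mp a) (measurable_int _ fi)).1 fi.
Qed.

Lemma Rintegral_opp f : measurable_fun setT f ->
  \int[mu]_x f (- x) = \int[mu]_x f x.
Proof.
move=> mf; apply/esym.
have ma : measurable_fun [set: measurableTypeR R] (-%R : measurableTypeR R -> measurableTypeR R).
  exact: oppr_measurable.
apply: (Rintegral_mp ma _ mf) => A mA; exact: lebesgue_measureN.
Qed.

Lemma Rintegral_odd f : measurable_fun setT f -> (forall x, f (- x) = - f x) ->
  mu.-integrable setT (EFin \o f) -> \int[mu]_x f x = 0.
Proof.
move=> mf fN fi; have := Rintegral_opp mf.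
under eq_RintegralT do rewrite fN -mulN1r.
rewrite RintegralZl// mulN1r => h; lra.
Qed.

Lemma continuous_measurableR f : continuous f -> measurable_fun setT f.
Proof. by move=> cf; apply: continuous_measurable_fun. Qed.

Definition csupp (c : R) A := forall x, c < `|x| -> A x = 0.

Lemma csupp_bounded c A : continuous A -> csupp c A -> exists M : R, forall x, `|A x| <= M.
Proof.
move=> cA sA.
have /compact_bounded[M [_ hM]] : compact (A @` `[- c, c]).
  by apply: continuous_compact; [exact: continuous_subspaceT|exact: segment_compact].
exists (Num.max 0 (M + 1)) => x; rewrite le_max.
have [xc|xc] := leP `|x| c; last by rewrite sA// normr0 lexx.
apply/orP; right; apply: (hM (M + 1)); first by rewrite ltrDl.
by exists x => //=; rewrite in_itv/= -ler_norml.
Qed.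

Lemma csupp_integrable c A : continuous A -> csupp c A ->
  mu.-integrable setT (EFin \o A).
Proof.
move=> cA sA.
have : mu.-integrable `[-c, c] (EFin \o A).
  apply: continuous_compact_integrable; first exact: segment_compact.
  exact: continuous_subspaceT.
rewrite -[X in mu.-integrable X _](setTI).
move/(integrable_restrict mu (@measurable_itv R `[-c, c]) measurableT).
apply: eq_integrable => // x _ /=; rewrite patchE; case: ifPn => //.
rewrite notin_setE/= in_itv/= -ler_norml => /negP; rewrite -ltNge => /sA ->//.
Qed.

Lemma csuppM c A f : csupp c A -> csupp c (fun x => A x * f x).
Proof. by move=> sA x /sA ->; rewrite mul0r. Qed.

Lemma Rintegral_csupp c A : csupp c A -> \int[mu]_x A x = \int[mu]_(x in `[-c, c]) A x.
Proof.
move=> sA; rewrite [RHS]Rintegral_mkcond; apply: eq_RintegralT => x.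
rewrite patchE; case: ifPn => //.
by rewrite notin_setE/= in_itv/= -ler_norml => /negP; rewrite -ltNge => /sA.
Qed.

(** Differentiation under the integral sign. The bound on [H'] is asked only after multiplication by
    [A], because in the main use [H'] is k cos (k x + th), which is unbounded in k but controlled on
    the support of [A]. *)
Lemma is_derive_Rintegral d (T : measurableType d) (nu : {measure set T -> \bar R})
    (A : T -> R) (H H' : R -> T -> R) (M : R) (x : R) :
  nu.-integrable setT (EFin \o A) ->
  (forall (x : R) k, is_derive x 1 (H ^~ k) (H' x k)) ->
  (forall x k, `|H x k| <= M) -> (forall x k, `|A k * H' x k| <= M * `|A k|) ->
  (forall x, measurable_fun setT (H x)) ->
  is_derive x 1 (fun x => \int[nu]_k (A k * H x k)) (\int[nu]_k (A k * H' x k)).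
Proof.
move=> Ai dH HM H'M mH.
pose f x k := A k * H x k.
have df (y : R) k : is_derive y 1 (f ^~ k) (A k * H' y k).
  rewrite /f; have ? := dH y k; apply: is_derive_eq.
  by [].
have d1 y k : partial1of2 f y k = A k * H' y k.
  by rewrite partial1of2E; have [_ ->] := df y k.
have Ix : `]x - 1, x + 1[%classic x by rewrite /= in_itv/= ltrBlDr ltrDl ltr01.
have fi y : `]x - 1, x + 1[%classic y -> nu.-integrable setT (EFin \o f y).
  by move=> _; apply: (@integrableM_bounded _ _ _ _ _ _ M).
have derf y k : `]x - 1, x + 1[%classic y -> setT k -> derivable (f ^~ k) y 1.
  by move=> _ _; have [] := df y k.
have G0 k : 0 <= `|A k| * `|M| by rewrite mulr_ge0.
have Gi : nu.-integrable setT (EFin \o (fun k => `|A k| * `|M|)).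
  apply: (@integrableM_bounded _ _ _ _ _ _ `|M|) => //.
    exact: (integrable_norm Ai).
  by move=> k; rewrite normr_id.
have Gub y k : `]x - 1, x + 1[%classic y -> setT k ->
    `|partial1of2 f y k| <= `|A k| * `|M|.
  move=> _ _; rewrite d1 (le_trans (H'M _ _))// mulrC ler_wpM2l//.
  exact: ler_norm.
have D := @derivable_under_integral _ _ _ nu f setT measurableT x _ _ Ix fi derf _ G0 Gi Gub.
have E := @differentiation_under_integral _ _ _ nu f setT measurableT x _ _ Ix fi derf _ G0 Gi Gub.
apply: DeriveDef => //.
by rewrite -derive1E E; apply: eq_RintegralT => k; rewrite d1.
Qed.

Lemma csupp_derive c A : cinf A -> csupp c A -> csupp c (derive1 A).
Proof.
move=> cA sA x cx; rewrite derive1E.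
have : \forall y \near x, A y = cst 0 y.
  have : \forall y \near x, c < `|y|.
    have n := cvg_norm (@cvg_id _ (nbhs x)).
    exact: (cvgr_gt _ (n _) _ cx).
  by apply: filterS => y /sA.
by move=> /near_eq_derive ->; rewrite ?oner_neq0 ?derive_cst.
Qed.

Lemma Rintegration_by_parts_csupp c A f (f' : R -> R) : cinf A -> csupp c A ->
  (forall x : R, is_derive x 1 f (f' x)) -> continuous f' ->
  \int[mu]_k (A k * f' k) = - \int[mu]_k (derive1 A k * f k).
Proof.
move=> cA sA df cf'.
(* The interval is enlarged to radius [|c| + 1]: it is then nondegenerate whatever the sign of [c],
   and [A] vanishes at its end points, which kills the boundary terms. *)
have s1 g : csupp c g -> csupp (`|c| + 1) g.
  move=> sg x hx; apply: sg; apply: le_lt_trans hx; have := ler_norm c; lra.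
have dfc : continuous f.
  move=> x; apply: differentiable_continuous; apply/derivable1_diffP.
  by have [] := df x.
have e1 : 0 < `|c| + 1 by rewrite ltr_wpDl.
have e2 : forall g, csupp c g -> g (`|c| + 1) = 0 /\ g (- (`|c| + 1)) = 0.
  move=> g sg; split; apply: sg; rewrite ?normrN gtr0_norm//; have := ler_norm c; lra.
rewrite (Rintegral_csupp (s1 _ (csuppM _ sA))).
rewrite (Rintegral_csupp (s1 _ (csuppM _ (csupp_derive cA sA)))).
rewrite (@Rintegration_by_parts _ A f (derive1 A) f')//.
- by rewrite (e2 _ sA).1 (e2 _ sA).2 !mul0r subrr sub0r.
- lra.
- by apply: continuous_subspaceT; apply: cinf_continuous; exact: cinf_derive.
- split.
  + by move=> x _; exact: cinfP cA 0%N x.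
  + by apply: cvg_at_right_filter; exact: cinf_continuous.
  + by apply: cvg_at_left_filter; exact: cinf_continuous.
- exact: continuous_subspaceT.
- split.
  + by move=> x _; have [] := df x.
  + by apply: cvg_at_right_filter; exact: dfc.
  + by apply: cvg_at_left_filter; exact: dfc.
- by move=> x _; rewrite derive1E; have [_ ->] := df x.
Qed.

End lebesgue_line.

(** * A smooth bump function *)

Section bump.
Context {R : realType}.
Implicit Types f g : R -> R.

Lemma is_derive_quadratic f (K : R) : (forall h, `|f h| <= K * h ^+ 2) ->
  is_derive (0 : R) 1 f 0.
Proof.
move=> fK; have f0 : f 0 = 0.
  by apply/eqP; rewrite -normr_le0; have := fK 0; rewrite expr0n/= mulr0.
have lim : (fun h : R => h^-1 *: (f (h *: 1 + 0) - f 0)) @ 0^' --> (0 : R).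
  apply/cvgr0Pnorm_lt => e e0; near=> h.
  have hn0 : h != 0 by near: h; exact: nbhs_dnbhs_neq.
  rewrite f0 subr0 addr0 /GRing.scale/= mulr1 normrM normfV.
  rewrite ltr_pdivrMl ?normr_gt0//.
  apply: le_lt_trans (fK h) _; rewrite -(real_normK (num_real h)) expr2.
  have : K * `|h| < e.
    rewrite (@le_lt_trans _ _ ((`|K| + 1) * `|h|))//.
      by rewrite ler_wpM2r//; have := ler_norm K; lra.
    rewrite -ltr_pdivlMl; last by rewrite ltr_wpDl.
    near: h; apply: dnbhs0_lt; rewrite mulr_gt0// invr_gt0 ltr_wpDl//.
  by move=> ?; rewrite mulrA mulrC ltr_pM2l// normr_gt0.
split; first by apply/cvg_ex; exists 0.
exact/cvg_lim.
Unshelve. all: by end_near. Qed.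

(* The powers of [t^-1] close the family under derivation. *)
Definition flat (n : nat) (t : R) : R :=
  if 0 < t then t^-1 ^+ n * expR (- t^-1) else 0.

(** With s = 1 / t, one term of the exponential series gives s^(n+2) <= (n+2)! exp s, hence s^n exp
    (-s) <= (n+2)! t^2. A quadratic bound is what makes the derivative at the junction 0 exist and
    vanish. *)
Lemma flat_quadratic n t : `|flat n t| <= (n.+2)`!%:R * t ^+ 2.
Proof.
rewrite /flat; case: ifPn => t0; last by rewrite normr0 mulr_ge0// sqr_ge0.
have s0 : 0 < t^-1 by rewrite invr_gt0.
rewrite ger0_norm ?mulr_ge0 ?expR_ge0 ?exprn_ge0 ?(ltW s0)//.
have := expR_ge1Dxn n.+1 (ltW s0) => h.
have : t^-1 ^+ n.+2 <= (n.+2)`!%:R * expR t^-1.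
  rewrite -ler_pdivrMl ?ltr0n ?fact_gt0// mulrC.
  by apply: le_trans h; rewrite lerDr.
rewrite expRN => {}h.
rewrite ler_pdivrMr ?expR_gt0// mulrAC -ler_pdivrMr ?exprn_gt0//.
by rewrite -exprVn -exprD addn2.
Qed.

Lemma is_derive_flat n (t : R) :
  is_derive t 1 (flat n) (flat n.+2 t - n%:R * flat n.+1 t).
Proof.
have [t0|t0|->] := ltgtP t 0.
- apply: (@near_eq_is_derive _ _ _ (cst 0)).
    near=> x; rewrite /flat/= ifN//.
    rewrite -leNgt ltW//; near: x; exact: lt_nbhsl.
  have fl m : flat m t = 0 by rewrite /flat ifN// -leNgt ltW.
  by rewrite !fl mulr0 subr0; exact: is_derive_cst.
- apply: (@near_eq_is_derive _ _ _ (fun t : R => t^-1 ^+ n * expR (- t^-1) : R)).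
    near=> x; rewrite /flat/= ifT//.
    near: x; exact: lt_nbhsr.
  have tn0 : t != 0 by rewrite gt_eqF.
  have dV : is_derive t 1 (fun t : R => t^-1) (- t ^- 2).
    have := @is_deriveV _ id t 1 1 tn0 (is_derive_id _ _).
    by move=> d; apply: is_derive_eq; exact: mulr1.
  have dX := @is_deriveX _ _ (fun t : R => t^-1) n t 1 _ dV.
  have dN := @is_deriveN _ _ _ (fun t : R => t^-1) t 1 _ dV.
  have dE := @is_derive1_comp _ expR (- (fun t : R => t^-1)) t _ _ (is_derive_expR _) dN.
  have := is_deriveM dX dE; rewrite !fctE /= => d.
  apply: (@DeriveDef _ _ _ _ _ (fun t1 : R => t1^-1 ^+ n * expR (- t1^-1))).
    exact: (@ex_derive _ _ _ _ _ _ _ d).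
  rewrite (@derive_val _ _ _ _ _ _ _ d).
  rewrite /flat t0 /GRing.scale/=.
  rewrite -exprVn; clear; move: (expR (- t^-1)) => E; move: t^-1 => v.
  by case: (n) => [|m]; rewrite ?exprS/=; ring.
- rewrite /flat ltxx mulr0 subr0.
  exact: is_derive_quadratic (flat_quadratic n).
Unshelve. all: by end_near. Qed.

Inductive flat_span : set (R -> R) :=
| flat_base n : flat_span (flat n)
| flat_add f g (c : R) : flat_span f -> flat_span g ->
    flat_span (fun t => f t + c * g t).

Lemma cinf_flat n : cinf (flat n).
Proof.
apply: (@cinf_class _ flat_span); last exact: flat_base.
move=> f; elim => {f} [m|f g c _ [f' Sf' df] _ [g' Sg' dg]].
  exists (fun t => flat m.+2 t + (- m%:R) * flat m.+1 t).
    by apply: flat_add; exact: flat_base.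
  by move=> x; rewrite mulNr; exact: is_derive_flat.
exists (fun t => f' t + c * g' t); first exact: flat_add.
move=> x; have ? := df x; have ? := dg x; apply: is_derive_eq.
by rewrite /GRing.scale.
Qed.

Definition bump (x : R) : R := flat 0 (x + 1) * flat 0 (- x + 1).

Lemma cinf_bump : cinf bump.
Proof.
apply: cinfM.
  by have := cinf_affine 1 1 (cinf_flat 0); under eq_fun do rewrite mul1r.
by have := cinf_affine (- 1) 1 (cinf_flat 0); under eq_fun do rewrite mulN1r.
Qed.

Lemma csupp_bump : csupp 1 bump.
Proof.
move=> x; rewrite /bump /flat ltNge ler_norml negb_and -!ltNge => /orP[x1|x1].
  by rewrite ifN ?mul0r// -leNgt; lra.
by rewrite [X in _ * X]ifN ?mulr0// -leNgt; lra.
Qed.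

End bump.

(** * Fubini's theorem under domination by a product *)

Section Rfubini.
Context d1 d2 (T1 : measurableType d1) (T2 : measurableType d2) (R : realType).
Variables (m1 : {sigma_finite_measure set T1 -> \bar R})
          (m2 : {sigma_finite_measure set T2 -> \bar R}).
Variables (f : T1 * T2 -> R) (a : T1 -> R) (b : T2 -> R).
Hypothesis mf : measurable_fun setT f.
Hypothesis ai : m1.-integrable setT (EFin \o a).
Hypothesis bi : m2.-integrable setT (EFin \o b).
Hypothesis fab : forall x y, `|f (x, y)| <= a x * b y.

Lemma integrable_prod_dominated : (m1 \x m2)%E.-integrable setT (EFin \o f).
Proof.
apply/integrable12ltyP; first exact/measurable_EFinP.
have ma := integrable_measurableR ai; have mb := integrable_measurableR bi.
apply: (@le_lt_trans _ _ (\int[m1]_x \int[m2]_y (`|a x| * `|b y|)%:E)%E).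
  apply: ge0_le_integral => //.
  - by move=> x _; exact: integral_ge0.
  - apply: (@measurable_fun_fubini_tonelli_F _ _ T1 T2 R m2 (fun z => (`|f z|)%:E)) => //=.
    by apply/measurable_EFinP; exact: measurableT_comp.
  - have -> : (fun x => \int[m2]_y (`|a x| * `|b y|)%:E)%E =
        (fun x => (`|a x|)%:E * \int[m2]_y (`|b y|)%:E)%E.
      apply/funext => x; under eq_integral do rewrite EFinM.
      rewrite ge0_integralZl//.
      by apply/measurable_EFinP; exact: measurableT_comp.
    apply: emeasurable_funM => //.
    by apply/measurable_EFinP; exact: measurableT_comp.
  - move=> x _; apply: ge0_le_integral => //.
    + apply/measurable_EFinP; apply: measurableT_comp => //.
      exact: measurableT_comp.
    + apply/measurable_EFinP; apply: measurable_funM => //.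
      exact: measurableT_comp.
    + by move=> y _; rewrite lee_fin/= (le_trans (fab x y))// -normrM ler_norm.
under eq_integral => x _.
  under eq_integral do rewrite EFinM.
  rewrite ge0_integralZl//; first over.
  by apply/measurable_EFinP; exact: measurableT_comp.
rewrite ge0_integralZr//; last 2 first.
- by apply/measurable_EFinP; exact: measurableT_comp.
- by apply: integral_ge0.
have /integrableP[_ +] := ai; have /integrableP[_ +] := bi.
rewrite -ge0_fin_numE ?integral_ge0// => bf.
rewrite -ge0_fin_numE ?integral_ge0// => af.
by rewrite -ge0_fin_numE ?mule_ge0 ?integral_ge0// fin_numM.
Qed.

Lemma integrable_fubini1 x : m2.-integrable setT (EFin \o (fun y => f (x, y))).
Proof.
apply: (@le_integrableR _ _ _ _ _ (fun y => a x * b y)).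
- exact: measurableT_comp.
- by move=> y; exact: fab.
- exact: integrableZlR.
Qed.

Lemma integrable_fubini2 y : m1.-integrable setT (EFin \o (fun x => f (x, y))).
Proof.
apply: (@le_integrableR _ _ _ _ _ (fun x => b y * a x)).
- exact: measurableT_comp.
- by move=> x; rewrite mulrC; exact: fab.
- exact: integrableZlR.
Qed.

(** The domination holds at every point, so every section is integrable, not merely almost every
    one. The inner real integrals are then the finite parts of finite extended ones everywhere, and
    the extended Fubini theorem applies. *)
Lemma Rfubini :
  \int[m1]_x \int[m2]_y f (x, y) = \int[m2]_y \int[m1]_x f (x, y).
Proof.
have := Fubini integrable_prod_dominated => h.
rewrite /Rintegral; congr fine.
transitivity (\int[m1]_x \int[m2]_y (EFin \o f) (x, y))%E.
  apply: eq_integral => x _; rewrite fineK//.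
  exact: (integrable_fin_num measurableT (integrable_fubini1 x)).
rewrite h; apply: eq_integral => y _; rewrite fineK//.
exact: (integrable_fin_num measurableT (integrable_fubini2 y)).
Qed.

End Rfubini.

(** * Cosine transforms *)

Section cinf_cos.
Context {R : realType}.

(** Derivatives are written as quarter-turn phase shifts, so that cosines with a phase form a class
    stable under derivation. *)
Lemma is_derive_cosD (th x : R) :
  is_derive x 1 (fun x => cos (x + th)) (cos (x + (th + pi / 2))).
Proof.
have d : is_derive x 1 (fun x : R => x + th) 1.
  by apply: is_derive_eq; rewrite addr0.
have := @is_derive1_comp _ cos (fun x : R => x + th) x _ _ (is_derive_cos _) d.
by rewrite mulr1 addrA cosDpihalf.
Qed.

Lemma cinf_cosD (th : R) : cinf (fun x => cos (x + th)).
Proof.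
apply: (@cinf_class _ [set h | exists th, h = fun x => cos (x + th)]); last by exists th.
move=> _ [t ->]; exists (fun x => cos (x + (t + pi / 2))).
  by exists (t + pi / 2).
by move=> x; exact: is_derive_cosD.
Qed.

Lemma is_derive_cos_affine (k th x : R) :
  is_derive x 1 (fun x => cos (k * x + th)) (k * cos (k * x + (th + pi / 2))).
Proof.
have := is_derive_affine k 0 x (cinf_cosD th).
rewrite (derive1_is_derive (is_derive_cosD th)) addr0.
by under eq_fun do rewrite addr0.
Qed.

End cinf_cos.

Section cosine_transform.
Context {R : realType}.
Local Notation mu := (@lebesgue_measure R).
Implicit Types f g A B : R -> R.

(* The phase [th] gives access to sines and to derivatives. *)
Definition ct A (th x : R) : R := \int[mu]_k (A k * cos (k * x + th)).

Lemma measurable_cos_affine (x th : R) : measurable_fun setT (fun k : R => cos (k * x + th)).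
Proof.
apply: measurableT_comp; first exact: continuous_measurableR (@continuous_cos R).
by apply: measurable_funD => //; exact: measurable_funM.
Qed.

Lemma ct_integrable A th x : mu.-integrable setT (EFin \o A) ->
  mu.-integrable setT (EFin \o (fun k => A k * cos (k * x + th))).
Proof.
move=> Ai; apply: (integrableM_bounded (M := 1 : R)) => //.
  exact: measurable_cos_affine.
by move=> k; exact: cos_max.
Qed.

Lemma ct_bounded A : mu.-integrable setT (EFin \o A) ->
  exists M : R, forall th x, `|ct A th x| <= M.
Proof.
move=> Ai; exists (\int[mu]_k `|A k|) => th x; rewrite /ct.
rewrite (le_trans (le_normr_Rintegral _ (ct_integrable th x Ai)))//.
apply: le_Rintegral => //; try exact: integrable_norm.
  exact: (integrable_norm (ct_integrable th x Ai)).
by move=> k _; rewrite normrM ler_piMr// cos_max.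
Qed.

Lemma is_derive_ct c A th (x : R) : continuous A -> csupp c A ->
  is_derive x 1 (ct A th) (ct (fun k => A k * k) (th + pi / 2) x).
Proof.
move=> cA sA.
rewrite (_ : ct _ _ x = \int[mu]_k (A k * (k * cos (k * x + th + pi / 2)))); last first.
  by apply: eq_RintegralT => k; rewrite addrA mulrA.
have := @is_derive_Rintegral R _ _ mu A (fun x k => cos (k * x + th))
  (fun x k => k * cos (k * x + th + pi / 2)) (Num.max 1 `|c|) x.
apply; first exact: csupp_integrable sA.
- by move=> y k; rewrite -addrA; exact: is_derive_cos_affine.
- by move=> y k; rewrite le_max cos_max.
- move=> y k; have [kc|/sA->] := leP `|k| c; last by rewrite mul0r normr0 mulr0.
  rewrite normrM mulrC ler_wpM2r// le_max; apply/orP; right.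
  rewrite normrM (le_trans (ler_piMr _ (cos_max _)))//.
  by rewrite (le_trans kc)// ler_norm.
- by move=> y; exact: measurable_cos_affine.
Qed.

(** Integration by parts: x cos (k x + th) is the derivative in k of cos (k x + th - pi / 2), and
    the minus sign of the formula turns the phase - pi / 2 into + pi / 2. *)
Lemma ct_mulx c A th x : cinf A -> csupp c A ->
  x * ct A th x = ct (derive1 A) (th + pi / 2) x.
Proof.
move=> cA sA; have Ai := csupp_integrable (cinf_continuous cA) sA.
rewrite -RintegralZl//; last exact: ct_integrable.
under eq_RintegralT do rewrite mulrCA.
have dsin (k : R) : is_derive k 1 (fun k => cos (x * k + (th - pi / 2))) (x * cos (k * x + th)).
  have := is_derive_cos_affine x (th - pi / 2) k.
  by rewrite subrK (mulrC x k).
rewrite (Rintegration_by_parts_csupp cA sA dsin); last first.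
  move=> k; apply: cvgM; first exact: cvg_cst.
  apply: continuous_comp; last exact: continuous_cos.
  by apply: cvgD; [apply: cvgMl; exact: cvg_id|exact: cvg_cst].
have sB := csupp_derive cA sA.
have Bi := csupp_integrable (cinf_continuous (cinf_derive cA)) sB.
rewrite -mulN1r -RintegralZl//.
  apply: eq_RintegralT => k; rewrite mulN1r -mulrN; congr (_ * _).
  by rewrite addrA cosBpihalf addrA cosDpihalf mulrC.
apply: (integrableM_bounded (M := 1 : R)) => //.
  have := measurable_cos_affine x (th - pi / 2).
  by under eq_fun do rewrite mulrC.
by move=> k; exact: cos_max.
Qed.

Lemma ct_cinf c A th : cinf A -> csupp c A -> cinf (ct A th).
Proof.
move=> cA sA; apply: (@cinf_class _ [set h | exists B t,
  [/\ cinf B, csupp c B & h = ct B t]]); last by exists A, th.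
move=> _ [B [t [cB sB ->]]]; exists (ct (fun k => B k * k) (t + pi / 2)).
  exists (fun k => B k * k), (t + pi / 2); split => //; last exact: csuppM.
  by apply: cinfM => //; exact: cinf_id.
by move=> x; apply: is_derive_ct sB; exact: cinf_continuous.
Qed.

Definition schwartz1 f := cinf f /\
  forall n N, exists M : R, forall x, (1 + `|x|) ^+ N * `|derive1n n f x| <= M.

(** Derivation multiplies the spectrum by k and shifts the phase; multiplication by x differentiates
    the spectrum. Both operations stay among transforms of smooth functions supported in [-c, c],
    which are bounded. The powers of 1 + |x| are reduced to those of |x| by (1 + |x|)^N <= 2^N (1 +
    |x|^N). *)
Lemma ct_schwartz1 c A th : cinf A -> csupp c A -> schwartz1 (ct A th).
Proof.
move=> cA sA; split; first exact: ct_cinf sA.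
move=> n N.
have {A th cA sA}[B [t [cB sB ->]]] : exists B t,
    [/\ cinf B, csupp c B & derive1n n (ct A th) = ct B t].
  elim: n => [|n [B [t [cB sB IH]]]]; first by exists A, th.
  exists (fun k => B k * k), (t + pi / 2); split.
  - by apply: cinfM => //; exact: cinf_id.
  - exact: csuppM.
  - rewrite derive1nS IH; apply: derive1_is_derive => x.
    by apply: is_derive_ct sB; exact: cinf_continuous.
have [M1 hM1] := ct_bounded (csupp_integrable (cinf_continuous cB) sB).
have [M2 hM2] : exists M : R, forall x, `|x| ^+ N * `|ct B t x| <= M.
  have [B' [t' [cB' sB' h]]] : exists B' t', [/\ cinf B', csupp c B' &
      forall x, x ^+ N * ct B t x = ct B' t' x].
    elim: N => [|N [B' [t' [cB' sB' IH]]]].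
      by exists B, t; split => // x; rewrite mul1r.
    exists (derive1 B'), (t' + pi / 2); split; first exact: cinf_derive.
      exact: csupp_derive.
    by move=> x; rewrite exprS -mulrA IH; exact: ct_mulx sB'.
  have [M hM] := ct_bounded (csupp_integrable (cinf_continuous cB') sB').
  by exists M => x; rewrite -normrX -normrM h.
exists (2 ^+ N * (M1 + M2)) => x.
apply: (@le_trans _ _ (2 ^+ N * (1 + `|x| ^+ N) * `|ct B t x|)).
  rewrite ler_wpM2r//.
  have [x1|x1] := leP `|x| 1.
    rewrite (@le_trans _ _ (2 ^+ N))//; first by rewrite lerXn2r ?nnegrE//; lra.
    by rewrite ler_peMr// lerDl exprn_ge0.
  rewrite (@le_trans _ _ ((2 * `|x|) ^+ N))//.
    by rewrite lerXn2r ?nnegrE//; lra.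
  by rewrite exprMn ler_wpM2l// lerDr.
rewrite -mulrA ler_wpM2l//.
by rewrite mulrDl mul1r lerD.
Qed.

Lemma csupp_schwartz1 c A : cinf A -> csupp c A -> schwartz1 A.
Proof.
move=> cA sA; split => // n N.
have cB := cinf_derive1n n cA.
have sB : csupp c (derive1n n A).
  elim: n {cB} => [//|n IH]; rewrite derive1nS; apply: csupp_derive => //.
  exact: cinf_derive1n.
have [M hM] := csupp_bounded (cinf_continuous cB) sB.
exists ((1 + `|c|) ^+ N * M) => x.
have [xc|/sB ->] := leP `|x| c; last first.
  by rewrite normr0 mulr0 mulr_ge0// (le_trans _ (hM 0)).
rewrite ler_pM// ?exprn_ge0 ?addr_ge0//.
by rewrite lerXn2r ?nnegrE ?addr_ge0// lerD2l (le_trans xc)// ler_norm.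
Qed.

End cosine_transform.

(** * Nonnegative transforms with compactly supported spectrum *)

Section autocorrelation.
Context {R : realType}.
Local Notation mu := (@lebesgue_measure R).
Implicit Types G H : R -> R.

(** Cross-correlation rather than convolution: the transform of [corr G G] is a squared modulus for
    every real [G], even or not, and derivatives in m fall on [H] alone. *)
Definition corr G H (m : R) : R := \int[mu]_k (G k * H (m + k)).

Let is_derive_corr c d G H (m : R) : continuous G -> csupp c G ->
  cinf H -> csupp d H -> is_derive m 1 (corr G H) (corr G (derive1 H) m).
Proof.
move=> cG sG cH sH.
have [M hM] := csupp_bounded (cinf_continuous cH) sH.
have [M' hM'] := csupp_bounded (cinf_continuous (cinf_derive cH)) (csupp_derive cH sH).
apply: (@is_derive_Rintegral R _ _ mu G (fun m k => H (m + k))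
  (fun m k => derive1 H (m + k)) (Num.max M M') m).
- exact: csupp_integrable sG.
- move=> x k; have := is_derive_affine 1 k x cH.
  by rewrite !mul1r; under eq_fun do rewrite mul1r.
- by move=> x k; rewrite le_max hM.
- by move=> x k; rewrite normrM mulrC ler_wpM2r// le_max hM' orbT.
- move=> x; apply: measurableT_comp; last exact: measurable_funD.
  exact: continuous_measurableR (cinf_continuous cH).
Qed.

Lemma corr_cinf c d G H : continuous G -> csupp c G ->
  cinf H -> csupp d H -> cinf (corr G H).
Proof.
move=> cG sG cH sH.
apply: (@cinf_class _ [set f | exists H,
  [/\ cinf H, csupp d H & f = corr G H]]); last by exists H.
move=> _ [K [cK sK ->]]; exists (corr G (derive1 K)).
  by exists (derive1 K); split => //; [exact: cinf_derive|exact: csupp_derive].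
by move=> x; exact: is_derive_corr sG cK sK.
Qed.

Lemma derive1_corr c d G H : continuous G -> csupp c G ->
  cinf H -> csupp d H -> derive1 (corr G H) = corr G (derive1 H).
Proof.
by move=> cG sG cH sH; apply: derive1_is_derive => x; exact: is_derive_corr sG cH sH.
Qed.

Lemma corr_csupp c G H : csupp c G -> csupp c H -> csupp (c + c) (corr G H).
Proof.
move=> sG sH m cm; rewrite /corr; under eq_RintegralT => k.
  rewrite (_ : G k * H (m + k) = 0); first over.
  have [kc|/sG->] := leP `|k| c; last by rewrite mul0r.
  rewrite sH ?mulr0//; have := lerB_normD m k; lra.
by rewrite /Rintegral integral0_eq.
Qed.

Lemma corr_even G m : continuous G -> corr G G (- m) = corr G G m.
Proof.
move=> cG; have mG := continuous_measurableR cG.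
rewrite /corr -(Rintegral_shift m); last first.
  apply: measurable_funM => //; apply: measurableT_comp => //.
  exact: measurable_funD.
by apply: eq_RintegralT => k; rewrite mulrC addrC addrK [k + m]addrC mulrC.
Qed.

(* The squared modulus of the Fourier transform of [G]. *)
Lemma ct_corr c G x : continuous G -> csupp c G ->
  ct (corr G G) 0 x = ct G 0 x ^+ 2 + ct G (- (pi / 2)) x ^+ 2.
Proof.
move=> cG sG; have mG := continuous_measurableR cG.
have [M hM] := csupp_bounded cG sG.
have Gi := csupp_integrable cG sG.
have M0 : 0 <= M := le_trans (normr_ge0 _) (hM 0).
pose f (z : R * R) := G z.2 * G (z.1 + z.2) * cos (z.1 * x).
transitivity (\int[mu]_m \int[mu]_k f (m, k)).
  rewrite /ct /corr; apply: eq_RintegralT => m.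
  rewrite /f/= -RintegralZr//; first by rewrite addr0.
  apply: (integrableM_bounded (M := M)) => //.
  by apply: measurableT_comp => //; exact: measurable_funD.
have mf : measurable_fun setT f.
  apply: measurable_funM; first apply: measurable_funM.
  - exact: measurableT_comp.
  - by apply: measurableT_comp => //; exact: measurable_funD.
  - apply: measurableT_comp; first exact: continuous_measurableR (@continuous_cos R).
    exact: measurable_funM.
(* The integrand is nonzero only if |k| <= c and |m + k| <= c, hence |m| <= 2 c; this gives the
   product bound that Fubini requires. *)
rewrite (@Rfubini _ _ _ _ R mu mu f (fun m => M * \1_`[-(c + c), c + c] m) (fun k => `|G k|))//; last 3 first.
- apply: integrableZlR.
  exact: integrable_indic_itv.
- exact: integrable_norm.
- move=> m k; rewrite /f/= !normrM.
  have [mc|mc] := leP `|m| (c + c); last first.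
    rewrite indicE memNset/= ?in_itv/=; last by rewrite -ler_norml; apply/negP; rewrite -ltNge.
    have [kc|/sG->] := leP `|k| c; last by rewrite normr0 !mul0r mulr0.
    rewrite [G (m + k)]sG ?normr0 ?mulr0 ?mul0r//; have := lerB_normD m k; lra.
  rewrite indicE mem_set/= ?in_itv/= -?ler_norml// mulr1.
  rewrite (le_trans (ler_piMr _ (cos_max _))) ?mulr_ge0//.
  by rewrite mulrC ler_wpM2r.
transitivity (\int[mu]_k (G k * (cos (k * x) * ct G 0 x + sin (k * x) * ct G (- (pi / 2)) x))).
  apply: eq_RintegralT => k.
  (* With l = m + k the argument becomes (l - k) x, and the addition formula separates l from k. *)
  rewrite -(Rintegral_shift (- k)); last first.
    exact: (measurableT_comp mf).
  under eq_RintegralT => l do rewrite /f/= subrK mulrBl cosB -!mulrA.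
  rewrite RintegralZl//; last first.
    apply: (integrableM_bounded (M := 2 : R)) => //.
      apply: measurable_funD; apply: measurable_funM => //;
      apply: continuous_measurableR => l; apply: continuous_comp;
      (exact: continuous_cos || exact: continuous_sin || (apply: cvgMl; exact: cvg_id)).
    move=> l; rewrite (le_trans (ler_normD _ _))// !normrM.
    rewrite (_ : 2 = 1 * 1 + 1 * 1); last by lra.
    by rewrite lerD// ler_pM ?cos_max ?sin_max.
  congr (_ * _).
  rewrite /ct -!RintegralZl//; try exact: ct_integrable.
  rewrite -RintegralDT//; try by apply: integrableZlR; exact: ct_integrable.
  apply: eq_RintegralT => l; rewrite addr0 cosBpihalf; ring.
transitivity (\int[mu]_k (ct G 0 x * (G k * cos (k * x + 0)) +
    ct G (- (pi / 2)) x * (G k * cos (k * x + - (pi / 2))))).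
  by apply: eq_RintegralT => k; rewrite addr0 cosBpihalf; ring.
rewrite RintegralDT//; try by apply: integrableZlR; exact: ct_integrable.
by rewrite !RintegralZl//; exact: ct_integrable.
Qed.

(** The sign [s] covers even and odd functions at once, so that two applications show that a second
    derivative keeps the parity. *)
Lemma derive1_sym f (s : R) : cinf f -> (forall x : R, f (- x) = s * f x) ->
  forall x, derive1 f (- x) = - s * derive1 f x.
Proof.
move=> cf fN x.
have d1 := is_derive_affine (-1) 0 x cf.
have d2 : is_derive x 1 (fun y => f (- 1 * y + 0)) (s * derive1 f x).
  have -> : (fun y => f (- 1 * y + 0)) = fun y => s * f y.
    by apply/funext => y; rewrite mulN1r addr0 fN.
  have ? := cinf_is_derive x cf.
  by apply: is_derive_eq.
have := @derive_val _ _ _ _ _ _ _ d1.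
have -> := @derive_val _ _ _ _ _ _ _ d2.
by rewrite addr0 !mulN1r mulNr => ->; rewrite opprK.
Qed.

Lemma ge0_Rintegral_scale (f : R -> R) (a : R) : 0 < a -> measurable_fun setT f ->
  (forall x, 0 <= f x) -> \int[mu]_x f (a^-1 * x) = a * \int[mu]_x f x.
Proof.
move=> a0 mf f0.
have ms : measurable_fun [set: measurableTypeR R] (fun x : measurableTypeR R => a^-1 * x : measurableTypeR R).
  exact: measurable_funM.
pose mixin := isMeasurableFun.Build _ _ _ _ _ ms.
pose pack : {mfun _ >-> _} := HB.pack (fun x : measurableTypeR R => a^-1 * x : measurableTypeR R) mixin.
have ai0 : 0 <= a^-1 by rewrite invr_ge0 ltW.
have mE (B : set (measurableTypeR R)) : measurable B ->
    mu B = mscale (NngNum ai0) (pushforward mu pack) B.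
  apply: lebesgue_measure_unique => //= _ [[b c]] _ <-.
  rewrite /mscale/= /pushforward (_ : _ @^-1` _ = `]a * b, a * c]%classic); last first.
    by apply/seteqP; split => x /=; rewrite !in_itv/= ltr_pdivlMl// ler_pdivrMl.
  rewrite /= !lebesgue_measure_itv/= !lte_fin ltr_pM2l//.
  case: ifP => // _; rewrite ?mule0// -!EFinB -EFinM; congr (_%:E).
  by field; rewrite gt_eqF.
have mfE : measurable_fun setT (EFin \o f) by exact/measurable_EFinP.
have : (\int[mu]_x (f x)%:E = (a^-1)%:E * \int[mu]_x (f (a^-1 * x)%R)%:E)%E.
  rewrite (eq_measure_integral (mscale (NngNum ai0) (pushforward mu pack))); last first.
    by move=> B mB _; exact: mE.
  rewrite ge0_integral_mscale//=; last by move=> x _; rewrite lee_fin.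
  rewrite ge0_integral_pushforward//=.
  by move=> x _; rewrite lee_fin.
move=> h; rewrite /Rintegral h.
(* If the integral is infinite, both sides are 0, the finite part of +oo; nonnegativity thus
   replaces integrability. *)
have [|] := boolP (\int[mu]_x (f (a^-1 * x)%R)%:E \is a fin_num)%E.
  by move=> fi; rewrite fineM//= mulrA divff ?mul1r// gt_eqF.
rewrite ge0_fin_numE; last by apply: integral_ge0 => x _; rewrite lee_fin.
rewrite -leNgt leye_eq => /eqP ->.
by rewrite gt0_muley ?lte_fin ?invr_gt0//= mulr0.
Qed.

Lemma continuous_sqr (g : R -> R) : continuous g -> continuous (fun k : R => g k ^+ 2).
Proof.
move=> cg k; rewrite /= (_ : (fun k => _) = (fun k => g k * g k)).
  by apply: cvgM; exact: cg.
by apply/funext => ?; rewrite expr2.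
Qed.

Lemma Rintegral_bump_gt0 : 0 < \int[mu]_k (@bump R k ^+ 2).
Proof.
(* On [-1/2, 1/2] both arguments of [flat 0] in [bump] are at least 1/2, so each factor is at least
   exp (-2); the square has four factors. *)
pose m : R := expR (- 2) ^+ 4.
have m0 : 0 < m by rewrite exprn_gt0 ?expR_gt0.
apply: (@lt_le_trans _ _ (\int[mu]_k (m * \1_`[- (1 / 2), 1 / 2] k))).
  rewrite RintegralZl//; last exact: integrable_indic_itv.
  apply: mulr_gt0 => //; rewrite /Rintegral integral_indic// setIT/=.
  by rewrite lebesgue_measure_itv/= lte_fin ifT -?EFinB/=; lra.
apply: le_Rintegral => //.
- exact/integrableZlR/integrable_indic_itv.
- apply: (@csupp_integrable _ 1); first exact/continuous_sqr/cinf_continuous/cinf_bump.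
  by move=> k /csupp_bump ->; rewrite expr0n.
move=> k _; rewrite indicE; case: (boolP (_ \in _)); last by rewrite mulr0 sqr_ge0.
rewrite inE/= in_itv/= => /andP[k1 k2]; rewrite mulr1.
have flatm (t : R) : 1 / 2 <= t -> expR (- 2) <= flat 0 t.
  move=> t2; have t0 : 0 < t by lra.
  rewrite /flat t0 expr0 mul1r ler_expR lerN2.
  by rewrite -[leRHS]invrK lef_pV2 ?posrE ?invr_gt0//; lra.
rewrite /m /bump (_ : 4 = 2 * 2)%N// exprM lerXn2r ?nnegrE ?exprn_ge0 ?expR_ge0//.
  by rewrite mulr_ge0// (le_trans (expR_ge0 _) (flatm _ _))//; lra.
by rewrite expr2 ler_pM ?expR_ge0// flatm//; lra.
Qed.

(** A scaling argument. With a = c / 2 and G k = G1 (k / a), take W the autocorrelation of [G] and V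
    = -W''. Then W 0 is the integral of G^2, equal to a I0, and V 0 is that of G'^2 by parts, equal
    to I1 / a. The ratio V 0 / W 0 is 4 I1 / (I0 c^2), whence a [kappa] that does not depend on c;
    I1 + 1 in place of I1 makes it visibly positive. *)
Lemma profile : exists2 kappa : R, 0 < kappa & forall c : R, 0 < c ->
  exists W V : R -> R,
  [/\ [/\ cinf W, csupp c W & forall k, W (- k) = W k],
      [/\ cinf V, csupp c V & forall k, V (- k) = V k],
      (forall x, 0 <= ct W 0 x),
      (forall x, ct V 0 x = x ^+ 2 * ct W 0 x) &
      0 < W 0 /\ V 0 <= kappa / c ^+ 2 * W 0].
Proof.
have [G1 [cG1 sG1]] : exists G1 : R -> R,
    [/\ cinf G1, csupp 1 G1 & 0 < \int[mu]_k (G1 k ^+ 2)].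
  by exists bump; split; [exact: cinf_bump|exact: csupp_bump|exact: Rintegral_bump_gt0].
set I0 := \int[mu]_k _ => I0_gt0.
pose I1 := \int[mu]_k (derive1 G1 k ^+ 2).
have I1_ge0 : 0 <= I1 by apply: Rintegral_ge0 => k _; exact: sqr_ge0.
exists (4 * (I1 + 1) / I0); first by rewrite divr_gt0// mulr_gt0// ltr_wpDl.
move=> c c0; pose a := c / 2; have a0 : 0 < a by rewrite divr_gt0.
pose G k := G1 (a^-1 * k).
have cG : cinf G by have := cinf_affine a^-1 0 cG1; under eq_fun do rewrite addr0.
have dG k : derive1 G k = a^-1 * derive1 G1 (a^-1 * k).
  have := is_derive_affine a^-1 0 k cG1; rewrite addr0.
  under eq_fun do rewrite addr0.
  by move=> d; rewrite derive1E; exact: (@derive_val _ _ _ _ _ _ _ d).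
have sG : csupp a G.
  move=> k ak; apply: sG1; rewrite normrM gtr0_norm ?invr_gt0//.
  by rewrite ltr_pdivlMl// mulr1.
have cc := cinf_continuous cG.
have cW := corr_cinf cc sG cG sG.
have sW := corr_csupp sG sG; rewrite /a -splitr in sW.
pose W := corr G G.
pose V k := - derive1 (derive1 W) k.
have cV : cinf V.
  by have := cinfZ (-1) (cinf_derive (cinf_derive cW)); under eq_fun do rewrite mulN1r.
have sV : csupp c V.
  move=> k ck; rewrite /V (csupp_derive _ (csupp_derive cW sW))//.
    by rewrite oppr0.
  exact: cinf_derive.
have Ws k : W (- k) = W k by exact: corr_even.
have Wp x : 0 <= ct W 0 x.
  by rewrite (ct_corr x cc sG) addr_ge0// sqr_ge0.
have W0 : W 0 = a * I0.
  rewrite /W /corr -(@ge0_Rintegral_scale (fun k => G1 k ^+ 2))//.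
  - by apply: eq_RintegralT => k; rewrite add0r expr2.
  - exact: continuous_measurableR (continuous_sqr (cinf_continuous cG1)).
  - by move=> x; exact: sqr_ge0.
have V0 : V 0 = a^-1 * I1.
  rewrite /V /W (derive1_corr cc sG cG sG).
  rewrite (derive1_corr cc sG (cinf_derive cG) (csupp_derive cG sG)) /corr.
  under eq_RintegralT do rewrite add0r.
  rewrite (Rintegration_by_parts_csupp cG sG (fun x => cinf_is_derive x (cinf_derive cG))); last first.
    exact/cinf_continuous/cinf_derive/cinf_derive.
  rewrite opprK; under eq_RintegralT do rewrite dG.
  transitivity (\int[mu]_x (a^-1 ^+ 2 * (derive1 G1 (a^-1 * x)) ^+ 2)).
    by apply: eq_RintegralT => k; ring.
  have cd := cinf_continuous (cinf_derive cG1).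
  have hi : mu.-integrable setT (EFin \o (fun x => derive1 G1 (a^-1 * x) ^+ 2)).
    apply: (@csupp_integrable _ a).
      apply: (@continuous_sqr (fun x => derive1 G1 (a^-1 * x))) => k.
      apply: continuous_comp; last exact: cd.
      by apply: cvgMr; exact: cvg_id.
    move=> k ak; rewrite (csupp_derive cG1 sG1) ?expr0n//.
    by rewrite normrM gtr0_norm ?invr_gt0// ltr_pdivlMl// mulr1.
  rewrite (RintegralZl _ measurableT hi).
  rewrite (@ge0_Rintegral_scale (fun k => derive1 G1 k ^+ 2))//; last 2 first.
  - exact: continuous_measurableR (continuous_sqr cd).
  - by move=> x; exact: sqr_ge0.
  by rewrite -/I1; field; rewrite gt_eqF.
exists W, V; split; [by []| |by []| |].
- split; [exact: cV|exact: sV|move=> k].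
  have h1 := @derive1_sym W 1 cW (fun x => etrans (Ws x) (esym (mul1r _))).
  by rewrite /V (derive1_sym (cinf_derive cW) h1) opprK mul1r.
- move=> x; rewrite expr2 -mulrA (ct_mulx _ _ cW sW).
  rewrite (ct_mulx _ _ (cinf_derive cW) (csupp_derive cW sW)).
  rewrite /ct; apply: eq_RintegralT => k.
  by rewrite add0r addrA !cosDpihalf sinDpihalf addr0 /V mulrN mulNr.
- rewrite W0 V0; split; first by rewrite mulr_gt0.
  rewrite /a; have -> : 4 * (I1 + 1) / I0 / c ^+ 2 * (c / 2 * I0) = (c / 2)^-1 * (I1 + 1).
    by field; rewrite !gt_eqF.
  by rewrite ler_wpM2l ?invr_ge0 ?divr_ge0 ?ltW// ltrDl.
Qed.

End autocorrelation.

Lemma Rdominated_convergence d (T : measurableType d) (R : realType)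
    (mu : {measure set T -> \bar R}) (D : set T) (f_ : nat -> T -> R) (f g : T -> R) :
  measurable D -> (forall n, measurable_fun D (f_ n)) ->
  (forall x, D x -> f_ n x @[n --> \oo] --> f x) ->
  mu.-integrable D (EFin \o g) ->
  (forall n x, D x -> `|f_ n x| <= g x) ->
  mu.-integrable D (EFin \o f) /\
  \int[mu]_(x in D) f_ n x @[n --> \oo] --> \int[mu]_(x in D) f x.
Proof.
move=> mD mf_ cf ig fg.
have mf : measurable_fun D f by exact: measurable_fun_cvg mf_ cf.
have [//| | | | |fi _ cv] := @dominated_convergence _ _ _ mu D mD (fun n => EFin \o f_ n) (EFin \o f) (EFin \o g).
- by move=> n; exact/measurable_EFinP.
- exact/measurable_EFinP.
- by apply: aeW => x Dx; apply/fine_cvgP; split; [exact: nearW|exact: cf].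
- exact: ig.
- by apply: aeW => x n Dx; rewrite lee_fin fg.
split => //; apply: fine_cvg; move: cv.
by rewrite /Rintegral fineK//; exact: (integrable_fin_num mD fi).
Qed.

(** * Fourier inversion and Poisson summation *)

Section kernels.
Context {R : realType}.
Local Notation mu := (@lebesgue_measure R).

Definition dirichlet (N : nat) (x : R) : R := 1 + \sum_(0 <= n < N) 2 * cos (n.+1%:R * x).

Lemma sin_dirichlet N x :
  sin (x / 2) * dirichlet N x = sin ((N%:R + 1 / 2) * x).
Proof.
elim: N => [|N IH].
  by rewrite /dirichlet big_nil addr0 mulr1 add0r; congr sin; field.
rewrite /dirichlet big_nat_recr//= addrA mulrDr -/(dirichlet N x) IH.
have -> : (N%:R + 1 / 2) * x = N.+1%:R * x - x / 2 by rewrite -natr1; field.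
have -> : (N.+1%:R + 1 / 2) * x = N.+1%:R * x + x / 2 by field.
rewrite sinB sinD; ring.
Qed.

(** The closed form of the Fejer kernel, multiplied out so that it also holds where sin (x / 2)
    vanishes. It shows that the means are O(1 / M) at each point where the sine does not vanish. *)
Lemma sin_sum_dirichlet M x :
  2 * sin (x / 2) ^+ 2 * \sum_(0 <= N < M) dirichlet N x = 1 - cos (M%:R * x).
Proof.
elim: M => [|M IH]; first by rewrite big_nil mulr0 mul0r cos0 subrr.
rewrite big_nat_recr//= mulrDr IH expr2 -!mulrA sin_dirichlet.
have -> : (M%:R + 1 / 2) * x = M%:R * x + x / 2 by field.
have -> : M.+1%:R * x = M%:R * x + (x / 2 + x / 2) by rewrite -natr1; field.
rewrite sinD cosD (cosD (x / 2)) sinD -!expr2.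
rewrite cos2sin2; ring.
Qed.

(** This weaker estimate bounds the mean of the kernels by 1 / |sin (x / 2)| uniformly in M: it
    provides the domination, while the closed form provides the pointwise limit. *)
Lemma norm_sin_sum_dirichlet M x :
  `|sin (x / 2) * \sum_(0 <= N < M) dirichlet N x| <= M%:R.
Proof.
rewrite big_distrr/=; apply: le_trans (ler_norm_sum _ _ _) _.
under eq_bigr do rewrite sin_dirichlet.
apply: (@le_trans _ _ (\sum_(0 <= i < M) 1)); first by apply: ler_sum => i _; exact: sin_max.
by rewrite sumr_const_nat subn0.
Qed.

Lemma sin_nat_pi n : sin (n%:R * pi) = 0 :> R.
Proof.
elim: n => [|n IH]; first by rewrite mul0r sin0.
by rewrite -natr1 mulrDl mul1r sinDpi IH oppr0.
Qed.

(** A weak form of Jordan's inequality by halving the angle: sin y = 2 sin (y / 2) cos (y / 2),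
    where the cosine is at least cos (pi / 4) and, by the mean value theorem, the sine is at least
    (y / 2) cos (pi / 4); finally cos (pi / 4)^2 = 1 / 2. *)
Lemma sin_ge_half (y : R) : 0 <= y <= pi / 2 -> y / 2 <= sin y.
Proof.
move=> /andP[y0 y1].
have q : cos (pi / 4) ^+ 2 = 1 / 2 :> R.
  have := cos_mulr2n (pi / 4 : R).
  have -> : pi / 4 *+ 2 = pi / 2 :> R by rewrite mulr2n; field.
  by rewrite cos_pihalf => h; lra.
have pi0 := pi_gt0 R.
have c0 : 0 < cos (pi / 4) :> R by apply: cos_gt0_pihalf; apply/andP; split; lra.
have cge z : 0 <= z <= pi / 4 -> cos (pi / 4) <= cos z :> R.
  move=> /andP[z0 z1]; rewrite leNgt ltr_cos ?in_itv/= -?leNgt//; apply/andP; split; lra.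
have y2 : 0 <= y / 2 by lra.
have [z] := @MVT_segment R sin cos 0 (y / 2) y2 (fun x _ => is_derive_sin x)
   (continuous_subspaceT (@continuous_sin R)).
rewrite in_itv/= sin0 !subr0 => /andP[z0 zy] h.
have -> : sin y = 2 * sin (y / 2) * cos (y / 2).
  have := sin_mulr2n (y / 2); have -> : y / 2 *+ 2 = y by rewrite mulr2n; field.
  by move=> ->; rewrite mulr2n; ring.
have c1 := cge z; have c2 := cge (y / 2).
rewrite h; apply: (@le_trans _ _ (2 * (cos (pi / 4) * (y / 2)) * cos (pi / 4))).
  rewrite [leRHS](_ : _ = y * cos (pi / 4) ^+ 2); last by field.
  by rewrite q; lra.
rewrite ler_pM ?mulr_ge0 ?(ltW c0)//; try lra.
by rewrite ler_wpM2l// ler_wpM2r ?c1//; lra.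
Qed.

Lemma norm_sin_ge_half (y : R) : `|y| <= pi / 2 -> `|y| / 2 <= `|sin y|.
Proof.
have [y0|y0] := leP 0 y.
  by rewrite ger0_norm// => h; rewrite (le_trans (sin_ge_half _)) ?y0// ler_norm.
rewrite ltr0_norm// -normrN -sinN => h.
by rewrite (le_trans (sin_ge_half _)) ?ler_norm//; lra.
Qed.

Lemma bounded_derivative_lipschitz (f df : R -> R) (K : R) :
  (forall x : R, is_derive x 1 f (df x)) -> (forall x, `|df x| <= K) ->
  forall x y, `|f x - f y| <= K * `|x - y|.
Proof.
move=> fdf dfK.
have cf : continuous f.
  move=> x; apply: differentiable_continuous; apply/derivable1_diffP.
  by have [] := fdf x.
have H x y : y <= x -> `|f x - f y| <= K * `|x - y|.
  move=> yx; have [z _ ->] := @MVT_segment R f df y x yx (fun x _ => fdf x)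
    (continuous_subspaceT cf).
  by rewrite normrM ler_wpM2r.
move=> x y; have [xy|/ltW yx] := leP x y; last exact: H.
by rewrite distrC [`|x - y|]distrC; exact: H.
Qed.

Lemma continuous_dirichlet N : continuous (dirichlet N).
Proof.
elim: N => [|N IH].
  rewrite (_ : dirichlet 0 = cst 1); first by move=> x; exact: cvg_cst.
  by apply/funext => x; rewrite /dirichlet big_nil addr0.
rewrite (_ : dirichlet N.+1 = fun x => dirichlet N x + 2 * cos (N.+1%:R * x)).
  move=> x; apply: cvgD; first exact: IH.
  apply: cvgMr; apply: continuous_comp; last exact: continuous_cos.
  by apply: cvgMr; exact: cvg_id.
by apply/funext => x; rewrite /dirichlet big_nat_recr//= addrA.
Qed.

Variables (dl : R).
Hypothesis dl0 : 0 < dl.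
Let L := pi / dl.
Let L0 : 0 < L. Proof. by rewrite divr_gt0// pi_gt0. Qed.
Local Notation D := (`[-L, L]%classic).

Let continuous_integrable f : continuous f -> mu.-integrable D (EFin \o f).
Proof.
move=> cf; apply: continuous_compact_integrable; first exact: segment_compact.
exact: continuous_subspaceT.
Qed.

Let continuous_scale (f : R -> R) (c : R) : continuous f -> continuous (fun x => f (c * x)).
Proof.
move=> cf x; apply: continuous_comp; last exact: cf.
by apply: cvgMr; exact: cvg_id.
Qed.

Let Rintegral_cos n : \int[mu]_(x in D) cos (n.+1%:R * (dl * x)) = 0.
Proof.
have n0 : n.+1%:R * dl != 0 by rewrite mulf_neq0 ?pnatr_eq0// gt_eqF.
(* The primitive is a sine, written as a cosine of phase - pi / 2 so that the derivation rule for
   phased cosines applies; it vanishes at both ends of the period. *)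
pose F := fun x : R => (n.+1%:R * dl)^-1 * cos (n.+1%:R * dl * x + (- (pi / 2))).
have dF (x : R) : is_derive x 1 F (cos (n.+1%:R * (dl * x))).
  have d := is_derive_cos_affine (n.+1%:R * dl) (- (pi / 2)) x.
  rewrite subrK in d || rewrite addNr addr0 in d.
  have := @is_deriveZ _ _ _ _ (n.+1%:R * dl)^-1 _ _ _ d.
  have e : (n.+1%:R * dl)^-1 *: (n.+1%:R * dl * cos (n.+1%:R * dl * x)) =
    cos (n.+1%:R * (dl * x)) by rewrite /GRing.scale/= mulKf// mulrA.
  by rewrite e.
rewrite /Rintegral (@continuous_FTC2 _ _ F)//.
- rewrite -EFinB/= /F !cosBpihalf mulrN sinN.
  have -> : n.+1%:R * dl * L = n.+1%:R * pi by rewrite /L; field; rewrite gt_eqF.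
  by rewrite sin_nat_pi oppr0 subrr.
- by rewrite gtrN.
- apply: continuous_subspaceT; apply: (@continuous_scale (fun x => cos (n.+1%:R * x))).
  exact/continuous_scale/continuous_cos.
- have cF : continuous F.
    move=> x; apply: differentiable_continuous; apply/derivable1_diffP.
    by have [] := dF x.
  split.
  + by move=> x _; have [] := dF x.
  + by apply: cvg_at_right_filter; exact: cF.
  + by apply: cvg_at_left_filter; exact: cF.
- by move=> x _; rewrite derive1E; have [_ ->] := dF x.
Qed.

Let Rintegral_dirichlet N : \int[mu]_(x in D) dirichlet N (dl * x) = 2 * L.
Proof.
elim: N => [|N IH].
  under eq_Rintegral do rewrite /dirichlet big_nil addr0.
  rewrite Rintegral_cst//= lebesgue_measure_itv/= lte_fin gtrN// -EFinB/=; ring.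
under eq_Rintegral do rewrite /dirichlet big_nat_recr//= addrA.
rewrite RintegralD//.
- rewrite IH RintegralZl//.
    by rewrite Rintegral_cos mulr0 addr0.
  apply: continuous_integrable; apply: (@continuous_scale (fun x => cos (N.+1%:R * x))).
  exact/continuous_scale/continuous_cos.
- apply: continuous_integrable.
  exact: (@continuous_scale (dirichlet N) dl (@continuous_dirichlet N)).
- apply: continuous_integrable => x; apply: cvgMr.
  apply: (@continuous_scale (fun x => cos (N.+1%:R * x))).
  exact/continuous_scale/continuous_cos.
Qed.

Variables (B : R -> R) (K : R).
Hypotheses (cB : continuous B) (sB : csupp L B).
Hypothesis BK : forall x, `|B x - B 0| <= K * `|x|.

Let K0 : 0 <= K.
Proof. by have := le_trans (normr_ge0 _) (BK 1); rewrite normr1 mulr1. Qed.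

Let mean (M : nat) (x : R) := M.+1%:R^-1 * \sum_(0 <= N < M.+1) dirichlet N (dl * x).

Let continuous_mean M : continuous (mean M).
Proof.
move=> x; apply: cvgMr.
elim: (M.+1) => [|m IH].
  under eq_fun do rewrite big_nil; rewrite big_nil; exact: cvg_cst.
under eq_fun do rewrite big_nat_recr//=.
rewrite big_nat_recr//=; apply: cvgD => //.
exact: (@continuous_scale (dirichlet m) dl (@continuous_dirichlet m)).
Qed.

Let integrand M x := (B x - B 0) * mean M x.

Let continuous_integrand M : continuous (integrand M).
Proof.
move=> x; apply: cvgM; last exact: continuous_mean.
by apply: cvgB; [exact: cB|exact: cvg_cst].
Qed.

Let sin_lower x : D x -> dl * `|x| / 4 <= `|sin (dl * x / 2)|.
Proof.
rewrite /= in_itv/= -ler_norml => xL.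
have h : `|dl * x / 2| = dl * `|x| / 2.
  by rewrite !normrM (gtr0_norm dl0) [`|2^-1|]ger0_norm.
apply: le_trans (norm_sin_ge_half _); rewrite h; first by rewrite le_eqVlt; apply/orP; left; apply/eqP; field.
by rewrite ler_wpM2r// mulrC -ler_pdivlMr.
Qed.

(** The Lipschitz bound K |x| at 0 cancels the singularity: on D the mean is at most 1 / |sin (dl x
    / 2)| <= 4 / (dl |x|). Dominated convergence therefore suffices, without any approximate
    identity argument. *)
Let integrand_le M x : D x -> `|integrand M x| <= 4 * K / dl.
Proof.
move=> Dx; have [->|x0] := eqVneq x 0.
  by rewrite /integrand subrr mul0r normr0 divr_ge0 ?mulr_ge0// ltW.
have xp : 0 < `|x| by rewrite normr_gt0.
have sp : 0 < `|sin (dl * x / 2)|.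
  by apply: lt_le_trans (sin_lower Dx); rewrite divr_gt0// mulr_gt0.
have h : `|mean M x| * `|sin (dl * x / 2)| <= 1.
  rewrite -normrM (_ : mean M x * _ = M.+1%:R^-1 * (sin (dl * x / 2) *
    \sum_(0 <= N < M.+1) dirichlet N (dl * x))); last by rewrite /mean; ring.
  rewrite normrM.
  rewrite ger0_norm; last by rewrite invr_ge0.
  have := norm_sin_sum_dirichlet M.+1 (dl * x).
  by rewrite ler_pdivrMl ?mulr1// ltr0n.
rewrite /integrand normrM.
apply: (@le_trans _ _ (K * `|x| * `|mean M x|)); first by rewrite ler_wpM2r.
have {}h : `|mean M x| * (dl * `|x| / 4) <= 1.
  by apply: le_trans h; rewrite ler_wpM2l// sin_lower.
rewrite -mulrA ler_pdivlMr// [leLHS](_ : _ = 4 * K * (`|mean M x| * (dl * `|x| / 4))); last by field.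
by rewrite ler_piMr// mulr_ge0.
Qed.

(** D is exactly one period of the kernels, so sin (dl x / 2) vanishes in D only at x = 0. There the
    mean may blow up, but the factor B x - B 0 is zero. *)
Let integrand_cvg0 x : D x -> integrand M x @[M --> \oo] --> (0 : R).
Proof.
move=> Dx; have [->|x0] := eqVneq x 0.
  rewrite (_ : (fun M => _) = cst 0); first exact: cvg_cst.
  by apply/funext => M; rewrite /integrand subrr mul0r.
have xp : 0 < `|x| by rewrite normr_gt0.
have sp : 0 < `|sin (dl * x / 2)|.
  by apply: lt_le_trans (sin_lower Dx); rewrite divr_gt0// mulr_gt0.
set S := sin (dl * x / 2) in sp.
have mE M : mean M x = (1 - cos (M.+1%:R * (dl * x))) / (2 * S ^+ 2) * M.+1%:R^-1.
  rewrite -sin_sum_dirichlet -/S /mean; field.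
  by rewrite addrC natr1 pnatr_eq0/= -normr_gt0.
apply/cvgr0Pnorm_lt => e e0.
have : `|B x - B 0| * (2 / (2 * S ^+ 2)) * harmonic M @[M --> \oo] --> `|B x - B 0| * (2 / (2 * S ^+ 2)) * 0.
  by apply: cvgMr; exact: (@cvg_harmonic R).
rewrite mulr0 => /cvgr0Pnorm_lt/(_ _ e0); apply: filterS => M.
apply: le_lt_trans; rewrite /integrand normrM mE.
have S2 : 0 <= (2 * S ^+ 2)^-1 by rewrite invr_ge0 mulr_ge0// sqr_ge0.
have h0 : 0 <= M.+1%:R^-1 :> R by rewrite invr_ge0.
rewrite [leRHS]ger0_norm; last by rewrite !mulr_ge0.
rewrite -[leRHS]mulrA ler_wpM2l//= normrM (ger0_norm h0) ler_wpM2r// normrM (ger0_norm S2).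
rewrite ler_wpM2r// (le_trans (ler_normB _ _))// normr1 (_ : 2 = 1 + 1)// lerD2l.
exact: cos_max.
Qed.

Let fejer_mean M : \sum_(0 <= N < M.+1) (\int[mu]_x (B x * dirichlet N (dl * x))) =
  M.+1%:R * (2 * L * B 0 + \int[mu]_(x in D) integrand M x).
Proof.
pose S m x := \sum_(0 <= N < m) dirichlet N (dl * x).
have cD N : continuous (fun x => dirichlet N (dl * x)).
  exact: (@continuous_scale (dirichlet N) dl (@continuous_dirichlet N)).
have cS m : continuous (S m).
  elim: m => [|m IH] x.
    rewrite (_ : S 0%N = cst 0); first exact: cvg_cst.
    by apply/funext => y; rewrite /S big_nil.
  rewrite (_ : S m.+1 = fun x => S m x + dirichlet m (dl * x)).
    by apply: cvgD; [exact: IH|exact: cD].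
  by apply/funext => y; rewrite /S big_nat_recr.
have SE (g : R -> R) m : continuous g ->
    \sum_(0 <= N < m) \int[mu]_(x in D) (g x * dirichlet N (dl * x)) =
    \int[mu]_(x in D) (g x * S m x).
  move=> cg; elim: m => [|m IH].
    rewrite big_nil; under eq_Rintegral do rewrite /S big_nil mulr0.
    by rewrite Rintegral_cst// mul0r.
  rewrite big_nat_recr//= IH -RintegralD//.
  - by apply: eq_Rintegral => x _; rewrite /S big_nat_recr//= [RHS]mulrDr.
  - by apply: continuous_integrable => x; apply: cvgM; [exact: cg|exact: cS].
  - by apply: continuous_integrable => x; apply: cvgM; [exact: cg|exact: cD].
under eq_bigr => N _.
  rewrite (Rintegral_csupp (csuppM _ sB)); over.
rewrite SE//.
have S1 : \int[mu]_(x in D) S M.+1 x = M.+1%:R * (2 * L).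
  transitivity (\int[mu]_(x in D) (1 * S M.+1 x)).
    by apply: eq_Rintegral => x _; rewrite mul1r.
  rewrite -(SE (fun=> 1)); last by move=> x; exact: cvg_cst.
  under eq_bigr do (under eq_Rintegral do rewrite mul1r; rewrite Rintegral_dirichlet).
  by rewrite sumr_const_nat subn0 [RHS]mulr_natl.
have -> : \int[mu]_(x in D) integrand M x =
    M.+1%:R^-1 * (\int[mu]_(x in D) (B x * S M.+1 x) - B 0 * \int[mu]_(x in D) S M.+1 x).
  rewrite -RintegralZl//; last exact: continuous_integrable.
  rewrite -RintegralB//; last 2 first.
  - by apply: continuous_integrable => x; apply: cvgM; [exact: cB|exact: cS].
  - by apply: continuous_integrable => x; apply: cvgMr; exact: cS.
  rewrite -RintegralZl//.
    by apply: eq_Rintegral => x _; rewrite /integrand /mean -/(S M.+1 x); ring.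
  apply: continuous_integrable => x; apply: cvgB.
    by apply: cvgM; [exact: cB|exact: cS].
  by apply: cvgMr; exact: cS.
rewrite S1; field.
by rewrite addrC natr1 pnatr_eq0.
Qed.

(** The bound depends on [B] only through [K]. It thus serves as a dominating constant when [B]
    varies with a parameter and the limit is taken under an integral in that parameter. *)
Lemma fejer_bound M : `|arithmetic_mean
  (fun N => \int[mu]_x (B x * dirichlet N (dl * x))) M - 2 * L * B 0|
  <= 2 * L * (4 * K / dl).
Proof.
rewrite /arithmetic_mean /series/= fejer_mean mulKf ?pnatr_eq0//.
rewrite addrAC subrr add0r.
rewrite (le_trans (le_normr_Rintegral _ (continuous_integrable (@continuous_integrand M))))//.
apply: (@le_trans _ _ (\int[mu]_(x in D) (4 * K / dl))).
  apply: le_Rintegral => //.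
  - exact: (integrable_norm (continuous_integrable (@continuous_integrand M))).
  - by apply: continuous_integrable => x; exact: cvg_cst.
  - by move=> x Dx; exact: integrand_le.
rewrite Rintegral_cst//= lebesgue_measure_itv/= lte_fin gtrN// -EFinB/= opprK.
by rewrite mulrC -mulr2n -[L *+ 2]mulr_natl.
Qed.

Lemma fejer_cvg : arithmetic_mean
  (fun N => \int[mu]_x (B x * dirichlet N (dl * x))) @ \oo --> 2 * L * B 0.
Proof.
have [|M|x Dx||M x Dx|_ cv] := @Rdominated_convergence _ _ R mu D integrand (fun=> 0) (fun=> 4 * K / dl).
- by [].
- exact: measurable_funTS (continuous_measurableR (@continuous_integrand M)).
- exact: integrand_cvg0.
- by apply: continuous_integrable => x; exact: cvg_cst.
- exact: integrand_le.
move: cv; rewrite Rintegral_cst// mul0r => /(cvgD (cvg_cst (2 * L * B 0))).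
rewrite addr0; apply: cvg_trans; apply: near_eq_cvg; apply: nearW => M.
rewrite /arithmetic_mean /series/= fejer_mean mulKf ?pnatr_eq0//.
Qed.

End kernels.

(** * Integrals along the identity and along the floor function *)

Section inversion.
Context {R : realType}.
Local Notation mu := (@lebesgue_measure R).

Lemma integrable_oneDsqrV : mu.-integrable setT (EFin \o (fun x : R => (oneDsqr x)^-1)).
Proof.
apply/integrableP; split.
  apply/measurable_EFinP; apply: continuous_measurableR; exact: continuous_oneDsqrV.
under eq_integral do rewrite /= ger0_norm ?invr_ge0 ?(le_trans ler01)//.
rewrite (@ge0_symfun_integralT R (fun x => (oneDsqr x)^-1)).
- by rewrite -set_itvcy integral0y_oneDsqr ltry.
- by move=> x; rewrite invr_ge0 (le_trans ler01).
- exact: continuous_oneDsqrV.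
- by move=> x; rewrite /= /oneDsqr sqrrN.
Qed.

(* [iota] is the identity for R^n, and the floor function, with [dl = 1], for
   Z^n: the integral of [f \o iota] is then the sum of [f] over Z. *)
Variables (dl : R) (iota : R -> R).
Hypothesis dl0 : 0 < dl.
Hypothesis miota : measurable_fun setT iota.
Hypothesis iotaD : forall t, iota (t + dl) = iota t + dl.
Hypothesis iota_close : forall t, `|iota t - t| <= 1.
Let L := pi / dl.

(** Since [iota t] is within 1 of t, |t| <= 1 + |iota t|, and quadratic decay survives composition
    with [iota]. *)
Lemma decay_iota (M : R) (t : R) : 0 <= M ->
  M / (1 + `|iota t|) ^+ 2 <= 4 * M * (oneDsqr t)^-1.
Proof.
move=> M0; rewrite (mulrC 4) -mulrA ler_wpM2l//.
have h : 0 < 1 + `|iota t| by rewrite ltr_wpDr.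
have h1 : 0 < oneDsqr t by rewrite (lt_le_trans ltr01).
rewrite -[leLHS]div1r ler_pdivrMr ?exprn_gt0// mulrAC ler_pdivlMr// mul1r.
have : `|t| <= 1 + `|iota t|.
  have {1}-> : t = iota t - (iota t - t) by ring.
  rewrite (le_trans (ler_normB _ _))// addrC lerD2r.
  exact: iota_close.
have : 1 <= 1 + `|iota t| by rewrite lerDl.
have := normr_ge0 t; have := real_normK (num_real t); rewrite /oneDsqr => <-; nra.
Qed.

Lemma integrable_decay_iota (f : R -> R) (M : R) : measurable_fun setT f ->
  (forall x, (1 + `|x|) ^+ 2 * `|f x| <= M) ->
  mu.-integrable setT (EFin \o (fun t => f (iota t))).
Proof.
move=> mf fM; have M0 : 0 <= M by apply: le_trans (fM 0); rewrite mulr_ge0// exprn_ge0// addr_ge0.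
apply: (@le_integrableR _ (measurableTypeR R) R mu _ (fun t => 4 * M * (oneDsqr t)^-1)).
- exact: measurableT_comp.
- move=> t; apply: le_trans (decay_iota t M0).
  by rewrite ler_pdivlMr ?exprn_gt0 ?ltr_wpDr// mulrC.
- exact/integrableZlR/integrable_oneDsqrV.
Qed.

Lemma iotaDn (t : R) n : iota (t + dl * n%:R) = iota t + dl * n%:R.
Proof.
elim: n => [|n IH]; first by rewrite !mulr0 !addr0.
by rewrite -natr1 mulrDr mulr1 !addrA iotaD IH.
Qed.

Lemma iotaBn (t : R) n : iota (t - dl * n%:R) = iota t - dl * n%:R.
Proof. by apply/eqP; rewrite eq_sym subr_eq -iotaDn subrK. Qed.

Lemma Rintegral_shift_itv (f : R -> R) (a b c : R) : measurable_fun setT f ->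
  \int[mu]_(t in `[a + c, b + c[) f t = \int[mu]_(s in `[a, b[) f (s + c).
Proof.
move=> mf; rewrite Rintegral_mkcond [RHS]Rintegral_mkcond.
rewrite -(Rintegral_shift c); last first.
  by apply/(measurable_restrictT _ _).1 => //; exact: measurable_funTS.
apply: eq_RintegralT => t; rewrite !patchE !mem_setE/= !in_itv/=.
by rewrite lerD2r ltrD2r.
Qed.

Section unfold.
Variables (f : R -> R) (M : R).
Hypothesis mf : measurable_fun setT f.
Hypothesis fM : forall x, (1 + `|x|) ^+ 2 * `|f x| <= M.
Let F t := f (iota t).
Let Fi : mu.-integrable setT (EFin \o F).
Proof. exact: integrable_decay_iota fM. Qed.
Let mF : measurable_fun setT F. Proof. exact: measurableT_comp. Qed.

(** Partial sums of the periodization of [f]. They are taken symmetrically because, for a cosine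
    transform, symmetric sums produce the Dirichlet kernel in the frequency. *)
Let symsum N (s : R) := f s + \sum_(0 <= n < N) (f (s + dl * n.+1%:R) + f (s - dl * n.+1%:R)).

Let measurable_symsum N : measurable_fun setT (symsum N).
Proof.
apply: measurable_funD => //.
elim: N => [|N IH]; first by under eq_fun do rewrite big_nil; exact: measurable_cst.
under eq_fun do rewrite big_nat_recr//=.
apply: measurable_funD => //; apply: measurable_funD;
  by apply: measurableT_comp => //; exact: measurable_funD.
Qed.

Let integrable_symsum N D : measurable D -> mu.-integrable D (EFin \o (fun s => symsum N (iota s))).
Proof.
move=> mD; apply: (@integrableS _ _ _ mu setT) => //.
have sh c : mu.-integrable setT (EFin \o (fun t => F (t + c))) by exact: integrable_shift.
rewrite /symsum; apply: integrableDR => //.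
elim: N => [|N IH].
  by under [_ \o _]eq_fun do rewrite /= big_nil; exact: integrable0.
under [_ \o _]eq_fun do rewrite /= big_nat_recr//=.
apply: integrableDR => //; apply: integrableDR.
  by have := sh (dl * N.+1%:R); under [_ \o _]eq_fun do rewrite /= /F iotaDn.
by have := sh (- (dl * N.+1%:R)); under [_ \o _]eq_fun do rewrite /= /F iotaBn.
Qed.

(** The window consists of 2 N + 1 cells of length [dl], the middle one being [0, dl[; the induction
    adds one cell at each end and moves it back to [0, dl[, since [iota] commutes with translation
    by [dl]. *)
Lemma Rintegral_symsum N :
  \int[mu]_(t in `[- (dl * N%:R), dl * N.+1%:R[) F t =
  \int[mu]_(s in `[0, dl[) symsum N (iota s).
Proof.
elim: N => [|N IH].
  rewrite mulr0 oppr0 mulr1; apply: eq_Rintegral => s _.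
  by rewrite /symsum big_nil addr0.
have N0 : 0 <= dl * N%:R by rewrite mulr_ge0// ltW.
have e1 : dl * N.+1%:R = dl * N%:R + dl by rewrite -natr1 mulrDr mulr1.
have N1 : 0 <= dl * N.+1%:R by rewrite mulr_ge0// ltW.
have P1 : dl * N%:R <= dl * N.+1%:R by rewrite e1 lerDl ltW.
have e2 : dl * N.+2%:R = dl * N.+1%:R + dl by rewrite -[N.+2%:R]natr1 mulrDr mulr1.
rewrite (@itv_bndbnd_setU _ _ _ (BLeft (dl * N.+1%:R))) ?bnd_simp; last 2 first.
- by rewrite (le_trans _ N1)// oppr_le0.
- by rewrite e2 lerDl ltW.
rewrite Rintegral_setU//=; last 2 first.
- by apply: (@integrableS _ _ _ mu setT) => //; exact: measurableU.
- apply/disj_setPS => y [/=]; rewrite !in_itv/= => /andP[_ h1] /andP[h2 _].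
  by move: h1; rewrite ltNge h2.
rewrite (@itv_bndbnd_setU _ _ _ (BLeft (- (dl * N%:R)))) ?bnd_simp; last 2 first.
- by rewrite lerN2.
- by rewrite (le_trans _ N1)// oppr_le0.
rewrite Rintegral_setU//=; last 2 first.
- by apply: (@integrableS _ _ _ mu setT) => //; exact: measurableU.
- apply/disj_setPS => y [/=]; rewrite !in_itv/= => /andP[_ h1] /andP[h2 _].
  by move: h1; rewrite ltNge h2.
rewrite IH.
have -> : \int[mu]_(x in `[(- (dl * N.+1%:R)), (- (dl * N%:R))[) F x =
    \int[mu]_(s in `[0, dl[) f (iota s - dl * N.+1%:R).
  have := @Rintegral_shift_itv F 0 dl (- (dl * N.+1%:R)) mF.
  rewrite sub0r (_ : dl - _ = - (dl * N%:R)); last by rewrite e1; ring.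
  by move=> ->; apply: eq_Rintegral => s _; rewrite /F iotaBn.
have -> : \int[mu]_(x in `[(dl * N.+1%:R), (dl * N.+2%:R)[) F x =
    \int[mu]_(s in `[0, dl[) f (iota s + dl * N.+1%:R).
  have := @Rintegral_shift_itv F 0 dl (dl * N.+1%:R) mF.
  rewrite add0r (_ : dl + _ = dl * N.+2%:R); last by rewrite e2; ring.
  by move=> ->; apply: eq_Rintegral => s _; rewrite /F iotaDn.
have i1 : mu.-integrable `[0, dl[ (EFin \o (fun s => f (iota s - dl * N.+1%:R))).
  apply: (@integrableS _ _ _ mu setT) => //.
  have := @integrable_shift _ F (- (dl * N.+1%:R)) Fi.
  by under [_ \o _]eq_fun do rewrite /= /F iotaBn.
have i2 : mu.-integrable `[0, dl[ (EFin \o (fun s => f (iota s + dl * N.+1%:R))).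
  apply: (@integrableS _ _ _ mu setT) => //.
  have := @integrable_shift _ F (dl * N.+1%:R) Fi.
  by under [_ \o _]eq_fun do rewrite /= /F iotaDn.
have i3 := @integrable_symsum N `[0, dl[ (measurable_itv _).
rewrite -RintegralD// -RintegralD//; last exact: (integrableD _ i1 i3).
apply: eq_Rintegral => s _; rewrite /symsum big_nat_recr//=; ring.
Qed.

Lemma Rintegral_exhaust :
  \int[mu]_(t in `[- (dl * N%:R), dl * N.+1%:R[) F t @[N --> \oo] -->
  \int[mu]_t F t.
Proof.
under eq_fun do rewrite Rintegral_mkcond.
have [|N|x _||N x _|_ //] := @Rdominated_convergence _ _ R mu setT
  (fun N => F \_ `[- (dl * N%:R), dl * N.+1%:R[) F (fun x => `|F x|).
- by [].
- by apply/(measurable_restrictT _ _).1 => //; exact: measurable_funTS.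
- apply: cvg_near_cst; near=> N.
  rewrite patchE mem_set//= in_itv/=.
  have : `|x| / dl < N%:R by near: N; exact: nbhs_infty_gtr.
  rewrite ltr_pdivrMr// mulrC => h.
  have /andP[x1 x2] : - `|x| <= x <= `|x| by rewrite -ler_norml.
  rewrite -natr1 mulrDr mulr1 (le_trans _ x1) ?lerN2 ?(ltW h)//=.
  by rewrite (le_lt_trans x2)// (lt_trans h)// ltrDl.
- exact: integrable_norm.
- by rewrite patchE; case: ifP => // _; rewrite normr0.
Unshelve. all: by end_near. Qed.

(** The integrals over growing windows converge already; passing to their arithmetic means loses
    nothing and makes them comparable with Fejer means. *)
Lemma cvg_unfolded : arithmetic_mean (fun N => \int[mu]_(s in `[0, dl[)
    (f (iota s) + \sum_(0 <= n < N) (f (iota s + dl * n.+1%:R) + f (iota s - dl * n.+1%:R))))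
  @ \oo --> \int[mu]_t F t.
Proof.
apply: cesaro; have := Rintegral_exhaust.
by under eq_fun do rewrite Rintegral_symsum.
Qed.

Lemma arithmetic_mean_symsum n : arithmetic_mean (fun N => \int[mu]_(s in `[0, dl[)
    (symsum N (iota s))) n =
  \int[mu]_(s in `[0, dl[) (arithmetic_mean (fun N => symsum N (iota s)) n).
Proof.
rewrite /arithmetic_mean /series/=.
have h m : mu.-integrable `[0, dl[ (EFin \o (fun s => \sum_(0 <= k < m) symsum k (iota s))) /\
   \sum_(0 <= k < m) \int[mu]_(s in `[0, dl[) symsum k (iota s) =
   \int[mu]_(s in `[0, dl[) \sum_(0 <= k < m) symsum k (iota s).
  elim: m => [|m [IH1 IH2]].
    split; first by under [_ \o _]eq_fun do rewrite /= big_nil; exact: integrable0.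
    rewrite big_nil; under eq_Rintegral do rewrite big_nil.
    by rewrite Rintegral_cst// mul0r.
  have i := @integrable_symsum m `[0, dl[ (measurable_itv _).
  split.
    under [_ \o _]eq_fun do rewrite /= big_nat_recr//=.
    exact: (integrableD _ IH1 i).
  rewrite big_nat_recr//= IH2 -RintegralD//.
  by apply: eq_Rintegral => s _; rewrite big_nat_recr.
by rewrite (h n.+1).2 RintegralZl//; exact: (h n.+1).1.
Qed.

Lemma measurable_mean_symsum n :
  measurable_fun setT (fun s => arithmetic_mean (fun N => symsum N (iota s)) n).
Proof.
rewrite /arithmetic_mean /series/=; apply: measurable_funM => //.
elim: (n.+1) => [|m IH]; first by under eq_fun do rewrite big_nil; exact: measurable_cst.
under eq_fun do rewrite big_nat_recr//=.
apply: measurable_funD => //; exact: measurableT_comp.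
Qed.

End unfold.

(** Under the integral, the values at s + m dl and s - m dl add up to 2 cos (k s + th) cos (m dl k),
    and the last factors sum to the Dirichlet kernel. *)
Lemma ct_symsum A th (s : R) N : mu.-integrable setT (EFin \o A) ->
  ct A th s + \sum_(0 <= n < N) (ct A th (s + dl * n.+1%:R) + ct A th (s - dl * n.+1%:R)) =
  \int[mu]_k (A k * cos (k * s + th) * dirichlet N (dl * k)).
Proof.
move=> Ai; rewrite {1}/ct.
have b N' : exists2 M : R, forall x : R, `|dirichlet N' x| <= M & measurable_fun setT (fun k : R => dirichlet N' (dl * k)).
  exists (1 + 2 * N'%:R) => [x|].
    rewrite /dirichlet (le_trans (ler_normD _ _))// normr1 lerD2l.
    rewrite (le_trans (ler_norm_sum _ _ _))//.
    apply: (@le_trans _ _ (\sum_(0 <= i < N') 2)); last first.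
      by rewrite sumr_const_nat subn0 mulr_natr.
    by apply: ler_sum => i _; rewrite normrM ger0_norm// ler_piMr// cos_max.
  apply: measurableT_comp; last exact: measurable_funM.
  exact: continuous_measurableR (@continuous_dirichlet R N').
elim: N => [|N IH].
  by rewrite big_nil addr0; apply: eq_RintegralT => k; rewrite /dirichlet big_nil addr0 mulr1.
rewrite big_nat_recr//= addrA IH /ct -RintegralDT; [|exact: ct_integrable..].
have [M hM mD] := b N.
rewrite -RintegralDT//.
- apply: eq_RintegralT => k; rewrite /dirichlet big_nat_recr//=.
  rewrite (_ : k * (s + _) + th = (k * s + th) + N.+1%:R * (dl * k)); last by ring.
  rewrite (_ : k * (s - _) + th = (k * s + th) - N.+1%:R * (dl * k)); last by ring.
  rewrite (cosB (k * s + th)) (cosD (k * s + th) (_ * _)); ring.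
- apply: (integrableM_bounded (M := M)) => //; exact: ct_integrable.
- by apply: integrableDR; exact: ct_integrable.
Qed.

Section fourier_inversion.
Variables (A : R -> R) (th : R).
Hypotheses (cA : cinf A) (sA : csupp L A).

Let contA := cinf_continuous cA.
Let Ai : mu.-integrable setT (EFin \o A) := csupp_integrable contA sA.

Let T0 : R := dl + 1.

Let iota_bounded s : `[0, dl[%classic s -> `|iota s| <= T0.
Proof.
rewrite /= in_itv/= => /andP[s0 s1].
have {1}-> : iota s = (iota s - s) + s by ring.
rewrite (le_trans (ler_normD _ _))// addrC lerD ?iota_close// ger0_norm//.
exact: ltW.
Qed.

Let B s k := A k * cos (k * s + th).

(** One Lipschitz constant for all s in a period is needed, since the Fejer bound is used as a
    domination in s. *)
Let lipB : exists K : R, forall s, `|s| <= T0 -> forall x, `|B s x - B s 0| <= K * `|x|.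
Proof.
have [M0 h0] := csupp_bounded contA sA.
have [M1 h1] := csupp_bounded (cinf_continuous (cinf_derive cA)) (csupp_derive cA sA).
exists (M0 * T0 + M1) => s sT x; rewrite -[X in _ * `|X|]subr0.
apply: (@bounded_derivative_lipschitz _ (B s)
  (fun k => A k * (s * cos (s * k + (th + pi / 2))) + cos (s * k + th) * derive1 A k)).
  move=> k; have d1 := is_derive_cos_affine s th k; have d2 := cinf_is_derive k cA.
  rewrite (_ : B s = A * (fun k => cos (s * k + th))); last first.
    by apply/funext => y; rewrite /B mulrC /= [RHS]mulrC (mulrC y).
  exact: is_deriveM.
move=> k; rewrite (le_trans (ler_normD _ _))// lerD// normrM.
  by rewrite ler_pM// normrM (le_trans _ sT)// ler_piMr// cos_max.
by rewrite (le_trans _ (h1 k))// ler_piMl// cos_max.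
Qed.

(** The same sequence has two limits. Unfolding gives the integral on the left; the Fejer theorem
    gives 2 L A 0 cos th at every point of the period, and a period has length dl with L dl = pi.
    The value depends neither on [dl] nor on [iota], which is inversion for the identity and Poisson
    summation for the floor. *)
Lemma Rintegral_ct_iota : \int[mu]_t ct A th (iota t) = 2 * pi * A 0 * cos th.
Proof.
have [sm hM] := ct_schwartz1 th cA sA.
have [M {}hM] := hM 0%N 2%N; rewrite derive1n0 in hM.
have mf : measurable_fun setT (ct A th) := continuous_measurableR (cinf_continuous sm).
have c1 := cvg_unfolded mf hM.
have [K hK] := lipB.
have sB s : csupp L (B s) by exact: csuppM.
have cB s : continuous (B s).
  move=> k; apply: cvgM; first exact: contA.
  apply: continuous_comp; last exact: continuous_cos.
  by apply: cvgD; [apply: cvgMl; exact: cvg_id|exact: cvg_cst].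
have B0 s : B s 0 = A 0 * cos th by rewrite /B mul0r add0r.
pose u m s := arithmetic_mean (fun N => ct A th (iota s) + \sum_(0 <= n < N)
  (ct A th (iota s + dl * n.+1%:R) + ct A th (iota s - dl * n.+1%:R))) m.
have uE m s : u m s = arithmetic_mean (fun N => \int[mu]_k (B (iota s) k * dirichlet N (dl * k))) m.
  by rewrite /u; congr (arithmetic_mean _ m); apply/funext => N; exact: ct_symsum.
have {}c1 : \int[mu]_(s in `[0, dl[) u m s @[m --> \oo] --> \int[mu]_t ct A th (iota t).
  by under eq_fun do rewrite -(arithmetic_mean_symsum mf hM).
have c2 : \int[mu]_(s in `[0, dl[) u m s @[m --> \oo] -->
    \int[mu]_(s in `[0, dl[) (2 * L * (A 0 * cos th)).
  have [|N|s Ds||N s Ds|_ //] := @Rdominated_convergence _ _ R mu `[0, dl[ u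
    (fun=> 2 * L * (A 0 * cos th))
    (fun=> 2 * L * (4 * K / dl) + `|2 * L * (A 0 * cos th)|).
  - exact: measurable_itv.
  - exact: measurable_funTS (measurable_mean_symsum mf N).
  - have := fejer_cvg dl0 (cB (iota s)) (sB _) (hK _ (iota_bounded Ds)).
    rewrite B0; have -> // : (fun n => u n s) = arithmetic_mean
      (fun N => \int[mu]_k (B (iota s) k * dirichlet N (dl * k))).
    by apply/funext => m; exact: uE.
  - apply: (@integrableS _ _ _ mu `[0, dl]) => //.
      by apply: subset_itvl; rewrite bnd_simp.
    apply: continuous_compact_integrable; first exact: segment_compact.
    by apply: continuous_subspaceT => x; exact: cvg_cst.
  - have := fejer_bound dl0 (cB (iota s)) (sB _) (hK _ (iota_bounded Ds)) N.
    rewrite B0 -uE => h; rewrite -lerBlDr; apply: le_trans h.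
    exact: lerB_dist.
rewrite (cvg_unique _ c1 c2)//.
rewrite Rintegral_cst//= lebesgue_measure_itv/= lte_fin dl0 -EFinB/= subr0.
by rewrite /L; field; rewrite gt_eqF.
Qed.

End fourier_inversion.

(* Inversion at an arbitrary frequency, by translating the spectrum. *)
Lemma Rintegral_ct_cos c B k th : cinf B -> csupp c B -> (forall l, B (- l) = B l) ->
  c + c <= L -> `|k| <= c ->
  \int[mu]_t (ct B 0 (iota t) * cos (k * iota t + th)) = 2 * pi * B k * cos th.
Proof.
move=> cB sB BN cL kc; have contB := cinf_continuous cB.
have Bi := csupp_integrable contB sB.
(* The translate is supported in [-2 c, 2 c] because |k| <= c; this is the reason for requiring c +
   c <= L. *)
pose A l := B (1 * l + k).
have cA : cinf A by exact: cinf_affine.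
have sA : csupp L A.
  move=> l lL; apply: sB; rewrite mul1r.
  have := lerB_normD l k; lra.
have := Rintegral_ct_iota (- th) cA sA; rewrite /A mulr0 add0r cosN => <-.
apply: eq_RintegralT => t; set x := iota t.
(* The sine transform of the even [B] vanishes; adding it, times a sine, completes the addition
   formula for cos (l x - (k x + th)). *)
have odd : ct B (- (pi / 2)) x = 0.
  apply: Rintegral_odd.
  - exact: integrable_measurableR (ct_integrable _ _ Bi).
  - by move=> l; rewrite BN !cosBpihalf mulNr sinN mulrN.
  - exact: ct_integrable.
transitivity (ct B 0 x * cos (k * x + th) + ct B (- (pi / 2)) x * sin (k * x + th)).
  by rewrite odd mul0r addr0.
pose g l := B l * cos ((l - k) * x + - th).
transitivity (\int[mu]_l g l).
  rewrite /ct mulrC [X in _ + X]mulrC -!RintegralZl//; try exact: ct_integrable.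
  rewrite -RintegralDT//; try by apply: integrableZlR; exact: ct_integrable.
  apply: eq_RintegralT => l; rewrite addr0 cosBpihalf /g.
  rewrite (_ : (l - k) * x + - th = l * x - (k * x + th)); last by ring.
  rewrite (cosB (l * x)); ring.
rewrite -(Rintegral_shift k); last first.
  apply: measurable_funM; first exact: continuous_measurableR.
  apply: continuous_measurableR => l; apply: continuous_comp; last exact: continuous_cos.
  apply: cvgD; last exact: cvg_cst.
  by apply: cvgMl; apply: cvgB; [exact: cvg_id|exact: cvg_cst].
by apply: eq_RintegralT => l; rewrite /g addrK mul1r.
Qed.

(** After exchanging the integrals, the inner one is inversion for [B] at frequency k with phase k
    u. Only |k| <= c matters, since [A] vanishes elsewhere. No convolution of spectra appears: a
    correlation in space is a product in frequency. *)
Lemma parseval c A B u : cinf A -> csupp c A -> (forall l, A (- l) = A l) ->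
  cinf B -> csupp c B -> (forall l, B (- l) = B l) -> c + c <= L ->
  \int[mu]_t (ct A 0 (u + iota t) * ct B 0 (iota t)) =
  \int[mu]_k (2 * pi * (A k * B k) * cos (k * u)).
Proof.
move=> cA sA AN cB sB BN cL.
have contA := cinf_continuous cA.
have Ai := csupp_integrable contA sA.
have [sm /(_ 0%N 2%N)[M]] := ct_schwartz1 0 cB sB; rewrite derive1n0 => hM.
have mp : measurable_fun setT (ct B 0) := continuous_measurableR (cinf_continuous sm).
have pi_int := integrable_decay_iota mp hM.
pose f (z : R * R) := A z.2 * cos (z.2 * (u + iota z.1) + 0) * ct B 0 (iota z.1).
have mi1 : measurable_fun setT (fun z : R * R => iota z.1) by exact: measurableT_comp.
have mf : measurable_fun setT f.
  apply: measurable_funM; last exact: measurableT_comp.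
  apply: measurable_funM.
    by apply: (measurableT_comp (f := A)) => //; exact: continuous_measurableR.
  apply: (measurableT_comp (f := cos)); first exact: continuous_measurableR (@continuous_cos R).
  apply: measurable_funD => //; apply: measurable_funM => //.
  exact: measurable_funD.
transitivity (\int[mu]_t \int[mu]_k f (t, k)).
  apply: eq_RintegralT => t; rewrite /f/= RintegralZr//.
  exact: ct_integrable.
rewrite (@Rfubini _ _ _ _ R mu mu f (fun t => `|ct B 0 (iota t)|) (fun k => `|A k|))//; last 3 first.
- exact: integrable_norm pi_int.
- exact: integrable_norm Ai.
- by move=> t k; rewrite /f/= !normrM mulrC ler_wpM2l// ler_piMr// cos_max.
apply: eq_RintegralT => k; have [kc|/sA Ak] := leP `|k| c; last first.
  rewrite Ak !mul0r mulr0 mul0r; under eq_RintegralT do rewrite /f/= Ak !mul0r.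
  by rewrite /Rintegral integral0.
rewrite /f/=; under eq_RintegralT => t do
  rewrite -mulrA (mulrC (cos _)) addr0 mulrDr (addrC (k * u)).
rewrite RintegralZl//; first by rewrite (Rintegral_ct_cos _ cB sB)//; ring.
apply: (integrableM_bounded (M := 1 : R)) => //.
  apply: (measurableT_comp (f := cos)); first exact: continuous_measurableR (@continuous_cos R).
  by apply: measurable_funD => //; exact: measurable_funM.
by move=> t; exact: cos_max.
Qed.

End inversion.

(** * Separable functions on R^n *)

Section product2.
Context d1 d2 (T1 : measurableType d1) (T2 : measurableType d2) (R : realType).
Variables (m1 : {sigma_finite_measure set T1 -> \bar R})
          (m2 : {sigma_finite_measure set T2 -> \bar R}).

Lemma Rintegral_product (f : T1 * T2 -> R) (a : T1 -> R) (b : T2 -> R) :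
  measurable_fun setT f -> m1.-integrable setT (EFin \o a) ->
  m2.-integrable setT (EFin \o b) -> (forall x y, `|f (x, y)| <= a x * b y) ->
  Rintegral (m1 \x m2)%E setT f = \int[m1]_x \int[m2]_y f (x, y).
Proof.
move=> mf ai bi fab.
have fi := integrable_prod_dominated mf ai bi fab.
rewrite /Rintegral -(integral12_prod_meas1 fi); congr fine.
apply: eq_integral => x _; rewrite /fubini_F/= fineK//.
exact: (integrable_fin_num measurableT (integrable_fubini1 mf bi fab x)).
Qed.

End product2.

Section rV_integral.
Context {R : realType}.
Local Notation mu := (@lebesgue_measure R).
Local Notation leb := (lebesgue_rV R).

Lemma measurable_prod_coord n (f : 'I_n -> R -> R) :
  (forall i, measurable_fun setT (f i)) ->
  measurable_fun [set: 'rV[R]_n] (fun x => \prod_i f i (x ord0 i)).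
Proof.
move=> mf; apply: measurable_prod => i _.
exact: measurableT_comp (mf i) (@measurable_coord_rV R n i).
Qed.

Lemma cons_rV0 n p : @cons_rV R n p ord0 ord0 = p.1.
Proof. by rewrite mxE unlift_none. Qed.

Lemma cons_rVS n p i : @cons_rV R n p ord0 (lift ord0 i) = p.2 ord0 i.
Proof. by rewrite mxE liftK. Qed.

Lemma lebesgue_rVS n A : measurable A ->
  ((mu \x leb n)%E (@cons_rV R n @^-1` A) = leb n.+1 A)%E.
Proof. by []. Qed.

Let measurable_prod0 (f : 'I_0 -> R -> R) :
  measurable_fun [set: 'rV[R]_0] (fun x => \prod_i f i (x ord0 i)).
Proof. by under eq_fun do rewrite big_ord0; exact: measurable_cst. Qed.

Lemma prod_rV_integrable n (f : 'I_n -> R -> R) :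
  (forall i, mu.-integrable setT (EFin \o f i)) ->
  (leb n).-integrable setT (EFin \o (fun x : 'rV[R]_n => \prod_i f i (x ord0 i))) /\
  \int[leb n]_x (\prod_i f i (x ord0 i)) = \prod_i \int[mu]_t f i t.
Proof.
elim: n f => [|n IH] f fi.
  split.
    apply/integrableP; split.
      by apply/measurable_EFinP; exact: measurable_prod0.
    rewrite integral_dirac//.
      by rewrite diracT mul1e ltry.
    by apply/measurable_EFinP; apply: measurableT_comp => //; exact: measurable_prod0.
  rewrite /Rintegral integral_dirac//.
    by rewrite diracT mul1e/= !big_ord0.
  by apply/measurable_EFinP; exact: measurable_prod0.
have mf i : measurable_fun setT (f i) by exact: integrable_measurableR (fi i).
have [i1 i2] := IH (fun i => f (lift ord0 i)) (fun i => fi (lift ord0 i)).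
pose g (p : measurableTypeR R * 'rV[R]_n) := f ord0 p.1 * \prod_i f (lift ord0 i) (p.2 ord0 i).
have gE p : \prod_i f i (cons_rV p ord0 i) = g p.
  rewrite big_ord_recl cons_rV0; congr (_ * _).
  by apply: eq_bigr => i _; rewrite cons_rVS.
have mg : measurable_fun setT g.
  apply: measurable_funM; first exact: (measurableT_comp (mf ord0) measurable_fst).
  apply: (measurableT_comp (f := fun x : 'rV[R]_n => \prod_i f (lift ord0 i) (x ord0 i))) => //.
  exact: (measurable_prod_coord (f := fun i => f (lift ord0 i))).
pose a t := `|f ord0 t|; pose b (y : 'rV[R]_n) := `|\prod_i f (lift ord0 i) (y ord0 i)|.
have ai : mu.-integrable setT (EFin \o a) by exact: integrable_norm (fi ord0).
have bi : (leb n).-integrable setT (EFin \o b) by exact: integrable_norm i1.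
have gab x y : `|g (x, y)| <= a x * b y by rewrite normrM.
have gi := integrable_prod_dominated mg ai bi gab.
have mF := measurable_prod_coord mf.
split.
  apply/(integrable_mp (@measurable_cons_rV R n) (@lebesgue_rVS n)).
    exact/measurable_EFinP.
  by apply: eq_integrable gi => // p _ /=; rewrite gE.
rewrite (Rintegral_mp (@measurable_cons_rV R n) (@lebesgue_rVS n) mF).
under eq_RintegralT do rewrite gE.
rewrite (Rintegral_product mg ai bi gab).
rewrite /g/=; under eq_RintegralT do rewrite RintegralZl//.
by rewrite RintegralZr// i2 big_ord_recl.
Qed.

(** The induction moves the first coordinate into the phase of the remaining ones, hence the
    arbitrary [th]. At each stage evenness kills the sine part, and only a product of cosine
    integrals remains. *)
Lemma cos_rV_integral n (f : 'I_n -> R -> R) (u : 'I_n -> R) th :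
  (forall i, mu.-integrable setT (EFin \o f i)) ->
  (forall i t, f i (- t) = f i t) ->
  \int[leb n]_x (\prod_i f i (x ord0 i) * cos (\sum_i x ord0 i * u i + th)) =
  cos th * \prod_i \int[mu]_t (f i t * cos (t * u i)).
Proof.
have mc m (v : 'I_m -> R) t0 : measurable_fun setT (fun x : 'rV[R]_m => cos (\sum_i x ord0 i * v i + t0)).
  apply: (measurableT_comp (f := cos)); first exact: continuous_measurableR (@continuous_cos R).
  apply: measurable_funD => //; apply: measurable_sum => i.
  by apply: measurable_funM => //; exact: measurable_coord_rV.
elim: n f u th => [|n IH] f u th fi fN.
  rewrite /Rintegral integral_dirac//.
    by rewrite diracT mul1e/= !big_ord0 mul1r mulr1 add0r.
  by apply/measurable_EFinP/measurable_funM => //; exact: mc.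
have mf i : measurable_fun setT (f i) by exact: integrable_measurableR (fi i).
have [i1 i2] := prod_rV_integrable (fun i => fi (lift ord0 i)).
pose g (p : measurableTypeR R * 'rV[R]_n) := f ord0 p.1 *
  (\prod_i f (lift ord0 i) (p.2 ord0 i) *
   cos (\sum_i p.2 ord0 i * u (lift ord0 i) + (p.1 * u ord0 + th))).
have gE p : \prod_i f i (cons_rV p ord0 i) * cos (\sum_i cons_rV p ord0 i * u i + th) = g p.
  rewrite !big_ord_recl cons_rV0 /g -mulrA; congr (_ * (_ * cos _)).
    by apply: eq_bigr => i _; rewrite cons_rVS.
  rewrite [X in X + th]addrC -addrA; congr (_ + _).
  by apply: eq_bigr => i _; rewrite cons_rVS.
have mF : measurable_fun setT (fun x : 'rV[R]_n.+1 =>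
    \prod_i f i (x ord0 i) * cos (\sum_i x ord0 i * u i + th)).
  by apply: measurable_funM; [exact: measurable_prod_coord|exact: mc].
have mg : measurable_fun setT g.
  rewrite (_ : g = (fun x : 'rV[R]_n.+1 =>
    \prod_i f i (x ord0 i) * cos (\sum_i x ord0 i * u i + th)) \o @cons_rV R n).
    exact: measurableT_comp mF (@measurable_cons_rV R n).
  by apply/funext => p /=; rewrite gE.
pose a t := `|f ord0 t|; pose b (y : 'rV[R]_n) := `|\prod_i f (lift ord0 i) (y ord0 i)|.
have ai : mu.-integrable setT (EFin \o a) by exact: integrable_norm (fi ord0).
have bi : (leb n).-integrable setT (EFin \o b) by exact: integrable_norm i1.
have gab x y : `|g (x, y)| <= a x * b y.
  by rewrite /g/= !normrM ler_wpM2l// ler_piMr// cos_max.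
rewrite (Rintegral_mp (@measurable_cons_rV R n) (@lebesgue_rVS n) mF).
under eq_RintegralT do rewrite gE.
rewrite (Rintegral_product mg ai bi gab) /g/=.
set Q := \prod_(i < n) \int[mu]_t (f (lift ord0 i) t * cos (t * u (lift ord0 i))).
transitivity (\int[mu]_t (Q * (f ord0 t * cos (t * u ord0 + th)))).
  apply: eq_RintegralT => t.
  rewrite RintegralZl//; last first.
    apply: (integrableM_bounded (M := 1 : R)) => //; first exact: mc.
    by move=> x; exact: cos_max.
  by rewrite (IH (fun i => f (lift ord0 i)) (fun i => u (lift ord0 i)))// -/Q; ring.
rewrite RintegralZl//; last exact: ct_integrable.
rewrite big_ord_recl -/Q.
have od : ct (f ord0) (- (pi / 2)) (u ord0) = 0.
  apply: Rintegral_odd.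
  - exact: integrable_measurableR (ct_integrable _ _ (fi ord0)).
  - by move=> l; rewrite fN !cosBpihalf mulNr sinN mulrN.
  - exact: ct_integrable.
have -> : \int[mu]_t (f ord0 t * cos (t * u ord0 + th)) =
    cos th * ct (f ord0) 0 (u ord0) - sin th * ct (f ord0) (- (pi / 2)) (u ord0).
  rewrite /ct -!RintegralZl//; try exact: ct_integrable.
  rewrite -RintegralB//; try by apply: integrableZlR; exact: ct_integrable.
  by apply: eq_RintegralT => t; rewrite addr0 cosBpihalf cosD; ring.
rewrite od mulr0 subr0 /ct; under eq_RintegralT do rewrite addr0.
ring.
Qed.

End rV_integral.

Section separable_functions.
Context {R : realType} {n : nat} {I : finType}.
Implicit Types (f : I -> 'I_n -> R -> R) (c : I -> R).

(** The index type is left free: [phi] is indexed by [option 'I_n], and its squared spectrum by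
    pairs of such indices. *)
Definition sepsum c f (x : 'rV[R]_n) : R := \sum_a c a * \prod_i f a i (x ord0 i).

Lemma continuous_prod_coord (g : 'I_n -> R -> R) : (forall i, continuous (g i)) ->
  continuous (fun x : 'rV[R]_n => \prod_i g i (x ord0 i)).
Proof.
move=> cg x; elim: (index_enum _) => [|i s IH].
  by under eq_fun do rewrite big_nil; exact: cst_continuous.
under eq_fun do rewrite big_cons; apply: continuousM => //.
apply: (@continuous_comp _ _ _ (fun x : 'rV[R]_n => x ord0 i) (g i)); last exact: cg.
exact: coord_continuous.
Qed.

Lemma continuous_sepsum c f : (forall a i, continuous (f a i)) -> continuous (sepsum c f).
Proof.
move=> cf x; rewrite /sepsum; elim: (index_enum _) => [|a s IH].
  by under eq_fun do rewrite big_nil; exact: cst_continuous.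
under eq_fun do rewrite big_cons; apply: (@continuousD _ _ _ (fun x => _) (fun x => _)) => //.
apply: continuousM; first exact: cst_continuous.
exact: (continuous_prod_coord (cf a)).
Qed.

Lemma is_derive_prod_coord (g : 'I_n -> R -> R) (j : 'I_n) (x : 'rV[R]_n) :
  (forall i, cinf (g i)) ->
  is_derive x (delta_mx ord0 j) (fun x : 'rV[R]_n => \prod_i g i (x ord0 i))
    (\prod_i (if i == j then derive1 (g i) else g i) (x ord0 i)).
Proof.
move=> cg; pose P := \prod_(i | i != j) g i (x ord0 i).
have dg := cinf_is_derive (x ord0 j) (cg j).
have E h : \prod_i g i ((h *: delta_mx ord0 j + x) ord0 i) = g j (h *: 1 + x ord0 j) * P.
  rewrite (bigD1 j)//= !mxE !eqxx/=; congr (_ * _).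
  apply: eq_bigr => i ij; rewrite !mxE (negbTE ij)/=.
  by rewrite mulr0 add0r.
have E0 : \prod_i g i (x ord0 i) = g j (x ord0 j) * P by rewrite (bigD1 j).
have E1 : \prod_i (if i == j then derive1 (g i) else g i) (x ord0 i) =
    derive1 (g j) (x ord0 j) * P.
  by rewrite (bigD1 j)//= eqxx; congr (_ * _); apply: eq_bigr => i /negbTE ->.
have lim : h^-1 *: (\prod_i g i ((h *: delta_mx ord0 j + x) ord0 i) -
    \prod_i g i (x ord0 i)) @[h --> 0^'] --> derive1 (g j) (x ord0 j) * P.
  under eq_fun do rewrite E E0 -mulrBl scalerAl.
  apply: cvgMl; have [+ <-] := dg; rewrite /derivable /derive => /cvg_ex[l hl].
  by rewrite (cvg_lim _ hl).
rewrite E1; split; first by apply/cvg_ex; eexists; exact: lim.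
exact/cvg_lim.
Qed.

Lemma is_derive_sepsum c f (j : 'I_n) (x : 'rV[R]_n) :
  (forall a i, cinf (f a i)) ->
  is_derive x (delta_mx ord0 j) (sepsum c f)
    (sepsum c (fun a i => if i == j then derive1 (f a i) else f a i) x).
Proof.
move=> cf; rewrite /sepsum; elim: (index_enum _) => [|a s IH].
  rewrite big_nil; under eq_fun do rewrite big_nil; exact: is_derive_cst.
rewrite big_cons; under eq_fun do rewrite big_cons.
apply: is_deriveD.
have d := is_derive_prod_coord j x (cf a).
have := @is_deriveZ _ _ _ _ (c a) _ _ _ d.
by rewrite /GRing.scale.
Qed.

(** Each factor depends on one coordinate, so only the multiplicity of i in [s] matters for the i-th
    factor, and the result is again separable. *)
Lemma pderiv_sepsum c f s : (forall a i, cinf (f a i)) ->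
  pderiv s (sepsum c f) = sepsum c (fun a i => derive1n (count_mem i s) (f a i)).
Proof.
move=> cf; elim: s => [|j s IH].
  by rewrite /=; congr sepsum; apply/funext => a; apply/funext => i; rewrite derive1n0.
apply/funext => x; rewrite /= IH.
have d := @is_derive_sepsum c (fun a i => derive1n (count_mem i s) (f a i)) j x
  (fun a i => cinf_derive1n _ (cf a i)).
rewrite (@derive_val _ _ _ _ _ _ _ d); congr (sepsum c _ x).
apply/funext => a; apply/funext => i /=; rewrite eq_sym.
by case: eqVneq => _; rewrite ?add1n ?derive1nS ?add0n.
Qed.

Lemma smooth_sepsum c f : (forall a i, cinf (f a i)) -> smooth (sepsum c f).
Proof.
move=> cf s; rewrite pderiv_sepsum//; split.
  by apply: continuous_sepsum => a i; apply: cinf_continuous; exact: cinf_derive1n.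
move=> j x; have [] // := @is_derive_sepsum c (fun a i => derive1n (count_mem i s) (f a i)) j x _.
by move=> a i; exact: cinf_derive1n.
Qed.

Lemma csmooth_real (g : 'rV[R]_n -> R) : smooth g -> csmooth (fun x => (g x)%:C).
Proof.
move=> sg; split; first exact: sg.
have p0 s : pderiv s (fun _ : 'rV[R]_n => 0 : R) = fun=> 0.
  elim: s => //= i s ->; apply/funext => x; exact: derive_cst.
move=> s; rewrite [pderiv s _]p0; split; first exact: cst_continuous.
by move=> i x; exact: derivable_cst.
Qed.

Lemma enorm_ge0 (x : 'rV[R]_n) : 0 <= enorm x.
Proof. exact: sqrtr_ge0. Qed.

(** The euclidean norm is at most the sum of the |x_i|, which is one of the terms of the expanded
    product. Decay in the norm thus follows from decay in each coordinate. *)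
Lemma enorm_le_prod (x : 'rV[R]_n) : 1 + enorm x <= \prod_i (1 + `|x ord0 i|).
Proof.
have h1 : enorm x <= \sum_i `|x ord0 i|.
  have s0 : 0 <= \sum_i `|x ord0 i| by apply: sumr_ge0.
  rewrite -(ler_pXn2r (n := 2)) ?nnegrE ?enorm_ge0//.
  rewrite /enorm sqr_sqrtr; last by apply: sumr_ge0 => i _; rewrite -expr2 sqr_ge0.
  rewrite /dot; elim: (index_enum _) => [|i s IH]; first by rewrite !big_nil expr0n.
  rewrite !big_cons sqrrD -expr2 -[x ord0 i ^+ 2]real_normK ?num_real//.
  rewrite -addrA lerD2l (le_trans IH)// lerDr mulrn_wge0// mulr_ge0//.
  by apply: sumr_ge0.
rewrite (le_trans (lerD (lexx 1) h1))//.
elim: (index_enum _) => [|i s IH]; first by rewrite !big_nil addr0.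
rewrite !big_cons mulrDl mul1r addrCA addrC lerD//.
rewrite ler_peMr// (le_trans _ IH)// lerDl sumr_ge0//.
Qed.

Lemma sepsum_decay c f (N : nat) :
  (forall a i, exists M : R, forall x, (1 + `|x|) ^+ N * `|f a i x| <= M) ->
  exists M : R, forall x, (1 + enorm x) ^+ N * `|sepsum c f x| <= M.
Proof.
move=> dec; have [K hK] : exists K : I -> 'I_n -> R,
    forall a i x, (1 + `|x|) ^+ N * `|f a i x| <= K a i.
  have [K hK] := choice (fun p : I * 'I_n => dec p.1 p.2).
  by exists (fun a i => K (a, i)) => a i; exact: (hK (a, i)).
exists (\sum_a `|c a| * \prod_i K a i) => x.
have e0 : 0 <= (1 + enorm x) ^+ N by rewrite exprn_ge0// addr_ge0// enorm_ge0.
rewrite (le_trans (ler_wpM2l e0 (ler_norm_sum _ _ _)))// mulr_sumr.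
apply: ler_sum => a _; rewrite normrM mulrCA ler_wpM2l// normr_prod.
apply: (@le_trans _ _ (\prod_i (1 + `|x ord0 i|) ^+ N * \prod_i `|f a i (x ord0 i)|)).
  rewrite ler_wpM2r// ?prodr_ge0// prodrXl.
  by rewrite lerXn2r ?nnegrE ?addr_ge0 ?enorm_ge0 ?prodr_ge0 ?enorm_le_prod.
rewrite -big_split/=; apply: ler_prod => i _.
by rewrite hK mulr_ge0// exprn_ge0// addr_ge0.
Qed.

Lemma schwartz_sepsum c f : (forall a i, schwartz1 (f a i)) ->
  schwartz (fun x => (sepsum c f x)%:C).
Proof.
move=> sf; have cf a i : cinf (f a i) by have [] := sf a i.
split; first exact/csmooth_real/smooth_sepsum.
move=> s N.
have [|M hM] := @sepsum_decay c (fun a i => derive1n (count_mem i s) (f a i)) N.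
  by move=> a i; have [_] := sf a i; apply.
exists M => x; have p0 : pderiv s (fun _ : 'rV[R]_n => 0 : R) = fun=> 0.
  by elim: (s) => //= i s' ->; apply/funext => y; exact: derive_cst.
rewrite /cpderiv/= p0 pderiv_sepsum//.
by rewrite /ComplexField.Normc.normc expr0n/= addr0 sqrtr_sqr.
Qed.

End separable_functions.

Lemma Rintegral_sum d (T : measurableType d) (R : realType)
    (mu : {measure set T -> \bar R}) (I : finType) (c : I -> R) (g : I -> T -> R) :
  (forall a, mu.-integrable setT (EFin \o g a)) ->
  mu.-integrable setT (EFin \o (fun x => \sum_a c a * g a x)) /\
  \int[mu]_x (\sum_a c a * g a x) = \sum_a c a * \int[mu]_x g a x.
Proof.
move=> gi; elim: (index_enum _) => [|a s [IH1 IH2]].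
  split; first by under [_ \o _]eq_fun do rewrite /= big_nil; exact: integrable0.
  by rewrite big_nil; under eq_RintegralT do rewrite big_nil; rewrite /Rintegral integral0.
have i1 : mu.-integrable setT (EFin \o (fun x => c a * g a x)) by exact: integrableZlR.
split.
  under [_ \o _]eq_fun do rewrite /= big_cons; exact: integrableDR.
under eq_RintegralT do rewrite big_cons.
by rewrite RintegralDT// RintegralZl// IH2 big_cons.
Qed.

(** * The test function and its autocorrelation *)

Section test_function.
Context {R : realType} {n : nat}.
Local Notation mu := (@lebesgue_measure R).
Local Notation leb := (lebesgue_rV R).
Variables (W V : R -> R) (c r : R).
Hypotheses (cW : cinf W) (sW : csupp c W) (WN : forall k, W (- k) = W k).
Hypotheses (cV : cinf V) (sV : csupp c V) (VN : forall k, V (- k) = V k).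
Hypothesis p_ge0 : forall x, 0 <= ct W 0 x.
Hypothesis qE : forall x, ct V 0 x = x ^+ 2 * ct W 0 x.
Hypothesis W0 : 0 < W 0.
Hypothesis r0 : 0 < r.
Hypothesis rVW : n%:R * V 0 < r ^+ 2 * W 0.

Local Notation I := (option 'I_n).

(** [None] indexes the product of the p (x_i), and [Some j] the same product times x_j^2, whose j-th
    factor has spectrum [V]. *)
Definition spec (a : I) (i : 'I_n) : R -> R := if a == Some i then V else W.
Definition coef (a : I) : R := if a is Some _ then - r ^- 2 else 1.
Definition spec2 (ab : I * I) (i : 'I_n) (k : R) : R :=
  2 * pi * (spec ab.1 i k * spec ab.2 i k).
Definition coef2 (ab : I * I) : R := coef ab.1 * coef ab.2.

(* [phi x = (1 - |x|^2 / r^2) \prod_i p (x_i)], as a sum of separable terms. *)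
Definition phi : 'rV[R]_n -> R := sepsum coef (fun a i => ct (spec a i) 0).
(** The square of the spectrum of [phi], expanded over pairs of terms, with one factor 2 pi per
    coordinate coming from [parseval]. *)
Definition fhat : 'rV[R]_n -> R := sepsum coef2 spec2.

Let cS a i : cinf (spec a i). Proof. by rewrite /spec; case: ifP. Qed.
Let sS a i : csupp c (spec a i). Proof. by rewrite /spec; case: ifP. Qed.
Let SN a i k : spec a i (- k) = spec a i k. Proof. by rewrite /spec; case: ifP. Qed.

Let cS2 ab i : cinf (spec2 ab i).
Proof. by apply: cinfZ; apply: cinfM; exact: cS. Qed.
Let sS2 ab i : csupp c (spec2 ab i).
Proof. by move=> k /sS h; rewrite /spec2 h mul0r mulr0. Qed.

Lemma cinf_spec2 ab i : cinf (spec2 ab i). Proof. exact: cS2. Qed.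
Lemma csupp_spec2 ab i : csupp c (spec2 ab i). Proof. exact: sS2. Qed.

Lemma big_option (F : I -> R) : \sum_a F a = F None + \sum_i F (Some i).
Proof.
rewrite (bigD1 None)//=; congr (_ + _).
rewrite (reindex_omap Some id)//=; last by case.
by apply: eq_bigl => i; rewrite eqxx.
Qed.

Lemma phiE x : phi x = (1 - dot x x / r ^+ 2) * \prod_i ct W 0 (x ord0 i).
Proof.
rewrite /phi /sepsum big_option mul1r mulrBl mul1r; congr (_ + _).
rewrite /dot mulrAC mulr_suml -mulNr -sumrN mulr_suml; apply: eq_bigr => j _.
rewrite (bigD1 j)//= [in RHS](bigD1 j)//= /spec eqxx qE expr2.
rewrite (eq_bigr (fun i => ct W 0 (x ord0 i))); first by ring.
by move=> i ij; rewrite /spec (inj_eq Some_inj) eq_sym (negbTE ij).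
Qed.

Lemma phi_le0 x : r <= enorm x -> phi x <= 0.
Proof.
move=> rx; rewrite phiE mulr_le0_ge0//; last by rewrite prodr_ge0.
rewrite subr_le0 ler_pdivlMr ?exprn_gt0// mul1r.
have -> : dot x x = enorm x ^+ 2.
  by rewrite /enorm sqr_sqrtr// sumr_ge0// => i _; rewrite -expr2 sqr_ge0.
by rewrite lerXn2r ?nnegrE ?enorm_ge0// ltW.
Qed.

Lemma schwartz_phi : schwartz (fun x => (phi x)%:C).
Proof. by apply: schwartz_sepsum => a i; exact: ct_schwartz1 (cS a i) (sS a i). Qed.

Lemma schwartz_fhat : schwartz (fun x => (fhat x)%:C).
Proof. by apply: schwartz_sepsum => a i; exact: csupp_schwartz1 (cS2 a i) (sS2 a i). Qed.

Lemma phi_decay (N : nat) : exists M : R, forall x, (1 + enorm x) ^+ N * `|phi x| <= M.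
Proof.
apply: sepsum_decay => a i.
have [_ /(_ 0%N N)[M hM]] := ct_schwartz1 0 (cS a i) (sS a i).
by exists M => x; move: (hM x); rewrite derive1n0.
Qed.

(** Decay as a product over the coordinates, rather than in the norm, gives a weight whose sum over
    unit cells reduces to one-dimensional sums. *)
Lemma phi_prod_decay (N : nat) : exists M : R, forall x,
  `|phi x| <= M * \prod_i (1 + `|x ord0 i|) ^- N.
Proof.
have h (a : I) (i : 'I_n) : exists M : R, forall x, `|ct (spec a i) 0 x| <= M * (1 + `|x|) ^- N.
  have [_ /(_ 0%N N)[M hM]] := ct_schwartz1 0 (cS a i) (sS a i).
  exists M => x; move: (hM x); rewrite derive1n0 mulrC.
  by rewrite ler_pdivlMr// exprn_gt0// ltr_wpDr.
have [K hK] := choice (fun p : I * 'I_n => h p.1 p.2).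
exists (\sum_a `|coef a| * \prod_i K (a, i)) => x.
rewrite (le_trans (ler_norm_sum _ _ _))// mulr_suml; apply: ler_sum => a _.
rewrite normrM -mulrA ler_wpM2l// normr_prod -big_split/=; apply: ler_prod => i _.
by rewrite normr_ge0/=; exact: (hK (a, i)).
Qed.

Lemma fhat_supp (k : 'rV[R]_n) i : c < `|k ord0 i| -> fhat k = 0.
Proof.
move=> ck; rewrite /fhat /sepsum big1// => a _.
by rewrite (bigD1 i)//= sS2// mul0r mulr0.
Qed.

Lemma measurable_phi : measurable_fun setT phi.
Proof.
apply: measurable_sum => a; apply: measurable_funM => //.
apply: (measurable_prod_coord (f := fun i => ct (spec a i) 0)) => i.
exact: continuous_measurableR (cinf_continuous (ct_cinf _ (cS a i) (sS a i))).
Qed.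

Variables (dl : R) (iota : R -> R).
Hypothesis dl0 : 0 < dl.
Hypothesis miota : measurable_fun setT iota.
Hypothesis iotaD : forall t, iota (t + dl) = iota t + dl.
Hypothesis iota_close : forall t, `|iota t - t| <= 1.
Hypothesis cL : c + c <= pi / dl.
Hypothesis c0 : 0 < c.

Definition Jmap (x : 'rV[R]_n) : 'rV[R]_n := \row_i iota (x ord0 i).

Let integrable_prof a i : mu.-integrable setT (EFin \o (fun t => ct (spec a i) 0 (iota t))).
Proof.
have [sm /(_ 0%N 2%N)[M]] := ct_schwartz1 0 (cS a i) (sS a i).
rewrite derive1n0; apply: integrable_decay_iota => //.
exact: continuous_measurableR (cinf_continuous sm).
Qed.

(** For n > 0 the integral is (2 pi)^n (W 0)^(n-1) (W 0 - n V 0 / r^2), and [rVW] says that it is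
    positive. *)
Lemma integrable_phi_Jmap : (leb n).-integrable setT (EFin \o (fun t => phi (Jmap t))) /\
  0 < \int[leb n]_t phi (Jmap t).
Proof.
have h a := prod_rV_integrable (integrable_prof a).
have [i1 i2] := Rintegral_sum coef (fun a => (h a).1).
have E : (fun t => phi (Jmap t)) = fun t : 'rV[R]_n =>
    \sum_a coef a * \prod_i ct (spec a i) 0 (iota (t ord0 i)).
  apply/funext => t; rewrite /phi /sepsum; apply: eq_bigr => a _; congr (_ * _).
  by apply: eq_bigr => i _; rewrite mxE.
rewrite E; split => //; rewrite i2.
have v a i : \int[mu]_t ct (spec a i) 0 (iota t) = 2 * pi * spec a i 0.
  rewrite (Rintegral_ct_iota dl0 miota iotaD iota_close) ?cos0 ?mulr1//.
  by move=> x hx; apply: sS; apply: le_lt_trans hx; have := c0; have := cL; lra.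
under eq_bigr do rewrite (h _).2.
rewrite big_option mul1r.
under eq_bigr do rewrite v.
under [X in _ + X]eq_bigr => j _ do under eq_bigr do rewrite v.
have -> : \prod_(i < n) (2 * pi * spec None i 0) = (2 * pi * W 0) ^+ n.
  by rewrite (eq_bigr (fun=> 2 * pi * W 0))// prodr_const card_ord.
have vj j : coef (Some j) * \prod_(i < n) (2 * pi * spec (Some j) i 0) =
    - r ^- 2 * ((2 * pi * V 0) * (2 * pi * W 0) ^+ n.-1).
  congr (_ * _); rewrite (bigD1 j)//= /spec eqxx; congr (_ * _).
  rewrite (eq_bigr (fun=> 2 * pi * W 0)).
    by rewrite prodr_const cardC1 card_ord.
  by move=> i ij; rewrite (inj_eq Some_inj) eq_sym (negbTE ij).
under eq_bigr do rewrite vj.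
rewrite sumr_const card_ord.
have pi0 : 0 < 2 * pi :> R by rewrite mulr_gt0// pi_gt0.
(* A factor 2 pi W 0 can be split off the power only when n > 0; for n = 0 the second summand is
   empty. *)
case: n rVW => [|m] hm; first by rewrite expr0 addr0.
rewrite exprS -[X in _ + X]mulr_natl.
have -> : 2 * pi * W 0 * (2 * pi * W 0) ^+ m +
    m.+1%:R * (- r ^- 2 * (2 * pi * V 0 * (2 * pi * W 0) ^+ m.+1.-1)) =
    2 * pi * (2 * pi * W 0) ^+ m * r ^- 2 * (r ^+ 2 * W 0 - m.+1%:R * V 0).
  by rewrite /=; field; rewrite gt_eqF.
by rewrite mulr_gt0 ?subr_gt0// mulr_gt0 ?invr_gt0 ?exprn_gt0// mulr_gt0// exprn_gt0// mulr_gt0.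
Qed.

(** The phases 0 and pi / 2 give the real and the imaginary part of the Fourier transform of [fhat]:
    a correlation of [phi] and 0. *)
Lemma fhat_autocorrelation (u : 'rV[R]_n) th :
  \int[leb n]_k (fhat k * cos (dot k u + th)) =
  cos th * \int[leb n]_t (phi (u + Jmap t) * phi (Jmap t)).
Proof.
have S2i ab i : mu.-integrable setT (EFin \o spec2 ab i).
  exact: csupp_integrable (cinf_continuous (cS2 ab i)) (sS2 ab i).
have h1 ab := prod_rV_integrable (S2i ab).
have mcosdot : measurable_fun setT (fun k : 'rV[R]_n => cos (dot k u + th)).
  apply: (measurableT_comp (f := cos)); first exact: continuous_measurableR (@continuous_cos R).
  apply: measurable_funD => //; apply: measurable_sum => i.
  by apply: measurable_funM => //; exact: measurable_coord_rV.
have h2 ab : (leb n).-integrable setT (EFin \o (fun k : 'rV[R]_n =>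
    \prod_i spec2 ab i (k ord0 i) * cos (dot k u + th))).
  apply: (integrableM_bounded (M := 1 : R)) => //; first exact: (h1 ab).1.
  by move=> k; exact: cos_max.
have [_ i2] := Rintegral_sum coef2 h2.
transitivity (\int[leb n]_k \sum_ab coef2 ab *
    (\prod_i spec2 ab i (k ord0 i) * cos (dot k u + th))).
  by apply: eq_RintegralT => k; rewrite /fhat /sepsum mulr_suml; apply: eq_bigr => a _; rewrite mulrA.
rewrite i2.
have S2N ab i t : spec2 ab i (- t) = spec2 ab i t by rewrite /spec2 !SN.
under eq_bigr do rewrite (cos_rV_integral (fun i => u ord0 i) th (S2i _) (S2N _)).
have pars ab i : \int[mu]_t (spec2 ab i t * cos (t * u ord0 i)) =
    \int[mu]_t (ct (spec ab.1 i) 0 (u ord0 i + iota t) * ct (spec ab.2 i) 0 (iota t)).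
  by rewrite (parseval dl0 miota iotaD iota_close _ (cS ab.1 i) (sS ab.1 i) (@SN ab.1 i)
    (cS ab.2 i) (sS ab.2 i) (@SN ab.2 i)).
have gi ab i : mu.-integrable setT (EFin \o (fun t =>
    ct (spec ab.1 i) 0 (u ord0 i + iota t) * ct (spec ab.2 i) 0 (iota t))).
  have [M hM] := ct_bounded (csupp_integrable (cinf_continuous (cS ab.1 i)) (sS ab.1 i)).
  rewrite (_ : (fun t => _) = fun t => ct (spec ab.2 i) 0 (iota t) *
      ct (spec ab.1 i) 0 (u ord0 i + iota t)); last by apply/funext => t; exact: mulrC.
  apply: (integrableM_bounded (M := M)) => //.
  apply: (measurableT_comp (f := ct (spec ab.1 i) 0)); last exact: measurable_funD.
  exact: continuous_measurableR (cinf_continuous (ct_cinf _ (cS _ i) (sS _ i))).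
have h3 ab := prod_rV_integrable (gi ab).
have [_ i3] := Rintegral_sum coef2 (fun ab => (h3 ab).1).
have -> : \int[leb n]_t (phi (u + Jmap t) * phi (Jmap t)) =
   \int[leb n]_t \sum_ab coef2 ab * \prod_i
     (ct (spec ab.1 i) 0 (u ord0 i + iota (t ord0 i)) * ct (spec ab.2 i) 0 (iota (t ord0 i))).
  apply: eq_RintegralT => t; rewrite /phi /sepsum big_distrlr/= pair_bigA/=.
  apply: eq_bigr => ab _; rewrite /coef2 big_split/= mulrACA.
  congr (_ * _ * (_ * _)); apply: eq_bigr => i _; rewrite !mxE//.
rewrite i3 mulr_sumr; apply: eq_bigr => ab _; rewrite mulrCA; congr (_ * (_ * _)).
rewrite (h3 ab).2; apply: eq_bigr => i _; exact: pars.
Qed.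

End test_function.

(** * Linear statistics of zero variance *)

Section campbell.
Context {R : realType} {dO dE : measure_display}.
Context {Omega : measurableType dO} {E : measurableType dE}.
Variables (P : probability Omega R) (Xi : R.-ker Omega ~> E).
Variables (mu : {measure set E -> \bar R}) (rho : R).
Hypothesis rho0 : 0 < rho.
Hypothesis Xi_rho : has_intensity P Xi mu rho.
Local Open Scope ereal_scope.

Lemma measurable_integral_ker (f : E -> \bar R) : measurable_fun setT f ->
  (forall x, 0 <= f x) -> measurable_fun setT (fun w => \int[Xi w]_x f x).
Proof.
move=> mf f0; apply: measurable_fun_integral_kernel => // U mU.
exact: measurable_kernel.
Qed.

Import HBNNSimple.

Let campbell_nnsfun (h : {nnsfun E >-> R}) :
  \int[P]_w \int[Xi w]_x (h x)%:E = rho%:E * \int[mu]_x (h x)%:E.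
Proof.
have sE (m : {measure set E -> \bar R}) : \int[m]_x (h x)%:E = \sum_(r \in range h) r%:E * m (h @^-1` [set r]).
  by rewrite integralT_nnsfun sintegralE.
rewrite (eq_integral (fun w => \sum_(r \in range h) r%:E * Xi w (h @^-1` [set r]))); last first.
  by move=> w _; exact: sE.
rewrite sE.
rewrite ge0_integral_fsum//; last 2 first.
- move=> r; apply: measurable_funeM.
  exact: measurable_kernel.
- move=> r w _; have := mulemu_ge0 (fun n => h @^-1` [set n]).
  by apply; exact: preimage_nnfun0.
rewrite ge0_mule_fsumr; last first.
  move=> r; have := mulemu_ge0 (fun n => h @^-1` [set n]).
  by apply; exact: preimage_nnfun0.
apply: eq_fsbigr => r _; have [r0|r0] := leP 0%R r; last first.
  rewrite preimage_nnfun0// measure0 !mule0 integral0_eq// => w _.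
  by rewrite measure0 mule0.
rewrite ge0_integralZl//; last exact: measurable_kernel.
by rewrite Xi_rho// muleCA.
Qed.

(** [has_intensity] is the case of indicators; linearity extends it to simple functions and monotone
    convergence to all nonnegative ones. *)
Lemma campbell (f : E -> \bar R) : measurable_fun setT f -> (forall x, 0 <= f x) ->
  \int[P]_w \int[Xi w]_x f x = rho%:E * \int[mu]_x f x.
Proof.
move=> mf f0; pose f_ := nnsfun_approx measurableT mf.
have fE (m : {measure set E -> \bar R}) : \int[m]_x f x = limn (fun n => \int[m]_x (f_ n x)%:E).
  rewrite -monotone_convergence//.
  - by apply: eq_integral => x _; apply/esym/cvg_lim => //; exact: cvg_nnsfun_approx.
  - by move=> n; exact/measurable_EFinP.
  - by move=> n x _; rewrite lee_fin.
  - by move=> x _ a b ab; rewrite lee_fin; exact/lefP/nd_nnsfun_approx.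
have nd (m : {measure set E -> \bar R}) : nondecreasing_seq (fun n => \int[m]_x (f_ n x)%:E).
  move=> a b ab; apply: ge0_le_integral => //.
  - by move=> x _; rewrite lee_fin.
  - exact/measurable_EFinP.
  - exact/measurable_EFinP.
  - by move=> x _; rewrite lee_fin; exact/lefP/nd_nnsfun_approx.
rewrite (eq_integral (fun w => limn (fun n => \int[Xi w]_x (f_ n x)%:E))); last first.
  by move=> w _; exact: fE.
rewrite monotone_convergence//; last 2 first.
- move=> n; apply: measurable_integral_ker.
    exact/measurable_EFinP.
  by move=> x; rewrite lee_fin.
- by move=> n w _; apply: integral_ge0 => x _; rewrite lee_fin.
under eq_fun do rewrite campbell_nnsfun.
rewrite limeMl//; first by rewrite -fE.
exact: ereal_nondecreasing_is_cvgn (nd mu).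
Qed.

Section zero_variance.
Variable phi : E -> R.
Hypothesis phi_int : mu.-integrable setT (EFin \o phi).
Hypothesis phi_pos : (0 < \int[mu]_x phi x)%R.
Hypothesis second_moment :
  \int[P]_w ((\int[Xi w]_x `|phi x|%:E) * (\int[Xi w]_x `|phi x|%:E)) < +oo.
Let X (w : Omega) : R := (\int[Xi w]_x phi x)%R.
Hypothesis var0 : ccovariance P (linear_statistic Xi (fun x => (phi x)%:C%C))
  (linear_statistic Xi (fun x => (phi x)%:C%C)) = 0%R.

Let mphi : measurable_fun setT phi := integrable_measurableR phi_int.

Let mX : measurable_fun setT X.
Proof.
rewrite /X /Rintegral; apply: measurableT_comp; first exact: fine_measurable.
under eq_fun do rewrite integralE.
apply: emeasurable_funB; apply: measurable_integral_ker => //.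
- exact/measurable_funepos/measurable_EFinP.
- exact/measurable_funeneg/measurable_EFinP.
Qed.

(** This holds even where the integral of [phi] is infinite or undefined, since X w is then the
    default value 0. *)
Let X_le w : `|X w|%:E <= \int[Xi w]_x `|phi x|%:E.
Proof.
have h := @le_abse_integral _ _ _ (Xi w) setT (EFin \o phi) measurableT _.
apply: le_trans (h _); last exact/measurable_EFinP.
rewrite /X /Rintegral; case: (\int[Xi w]_x _) => [r| |]//=; rewrite ?normr0 ?leey//.
Qed.

Let X2_fin : P.-integrable setT (EFin \o (fun w => X w ^+ 2)%R).
Proof.
apply/integrableP; split; first by apply/measurable_EFinP; exact: measurable_funX.
apply: le_lt_trans second_moment; apply: ge0_le_integral => //.
- by apply/measurable_EFinP; apply: measurableT_comp => //; exact: measurable_funX.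
- apply: emeasurable_funM; apply: measurable_integral_ker => //;
    by apply/measurable_EFinP; exact: measurableT_comp.
- move=> w _; rewrite /= normrX expr2 EFinM lee_pmul//.
Qed.

Let X_fin : P.-integrable setT (EFin \o X).
Proof.
apply: (@le_integrableR _ _ _ _ _ (fun w => 1 + X w ^+ 2)%R) => //.
  move=> w; rewrite -real_normK ?num_real//; have := normr_ge0 (X w); nra.
by apply: integrableDR => //; exact: finite_measure_integrable_cst.
Qed.

Let m : R := (\int[P]_w X w)%R.

Let linE : linear_statistic Xi (fun x => (phi x)%:C%C) = fun w => (X w)%:C%C.
Proof.
apply/funext => w; rewrite /linear_statistic /cintegral/=.
by congr (_ +i* _)%C; rewrite /Rintegral integral0.
Qed.

(** The integrability of (X - m)^2 is essential: a real integral is 0 also when the extended one is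
    +oo, so [var0] alone would not exclude an infinite variance. *)
Let ae_X : {ae P, forall w, X w = m}.
Proof.
have iXm : P.-integrable setT (EFin \o (fun w => (X w - m) ^+ 2)%R).
  rewrite (_ : (fun w => _) = (fun w => X w ^+ 2 + (- (2 * m) * X w + m ^+ 2)))%R; last first.
    by apply/funext => w; ring.
  apply: integrableDR; first exact: X2_fin.
  apply: integrableDR; first exact: integrableZlR X_fin.
  exact: finite_measure_integrable_cst.
have v0 : (\int[P]_w ((X w - m) ^+ 2) = 0)%R.
  move: var0; rewrite linE /ccovariance /cintegral/=.
  have -> : (\int[P]_x 0 = 0)%R by rewrite /Rintegral integral0.
  move=> /(congr1 (@complex.Re R))/=.
  by under eq_RintegralT do rewrite subr0 oppr0 mulr0 subr0 -expr2.
have : ae_eq P setT (EFin \o (fun w => (X w - m) ^+ 2)%R) (cst 0).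
  apply/ae_eq_integral_abs => //; first exact: measurable_int iXm.
  under eq_integral do rewrite /= ger0_norm ?sqr_ge0//.
  have := integrable_fin_num measurableT iXm => /fineK <-.
  by move: v0; rewrite /Rintegral => ->.
apply: filterS => w /(_ I) /= [] /eqP; rewrite sqrf_eq0 subr_eq0 => /eqP.
by [].
Qed.

(** Campbell's formula is applied to the positive and negative parts of [phi] separately. Both
    statistics have finite mean, hence are finite almost surely, and X is almost surely their
    difference. *)
Let mean_pos : (0 < m)%R.
Proof.
pose fp := (EFin \o phi)^\+; pose fn := (EFin \o phi)^\-.
have mfp : measurable_fun setT fp by exact/measurable_funepos/measurable_EFinP.
have mfn : measurable_fun setT fn by exact/measurable_funeneg/measurable_EFinP.
have ip := integrable_funepos measurableT phi_int.
have im := integrable_funeneg measurableT phi_int.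
pose a w := \int[Xi w]_x fp x; pose b w := \int[Xi w]_x fn x.
have a0 w : 0 <= a w by apply: integral_ge0 => x _; exact: funepos_ge0.
have b0 w : 0 <= b w by apply: integral_ge0 => x _; exact: funeneg_ge0.
have ma : measurable_fun setT a.
  by apply: measurable_integral_ker => // x; exact: funepos_ge0.
have mb : measurable_fun setT b.
  by apply: measurable_integral_ker => // x; exact: funeneg_ge0.
have Ea : \int[P]_w a w = rho%:E * \int[mu]_x fp x
  by apply: campbell => // x; exact: funepos_ge0.
have Eb : \int[P]_w b w = rho%:E * \int[mu]_x fn x
  by apply: campbell => // x; exact: funeneg_ge0.
have fpf : \int[mu]_x fp x \is a fin_num by exact: integrable_fin_num.
have fnf : \int[mu]_x fn x \is a fin_num by exact: integrable_fin_num.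
have ai : P.-integrable setT a.
  apply/integrableP; split => //; under eq_integral do rewrite gee0_abs//.
  by rewrite Ea ltey_eq fin_numM.
have bi : P.-integrable setT b.
  apply/integrableP; split => //; under eq_integral do rewrite gee0_abs//.
  by rewrite Eb ltey_eq fin_numM.
have aeX : ae_eq P setT (EFin \o X) (a \- b).
  have := integrable_ae measurableT ai; have := integrable_ae measurableT bi.
  apply: filterS2 => w /(_ I) bf /(_ I) af _.
  by rewrite /= /X /Rintegral integralE fineK// fin_numB af bf.
have : m%:E = rho%:E * \int[mu]_x (phi x)%:E.
  rewrite /m /Rintegral fineK; last exact: integrable_fin_num.
  have -> : \int[P]_x (X x)%:E = \int[P]_w (a \- b) w.
    apply: ae_eq_integral aeX => //; last exact: emeasurable_funB.
    exact/measurable_EFinP.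
  rewrite (integralB measurableT ai bi) [in RHS]integralE muleBr//; last exact: fin_num_adde_defr.
  by congr (_ - _); [exact: Ea|exact: Eb].
have := integrable_fin_num measurableT phi_int => /fineK <-.
by move=> [->]; rewrite mulr_gt0.
Qed.

Lemma no_hole (A : set E) : measurable A -> (forall x, ~ A x -> phi x <= 0)%R ->
  P [set w | Xi w A = 0] = 0.
Proof.
move=> mA phiA; apply/negligibleP.
  have := measurable_kernel Xi A mA measurableT [set 0] (emeasurable_set1 0).
  by rewrite setTI.
apply: negligibleS (ae_X) => w /= XA0 Xm.
have : (X w <= 0)%R; last by rewrite Xm leNgt mean_pos.
rewrite /X /Rintegral integralE.
have mfp : measurable_fun setT (EFin \o phi)^\+ by exact/measurable_funepos/measurable_EFinP.
have -> : \int[Xi w]_x (EFin \o phi)^\+ x = 0.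
  rewrite -(setUv A) ge0_integral_setU//; last 3 first.
  - exact: measurableC.
  - by rewrite setUv.
  - by apply/disj_setPS; rewrite setICr.
  rewrite null_set_integral//; last exact: measurable_funTS.
  rewrite add0e integral0_eq// => x Ax; rewrite funeposE.
  by apply/max_idPr; rewrite lee_fin phiA.
rewrite sub0e fineN oppr_le0 fine_ge0// integral_ge0//.
Qed.

End zero_variance.

End campbell.

(** * Square integrability of linear statistics *)

Section second_moment.
Context {R : realType}.
Local Open Scope ereal_scope.

Lemma ge0_mule_nneseriesr (x : \bar R) (u : nat -> \bar R) : 0 <= x ->
  (forall n, 0 <= u n) -> x * \sum_(n <oo) u n = \sum_(n <oo) x * u n.
Proof.
move=> x0 u0; rewrite -(@ge0_integral_count _ u)// -ge0_integralZl//.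
by rewrite ge0_integral_count// => n; exact: mule_ge0.
Qed.

Context {dO dE : measure_display}.
Context {Omega : measurableType dO} {E : measurableType dE}.
Variables (P : probability Omega R) (Xi : R.-ker Omega ~> E).

(** The integral of |f| is at most the sum of the om_n N_n, where N_n counts the points of Q_n.
    Expanding the square, the second moment is at most 2 M times the squared sum of the weights,
    once E[N_m N_n] <= 2 M. *)
Lemma second_moment_series (Q : nat -> set E) (om : nat -> R) (f : E -> R) (M : \bar R) :
  (forall n, measurable (Q n)) -> trivIset setT Q -> \bigcup_n Q n = setT ->
  (forall n, (0 <= om n)%R) -> \sum_(n <oo) (om n)%:E < +oo ->
  measurable_fun setT f -> (forall n x, Q n x -> (`|f x| <= om n)%R) ->
  M < +oo -> (forall n, \int[P]_w (Xi w (Q n) * Xi w (Q n)) <= M) ->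
  \int[P]_w ((\int[Xi w]_x `|f x|%:E) * (\int[Xi w]_x `|f x|%:E)) < +oo.
Proof.
move=> mQ tQ UQ om0 omS mf fom Moo QM.
have mN n : measurable_fun setT (fun w => Xi w (Q n)) by exact: measurable_kernel.
have maf : measurable_fun setT (fun x => `|f x|%:E).
  by apply/measurable_EFinP; exact: measurableT_comp.
pose s n w := (om n)%:E * Xi w (Q n).
have s0 n w : 0 <= s n w by apply: mule_ge0 => //; rewrite lee_fin.
have ms n : measurable_fun setT (s n) by exact: measurable_funeM.
have Is w : \int[Xi w]_x `|f x|%:E <= \sum_(n <oo) s n w.
  rewrite -UQ ge0_integral_bigcup//; last by rewrite UQ.
  apply: lee_nneseries => [n _ _|n _]; first by apply: integral_ge0 => x _; rewrite lee_fin.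
  rewrite /s -(integral_cst _ (mQ n)); apply: ge0_le_integral => //.
  - exact: measurable_funTS.
  - by move=> x Qx; rewrite lee_fin; exact: fom.
have p0 m n w : 0 <= Xi w (Q m) * Xi w (Q n) by exact: mule_ge0.
have mp m n : measurable_fun setT (fun w => Xi w (Q m) * Xi w (Q n)).
  exact: emeasurable_funM.
(* The product of two counts is at most the larger square, hence at most the sum of the squares;
   this replaces the Cauchy-Schwarz inequality. *)
have cross m n : \int[P]_w (Xi w (Q m) * Xi w (Q n)) <= M + M.
  apply: le_trans (leeD (QM m) (QM n)); rewrite -ge0_integralD//.
  apply: ge0_le_integral => //; first exact: emeasurable_funD.
  move=> w _; have [mn|/ltW nm] := leP (Xi w (Q m)) (Xi w (Q n)).
  - by rewrite -[leLHS]add0e; apply: leeD; [exact: mule_ge0|exact: lee_pmul].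
  - by rewrite -[leLHS]adde0; apply: leeD; [exact: lee_pmul|exact: mule_ge0].
have M0 : 0 <= M by apply: le_trans (QM 0%N); apply: integral_ge0 => w _; exact: mule_ge0.
pose Y w := \sum_(m <oo) \sum_(n <oo) (om m * om n)%:E * (Xi w (Q m) * Xi w (Q n)).
have YE w : (\sum_(n <oo) s n w) * (\sum_(n <oo) s n w) = Y w.
  rewrite ge0_mule_nneseriesr//; last by exact: nneseries_ge0.
  apply: eq_eseriesr => m _; rewrite muleC ge0_mule_nneseriesr//.
  by apply: eq_eseriesr => n _; rewrite /s EFinM muleACA.
have t0 m n w : 0 <= (om m * om n)%:E * (Xi w (Q m) * Xi w (Q n)).
  by apply: mule_ge0; [rewrite lee_fin mulr_ge0|exact: mule_ge0].
have mt m n : measurable_fun setT (fun w => (om m * om n)%:E * (Xi w (Q m) * Xi w (Q n))).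
  by apply: measurable_funeM; exact: emeasurable_funM.
have mtt m : measurable_fun setT (fun w => \sum_(n <oo) (om m * om n)%:E * (Xi w (Q m) * Xi w (Q n))).
  exact: (@ge0_emeasurable_sum _ _ _ setT _ xpredT).
have tt0 m w : 0 <= \sum_(n <oo) (om m * om n)%:E * (Xi w (Q m) * Xi w (Q n)).
  by apply: nneseries_ge0.
apply: (@le_lt_trans _ _ (\int[P]_w Y w)).
  apply: ge0_le_integral => //.
  - by move=> w _; apply: mule_ge0; apply: integral_ge0 => x _; rewrite lee_fin.
  - by apply: emeasurable_funM; apply: measurable_integral_ker => // x; rewrite lee_fin.
  - exact: (@ge0_emeasurable_sum _ _ _ setT _ xpredT).
  - by move=> w _; rewrite -YE; apply: lee_pmul => //; apply: integral_ge0 => x _; rewrite lee_fin.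
rewrite integral_nneseries//.
set S := \sum_(n <oo) _ in omS.
have S0 : 0 <= S by apply: nneseries_ge0 => n _ _; rewrite lee_fin.
apply: (@le_lt_trans _ _ (S * (S * (M + M)))); last first.
  by rewrite !lte_mul_pinfty ?mule_ge0 ?adde_ge0 ?lte_add_pinfty// ?ge0_fin_numE// ?lte_mul_pinfty ?ge0_fin_numE// ?lte_add_pinfty// ?adde_ge0.
have e0 n : 0 <= (om n)%:E by rewrite lee_fin.
have MM0 : 0 <= M + M by exact: adde_ge0.
rewrite muleC ge0_mule_nneseriesr//; last exact: mule_ge0.
apply: lee_nneseries => [m _ _|m _]; first by apply: integral_ge0.
rewrite integral_nneseries// muleC (muleC S) ge0_mule_nneseriesr// ge0_mule_nneseriesr//; last first.
  by move=> n; exact: mule_ge0.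
apply: lee_nneseries => [n _ _|n _]; first by apply: integral_ge0.
rewrite ge0_integralZl// ?lee_fin ?mulr_ge0//.
rewrite EFinM -muleA; apply: lee_pmul => //; first by rewrite mule_ge0 ?integral_ge0.
by rewrite muleC; apply: lee_pmul => //; exact: integral_ge0.
Qed.

End second_moment.

(** * Sums over Z^n as integrals over R^n *)

Section floor_map.
Context {R : realType} {n : nat}.
Local Notation Zn := {ffun 'I_n -> int}.
Local Notation mu := (@lebesgue_measure R).
Local Notation leb := (lebesgue_rV R n).

Lemma measurable_fun_Zn d (T : measurableType d) (f : Zn -> T) : measurable_fun setT f.
Proof. by move=> _ Y _. Qed.

(** A partition of Z^n indexed by [nat]: a fiber is a singleton, or empty at a number that codes no
    point, so that series over [nat] enumerate Z^n without a bijection. *)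
Definition pickle_fiber (k : nat) : set Zn := [set v | pickle v = k].

Lemma pickle_fiberE k : pickle_fiber k = if pickle_inv k is Some v then [set v] else set0.
Proof.
apply/seteqP; split => [v /= <-|v]; first by rewrite pickleK_inv.
rewrite /pickle_fiber; case E : (pickle_inv k) => [w|]//= ->.
by have := @pickle_invK Zn k; rewrite E.
Qed.

Lemma trivIset_pickle_fiber : trivIset setT pickle_fiber.
Proof. by apply/trivIsetP => i j _ _ ij; apply/seteqP; split => // v [/= vi vj]; move: ij; rewrite -vi -vj eqxx. Qed.

Lemma bigcup_pickle_fiber : \bigcup_k pickle_fiber k = setT.
Proof. by apply/seteqP; split => // v _; exists (pickle v). Qed.

Definition floorZ (x : 'rV[R]_n) : Zn := [ffun i => Num.floor (x ord0 i)].

Lemma floorZ_preimage1 v : floorZ @^-1` [set v] =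
  ~` (\bigcup_i (coord_rV i @^-1` ~` `[(v i)%:~R, (v i)%:~R + 1[%classic)).
Proof.
rewrite setC_bigcup; apply/seteqP; split => [x /= <- i _|x /= h].
  rewrite /= /coord_rV ffunE => /=; apply; rewrite in_itv/=; exact: mem_rg1_floor.
apply/ffunP => i; rewrite ffunE; apply: floor_def.
by have := h i I; rewrite /= => /contrapT; rewrite in_itv/= /coord_rV intrD1.
Qed.

Lemma measurable_floorZ : measurable_fun setT floorZ.
Proof.
move=> _ Y _; rewrite setTI.
have -> : floorZ @^-1` Y = \bigcup_v (if v \in Y then floorZ @^-1` [set v] else set0).
  apply/seteqP; split => [x /= Yx|x [v _]].
    by exists (floorZ x) => //; rewrite mem_set.
  by case: ifPn => //; rewrite inE => Yv /= ->.
apply: countable_bigcupT_measurable => [|v]; first exact: (@countableP Zn).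
case: ifP => _ //.
rewrite floorZ_preimage1; apply: measurableC; apply: fin_bigcup_measurable => // i _.
by rewrite -[X in measurable X]setTI; apply: measurable_coord_rV => //; exact: measurableC.
Qed.

Lemma lebesgue_floorZ1 v : leb (floorZ @^-1` [set v]) = 1%E.
Proof.
have mA : measurable (floorZ @^-1` [set v]).
  by rewrite -[X in measurable X]setTI; exact: measurable_floorZ.
pose I i := `[(v i)%:~R, (v i)%:~R + 1[%classic : set R.
have m1 i : mu (I i) = 1%E.
  rewrite lebesgue_measure_itv/= lte_fin ltrDl ltr01.
  by rewrite -EFinB addrC addKr.
have f1 i : mu.-integrable setT (EFin \o (\1_(I i) : R -> R)).
  exact: integrable_indic_itv.
have [h1 h2] := prod_rV_integrable f1.
have E (x : 'rV[R]_n) : \prod_i \1_(I i) (x ord0 i) = \1_(floorZ @^-1` [set v]) x :> R.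
  rewrite floorZ_preimage1 setC_bigcup !indicE.
  have [xA|/existsNP[i /not_implyP[_ /contrapT xi]]] := pselect ((\bigcap_i ~` (coord_rV i @^-1` ~` I i)) x).
    rewrite (mem_set xA) big1// => i _; rewrite indicE mem_set//.
    by have := xA i Logic.I; rewrite /= => /contrapT.
  rewrite memNset; last by move=> /(_ i Logic.I); exact.
  by rewrite (bigD1 i)//= indicE memNset ?mul0r.
rewrite -[X in leb X]setIT -integral_indic//.
have -> : (\int[leb]_x (\1_(floorZ @^-1` [set v]) x)%:E)%E =
    (\int[leb]_x (\prod_i \1_(I i) (x ord0 i))%:E)%E.
  by apply: eq_integral => x _; rewrite E.
rewrite -[LHS]fineK; last exact: integrable_fin_num.
rewrite [fine _]h2 big1// => i _.
have -> : \int[mu]_t \1_(I i) t = fine (mu (I i `&` setT)).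
  by rewrite -integral_indic//; exact: measurable_itv.
by rewrite setIT m1.
Qed.

Lemma counting_unique (nu : set Zn -> \bar R) : nu set0 = 0%E ->
  (forall F : nat -> set Zn, trivIset setT F -> nu (\bigcup_k F k) = (\sum_(k <oo) nu (F k))%E) ->
  (forall v, nu [set v] = 1%E) -> forall A, nu A = counting A.
Proof.
move=> nu0 nuU nu1 A; have -> : A = \bigcup_k (A `&` pickle_fiber k).
  by rewrite -setI_bigcupr bigcup_pickle_fiber setIT.
have tA := @trivIset_setIl _ _ _ _ (fun=> A) trivIset_pickle_fiber.
rewrite nuU// measure_semi_bigcup//.
apply: eq_eseriesr => k _; rewrite pickle_fiberE.
case: (pickle_inv k) => [v|]; last by rewrite setI0 nu0 measure0.
have [Av|Av] := pselect (A v); last first.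
  rewrite (_ : _ `&` _ = set0) ?nu0 ?measure0//.
  by apply/seteqP; split => // x [Ax /= xv]; apply: Av; rewrite -xv.
rewrite (_ : _ `&` _ = [set v]); last by apply/seteqP; split => [x []|x /= ->].
transitivity (1%E : \bar R); first exact: nu1.
by change (1%E = counting [set v] :> \bar R); rewrite /counting asboolT// fset_set1 finmap.cardfs1.
Qed.

(** Unit cubes have measure 1, so the floor map carries Lebesgue measure to counting measure. Sums
    over Z^n thereby inherit the integration results on R^n. *)
Lemma floorZ_counting A : measurable A -> leb (floorZ @^-1` A) = counting A.
Proof.
move=> _; apply: (counting_unique (nu := fun A => leb (floorZ @^-1` A))).
- by rewrite preimage_set0 measure0.
- move=> F tF.
  have mF B : measurable (floorZ @^-1` B).
    by rewrite -[X in measurable X]setTI; exact: measurable_floorZ.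
  rewrite preimage_bigcup measure_semi_bigcup//; last by rewrite -preimage_bigcup.
  by apply/trivIsetP => i j _ _ ij; rewrite -preimage_setI; move/trivIsetP : tF => ->.
- exact: lebesgue_floorZ1.
Qed.

Lemma counting1 v : counting [set v : Zn] = 1%E :> \bar R.
Proof. by rewrite -floorZ_counting// lebesgue_floorZ1. Qed.

Lemma integrable_Zn (f : Zn -> R) : (@counting Zn R).-integrable setT (EFin \o f) <->
  leb.-integrable setT (EFin \o (f \o floorZ)).
Proof.
have := integrable_mp measurable_floorZ floorZ_counting (f := EFin \o f).
by apply; exact: measurable_fun_Zn.
Qed.

Lemma Rintegral_Zn (f : Zn -> R) : \int[@counting Zn R]_v f v = \int[leb]_x f (floorZ x).
Proof.
apply: (Rintegral_mp measurable_floorZ floorZ_counting).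
exact: measurable_fun_Zn.
Qed.

(** The exponent 2 makes each one-dimensional factor summable. *)
Definition weightZ (v : Zn) : R := \prod_i (1 + `|(v i)%:~R|) ^- 2.

Lemma weightZ_ge0 v : 0 <= weightZ v.
Proof. by apply: prodr_ge0 => i _; rewrite invr_ge0 exprn_ge0// addr_ge0. Qed.

Definition floorR (t : R) : R := (Num.floor t)%:~R.

Lemma measurable_floorR : measurable_fun setT floorR.
Proof.
apply: nondecreasing_measurable => // x y xy.
by rewrite ler_int; exact: le_floor.
Qed.

Lemma floorR_close t : `|floorR t - t| <= 1.
Proof.
have := mem_rg1_floor t; rewrite /range1/= => /andP[h1 h2].
by rewrite ler_norml; apply/andP; split; rewrite /floorR; lra.
Qed.

Lemma integrable_weightZ : (@counting Zn R).-integrable setT (EFin \o weightZ).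
Proof.
apply/integrable_Zn.
have h : mu.-integrable setT (EFin \o (fun t => (1 + `|floorR t|) ^- 2 : R)).
  apply: (integrable_decay_iota measurable_floorR floorR_close (M := 1) (f := fun x => (1 + `|x|) ^- 2)).
    apply: continuous_measurableR => x; apply: cvgV.
      by rewrite expf_neq0// gt_eqF// ltr_wpDr.
    by apply: cvgM; (apply: cvgD; [exact: cvg_cst|exact: norm_continuous]).
  move=> x; have x0 : 0 < 1 + `|x| by rewrite ltr_wpDr.
  by rewrite normfV normrX (ger0_norm (ltW x0)) divff// expf_neq0// gt_eqF.
have [+ _] := prod_rV_integrable (fun _ : 'I_n => h).
rewrite /= => hi; apply: eq_integrable hi => // x _ /=.
by congr EFin; apply: eq_bigr => i _; rewrite ffunE.
Qed.

End floor_map.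

(** * Stationary counts in unit cells *)

Section cells.
Context {R : realType} {n : nat} {dO dE : measure_display}.
Context {Omega : measurableType dO} {E : measurableType dE}.
Variables (P : probability Omega R) (Xi : R.-ker Omega ~> E) (add : E -> E -> E).
Hypothesis invXi : translation_invariant P Xi add.

Lemma translation_invariant_eval (A : set E) v (B : set (\bar R)) :
  measurable A -> measurable B ->
  P [set w | B (Xi w [set x | A (add x v)])] = P [set w | B (Xi w A)].
Proof.
move=> mA mB; have := invXi v (F := [set mu | B (mu A)]).
by apply; apply: sub_sigma_algebra; exists A, B.
Qed.

Local Notation Zn := {ffun 'I_n -> int}.
Variables (cell : E -> Zn) (tr : Zn -> E).
Hypothesis mcell : forall v, measurable (cell @^-1` [set v]).
Hypothesis cellD : forall x v, cell (add x (tr v)) = cell x + v.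
Hypothesis fin0 : (\int[P]_w (Xi w (cell @^-1` [set 0%R]) * Xi w (cell @^-1` [set 0%R])) < +oo)%E.

(** A point process has a finite second moment on each bounded set, but with no uniform bound;
    invariance makes the counts in all cells equal in law, which provides one. *)
Lemma cell_second_moment v :
  (\int[P]_w (Xi w (cell @^-1` [set v]) * Xi w (cell @^-1` [set v])) =
   \int[P]_w (Xi w (cell @^-1` [set 0%R]) * Xi w (cell @^-1` [set 0%R])))%E.
Proof.
have mX u : measurable_fun setT (fun w => Xi w (cell @^-1` [set u])).
  exact: measurable_kernel.
have sh : [set x | (cell @^-1` [set v]) (add x (tr v))] = cell @^-1` [set 0%R].
  apply/seteqP; split => x /=; rewrite cellD; first by move/(canRL (addrK _)); rewrite subrr.
  by move=> ->; rewrite add0r.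
have mp A : measurable A -> P ((fun w => Xi w (cell @^-1` [set 0%R])) @^-1` A) =
    pushforward P (fun w => Xi w (cell @^-1` [set v])) A.
  by move=> mA; rewrite /pushforward -sh; exact: translation_invariant_eval.
have mp' A : measurable A -> P ((fun w => Xi w (cell @^-1` [set v])) @^-1` A) =
    pushforward P (fun w => Xi w (cell @^-1` [set v])) A by [].
(* Absolute values make the integrand visibly nonnegative on all of the extended line, as the change
   of variables requires. *)
have msq : measurable_fun setT (fun y : \bar R => `|y| * `|y|)%E.
  by apply: emeasurable_funM; exact: abse_measurable.
have e u : (\int[P]_w (Xi w (cell @^-1` [set u]) * Xi w (cell @^-1` [set u])) =
   \int[P]_w (`|Xi w (cell @^-1` [set u])| * `|Xi w (cell @^-1` [set u])|))%E.
  by apply: eq_integral => w _; rewrite gee0_abs.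
rewrite e e -(ge0_integral_mp (mX v) mp' msq); last by move=> y; exact: mule_ge0.
by rewrite -(ge0_integral_mp (mX 0) mp msq)// => y; exact: mule_ge0.
Qed.

(** [cell] and [tr] are abstract so that one argument serves both spaces: the floor map on R^n and
    the identity on Z^n. *)
Lemma second_moment_cells (f : E -> R) (M : R) : measurable_fun setT f ->
  (forall x, `|f x| <= M * weightZ (cell x)) ->
  (\int[P]_w ((\int[Xi w]_x `|f x|%:E) * (\int[Xi w]_x `|f x|%:E)) < +oo)%E.
Proof.
move=> mf fM; pose K : R := `|M|.
have {}fM x : `|f x| <= K * weightZ (cell x).
  by apply: le_trans (fM x) _; rewrite ler_wpM2r ?weightZ_ge0// ler_norm.
pose Q k := cell @^-1` pickle_fiber k.
pose om k : R := if pickle_inv k is Some v then K * weightZ (v : Zn) else 0.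
have mQ k : measurable (Q k).
  rewrite /Q pickle_fiberE; case: pickle_inv => [v|]; first exact: mcell.
  by rewrite preimage_set0.
have om0 k : 0 <= om k.
  by rewrite /om; case: pickle_inv => // v; rewrite mulr_ge0 ?weightZ_ge0 ?normr_ge0.
apply: (second_moment_series (Q := Q) (om := om)) mf _ fin0 _ => //.
- by move=> i j _ _ [x [<- <-]].
- by rewrite /Q -preimage_bigcup bigcup_pickle_fiber.
- have /integrableP[_] := integrableZlR K (@integrable_weightZ R n).
  rewrite -bigcup_pickle_fiber ge0_integral_bigcup//; last exact: trivIset_pickle_fiber.
  apply: le_lt_trans; apply: lee_nneseries => [k _ _|k _]; first by rewrite lee_fin.
  rewrite pickle_fiberE /om; case: pickle_inv => [v|]; last by rewrite integral_set0.
  rewrite (@eq_integral _ _ _ _ [set v] (cst (K * weightZ v)%:E)); last first.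
    by move=> x; rewrite inE/= => ->; rewrite ger0_norm// mulr_ge0 ?weightZ_ge0 ?normr_ge0.
  rewrite integral_cst// -[leLHS]mule1 lee_pmul ?lee_fin ?mulr_ge0 ?weightZ_ge0 ?normr_ge0//.
  by rewrite [X in (_ <= X)%E](_ : _ = counting [set (v : Zn)])// counting1.
- move=> k x /= <-; rewrite /om pickleK_inv; exact: fM.
- move=> k; rewrite /Q pickle_fiberE; case: pickle_inv => [v|]; first by rewrite cell_second_moment.
  rewrite preimage_set0 (eq_integral (cst 0%E)) ?integral0.
    by apply: integral_ge0 => w _; exact: mule_ge0.
  by move=> w _; rewrite measure0 mul0e.
Qed.

End cells.

Lemma mulCr_re (R : realType) (a : R) (z : R[i]) : complex.Re (a%:C * z) = a * complex.Re z.
Proof. by case: z => x y /=; rewrite mul0r subr0. Qed.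

Lemma mulCr_im (R : realType) (a : R) (z : R[i]) : complex.Im (a%:C * z) = a * complex.Im z.
Proof. by case: z => x y /=; rewrite mul0r addr0. Qed.

Lemma sinN_cosDpihalf (R : realType) (x : R) : sin (- x) = cos (x + pi / 2).
Proof. by rewrite sinN cosDpihalf. Qed.

(** * Processes on R^n *)

Section euclidean_ball.
Context {R : realType} {n : nat}.
Implicit Types x k : 'rV[R]_n.

Lemma measurable_enorm : measurable_fun setT (@enorm R n).
Proof.
apply: (@measurableT_comp _ _ _ _ _ _ (@Num.sqrt R)).
  exact: continuous_measurableR (@sqrt_continuous R).
apply: measurable_sum => i.
by apply: measurable_funM; exact: measurable_coord_rV.
Qed.

Lemma eball0 (r : R) x : eball 0 r x <-> enorm x < r.
Proof. by rewrite /eball/= subr0. Qed.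

Lemma measurable_eball (c : 'rV[R]_n) (r : R) : measurable (eball c r).
Proof.
have -> : eball c r = (fun x => enorm (x - c)) @^-1` `]-oo, r[%classic.
  by apply/seteqP; split => x; rewrite /= in_itv.
rewrite -[X in measurable X]setTI.
have : measurable_fun setT (fun x => enorm (x - c)); last by apply.
apply: measurableT_comp; first exact: measurable_enorm.
apply: measurable_fun_rV => i; under eq_fun do rewrite !mxE.
by apply: measurable_funB => //; exact: measurable_coord_rV.
Qed.

Lemma enorm_lt (c b : R) k : 0 <= c -> n%:R * c ^+ 2 < b ^+ 2 -> 0 <= b ->
  (forall i, `|k ord0 i| <= c) -> enorm k < b.
Proof.
move=> c0 cb b0 kc; rewrite -(@ltr_pXn2r _ 2)// ?nnegrE ?enorm_ge0//.
rewrite /enorm sqr_sqrtr; last by apply: sumr_ge0 => i _; rewrite -expr2 sqr_ge0.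
apply: le_lt_trans cb; rewrite mulr_natl -[n in leRHS]card_ord -sumr_const.
by apply: ler_sum => i _; rewrite -expr2 -real_normK ?num_real// lerXn2r ?nnegrE.
Qed.

Lemma eball_translate (r : R) (v : 'rV[R]_n) : [set x | eball v r (x + v)] = eball 0 r.
Proof. by apply/seteqP; split => x; rewrite /eball/= subr0 addrK. Qed.

Lemma measurable_floorZ1 v : measurable (@floorZ R n @^-1` [set v]).
Proof. by rewrite -[X in measurable X]setTI; exact: measurable_floorZ. Qed.

Lemma floorZD x v : floorZ (x + rV_of_Zn v) = floorZ x + v.
Proof.
apply/ffunP => i; rewrite [LHS]ffunE [RHS]ffunE [X in _ = X + _]ffunE.
rewrite (_ : _ ord0 i = x ord0 i + (v i)%:~R); last by rewrite !mxE.
by rewrite floorDrz ?intrKfloor//; exact: intr_int.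
Qed.

Lemma enorm_floorZ0 x : floorZ x = 0 -> enorm x <= n%:R + 1.
Proof.
move=> x0; have n0 : 0 <= n%:R :> R by [].
apply/ltW/(@enorm_lt 1) => //; first by rewrite expr1n mulr1; nra.
move=> i; have := floorR_close (x ord0 i); rewrite /floorR.
have -> : Num.floor (x ord0 i) = 0 by move/ffunP: x0 => /(_ i); rewrite !ffunE.
by rewrite sub0r normrN.
Qed.

Lemma cintegral_null (S : {measure set 'rV[R]_n -> \bar R}) (D B : set 'rV[R]_n) (f : 'rV[R]_n -> R) :
  measurable D -> measurable B -> S B = 0%E -> measurable_fun setT f ->
  (forall x, D x -> ~ B x -> f x = 0) ->
  cintegral S D (fun x => (f x)%:C) = 0.
Proof.
move=> mD mB SB mf f0; rewrite /cintegral/=; congr (_ +i* _); last first.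
  by rewrite /Rintegral integral0.
rewrite /Rintegral integral_mkcond.
have -> : ((fun x => (f x)%:E) \_ D) = ((EFin \o f) \_ D) \_ B.
  apply/funext => x; rewrite !patchE; case: ifPn => xD; case: ifPn => // xB.
  by rewrite f0//; [rewrite inE in xD|rewrite notin_setE in xB].
rewrite -integral_mkcond null_set_integral//.
apply: measurable_funTS; apply/(measurable_restrictT _ mD).
by apply: measurable_funTS; exact/measurable_EFinP.
Qed.

End euclidean_ball.

Section euclidean_case.
Context {R : realType} {n : nat}.
Local Notation leb := (lebesgue_rV R n).
Variables (W V : R -> R) (c r b : R).
Hypotheses (cW : cinf W) (sW : csupp c W) (WN : forall k, W (- k) = W k).
Hypotheses (cV : cinf V) (sV : csupp c V) (VN : forall k, V (- k) = V k).
Hypothesis p_ge0 : forall x, 0 <= ct W 0 x.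
Hypothesis qE : forall x, ct V 0 x = x ^+ 2 * ct W 0 x.
Hypothesis W0 : 0 < W 0.
Hypothesis r0 : 0 < r.
Hypothesis rVW : n%:R * V 0 < r ^+ 2 * W 0.
Hypothesis c0 : 0 < c.
Hypothesis b0 : 0 <= b.
Hypothesis cb : n%:R * c ^+ 2 < b ^+ 2.

Local Notation phi := (@phi R n W V r).
Local Notation fhat := (@fhat R n W V r).

Lemma fhat_eball k : ~ eball 0 b k -> fhat k = 0.
Proof.
move=> kb; have [kc|/existsNP[i /negP]] := pselect (forall i, `|k ord0 i| <= c).
  by exfalso; apply: kb; apply/eball0; exact: enorm_lt (ltW c0) cb b0 kc.
by rewrite -ltNge => /(fhat_supp r sW sV).
Qed.

Lemma measurable_fhat : measurable_fun setT fhat.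
Proof.
apply: measurable_sum => a; apply: measurable_funM => //.
apply: (measurable_prod_coord (f := fun i => spec2 W V a i)) => i.
exact: continuous_measurableR (cinf_continuous (cinf_spec2 cW cV a i)).
Qed.

Lemma phi_weightZ : exists M, forall x, `|phi x| <= M * weightZ (floorZ x).
Proof.
have [M hM] := @phi_prod_decay R n W V c r cW sW cV sV 2%N.
(* Per coordinate, 1 + |floor y| <= 2 (1 + |y|), and squaring costs a factor 4. *)
exists (`|M| * 4 ^+ n) => x; apply: le_trans (hM x) _.
apply: (@le_trans _ _ (`|M| * \prod_i (1 + `|x ord0 i|) ^- 2)).
  rewrite ler_wpM2r ?ler_norm//; apply: prodr_ge0 => i _.
  by rewrite invr_ge0 exprn_ge0// addr_ge0.
rewrite -mulrA ler_wpM2l// -[in 4 ^+ n](card_ord n) -prodr_const -big_split/=.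
apply: ler_prod => i _; rewrite invr_ge0 exprn_ge0 ?addr_ge0//= ffunE.
set y := x ord0 i; have y0 : 0 < 1 + `|y| by rewrite ltr_wpDr.
have z0 : 0 < 1 + `|(Num.floor y)%:~R : R| by rewrite ltr_wpDr.
rewrite -[leLHS]mul1r ler_pdivrMr ?exprn_gt0// mulrAC ler_pdivlMr ?exprn_gt0// mul1r.
have : `|(Num.floor y)%:~R : R| <= 1 + `|y|.
  rewrite -[X in `|X| <= _](subrK y) (le_trans (ler_normD _ _))// lerD2r.
  exact: floorR_close.
have -> : 4 * (1 + `|y|) ^+ 2 = (2 * (1 + `|y|)) ^+ 2 by rewrite exprMn -natrX.
by move=> h; rewrite lerXn2r ?nnegrE ?(ltW z0)// ?mulr_ge0// ?(ltW y0)//; have := normr_ge0 y; lra.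
Qed.

(** The identity commutes with every translation, so the period is free; this choice turns the
    constraint [cL] into an equality. *)
Let dl := pi / (2 * c).
Let dl0 : 0 < dl. Proof. by rewrite divr_gt0 ?pi_gt0// mulr_gt0. Qed.
Let cL : c + c <= pi / dl.
Proof.
have pi0 := pi_gt0 R.
rewrite /dl invf_div mulrCA mulfV ?gt_eqF// mulr1; lra.
Qed.
Let id_close (t : R) : `|id t - t| <= 1. Proof. by rewrite subrr normr0. Qed.
Let JmapE : Jmap id = id :> ('rV[R]_n -> 'rV[R]_n).
Proof. by apply/funext => x; apply/rowP => i; rewrite mxE. Qed.

(** The right side is the argument that [covariance_functional] gives to [beta] when both test
    functions are [phi]. The variance is therefore [beta (fourier fhat)], which [structure_function]
    rewrites as an integral against [S]. *)
Lemma fourier_fhat : fourier (fun k => (fhat k)%:C) =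
  fun u => cintegral leb setT (fun t => (phi (u + t))%:C * conjc (phi t)%:C).
Proof.
apply/funext => u; rewrite /fourier /cintegral.
have h := @fhat_autocorrelation R n W V c r cW sW WN cV sV VN dl id dl0
  (@measurable_id _ _ _) (fun=> erefl) id_close cL u.
rewrite JmapE in h.
have dotC k : dot u k = dot k u by rewrite /dot; apply: eq_bigr => i _; rewrite mulrC.
congr (_ +i* _).
- under eq_RintegralT do rewrite mulCr_re/= cosN -[dot u _]addr0 dotC.
  under [RHS]eq_RintegralT do rewrite mulCr_re/=.
  by rewrite h cos0 mul1r.
- under eq_RintegralT do rewrite mulCr_im/= sinN_cosDpihalf dotC.
  under [RHS]eq_RintegralT do rewrite mulCr_im/= oppr0 mulr0.
  by rewrite h cos_pihalf mul0r /Rintegral integral0.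
Qed.

Section process.
Context {dO : measure_display} {Omega : measurableType dO}.
Variables (P : probability Omega R) (Xi : R.-ker Omega ~> 'rV[R]_n) (rho : R).
Variables (beta : ('rV[R]_n -> R[i]) -> R[i]) (S : {measure set 'rV[R]_n -> \bar R}).
Hypothesis Xi_pp : point_process P Xi ebounded.
Hypothesis Xi_inv : translation_invariant P Xi +%R.
Hypothesis rho0 : 0 < rho.
Hypothesis Xi_rho : has_intensity P Xi leb rho.
Hypothesis Xi_beta : covariance_functional P Xi beta.
Hypothesis beta_S : structure_function beta S.
Hypothesis S_b : S (eball 0 b) = 0%E.

Let var0 : ccovariance P (linear_statistic Xi (fun x => (phi x)%:C))
  (linear_statistic Xi (fun x => (phi x)%:C)) = 0.
Proof.
have sphi := @schwartz_phi R n W V c r cW sW cV sV.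
rewrite (Xi_beta.2 _ _ sphi sphi) -fourier_fhat.
rewrite -(beta_S (@schwartz_fhat R n W V c r cW sW cV sV)).2.
apply: (cintegral_null (B := eball 0 b)) => //.
- exact: measurable_eball.
- exact: measurable_fhat.
- by move=> x _; exact: fhat_eball.
Qed.

Let cell0_fin : (\int[P]_w (Xi w (floorZ @^-1` [set 0%R]) * Xi w (floorZ @^-1` [set 0%R])) < +oo)%E.
Proof.
apply: (Xi_pp _ _).2; first exact: measurable_floorZ1.
by exists (n%:R + 1) => x; exact: enorm_floorZ0.
Qed.

Lemma no_hole_euclidean x : P [set w | Xi w (eball x r) = 0%E] = 0%E.
Proof.
have := translation_invariant_eval Xi_inv x (measurable_eball x r) (emeasurable_set1 0%E).
rewrite /= => <-; rewrite eball_translate.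
have [iphi pphi] := integrable_phi_Jmap cW sW cV sV W0 r0 rVW dl0 (@measurable_id _ _ _) (fun=> erefl) id_close cL c0.
rewrite JmapE in iphi pphi.
apply: (no_hole rho0 Xi_rho iphi pphi _ var0).
- have [M hM] := phi_weightZ.
  apply: (second_moment_cells Xi_inv (cell := floorZ) (tr := @rV_of_Zn R n)) hM.
  + exact: measurable_floorZ1.
  + exact: floorZD.
  + exact: cell0_fin.
  + exact: (measurable_phi r cW sW cV sV).
- exact: measurable_eball.
- move=> y /eball0 /negP; rewrite -leNgt; exact: phi_le0.
Qed.

End process.

End euclidean_case.

(** * Processes on Z^n *)

Section real_covariance.
Context {R : realType} {dO : measure_display} {Omega : measurableType dO}.
Variable P : probability Omega R.
Implicit Types X Y : Omega -> R.

Lemma ccovariance_real X Y :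
  ccovariance P (fun w => (X w)%:C) (fun w => (Y w)%:C) =
  (\int[P]_w ((X w - \int[P]_z X z) * (Y w - \int[P]_z Y z)))%:C.
Proof.
have i0 : \int[P]_w (0 : R) = 0 by rewrite /Rintegral integral0.
rewrite /ccovariance /cintegral/= i0; congr (_ +i* _).
  by apply: eq_RintegralT => w; rewrite subr0 mul0r subr0.
rewrite -[RHS]i0; apply: eq_RintegralT => w.
by rewrite subr0 oppr0 mulr0 mul0r addr0.
Qed.

Lemma integrable_square X : measurable_fun setT X ->
  P.-integrable setT (EFin \o (fun w => X w ^+ 2)) ->
  forall m, P.-integrable setT (EFin \o (fun w => (X w - m) ^+ 2)).
Proof.
move=> mX X2 m.
have iX : P.-integrable setT (EFin \o X).
  apply: (@le_integrableR _ _ _ _ _ (fun w => 1 + X w ^+ 2)) => //.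
    move=> w; rewrite -real_normK ?num_real//; have := normr_ge0 (X w); nra.
  by apply: integrableDR => //; exact: finite_measure_integrable_cst.
rewrite (_ : (fun w => _) = (fun w => X w ^+ 2 + (- (2 * m) * X w + m ^+ 2))); last first.
  by apply/funext => w; ring.
apply: integrableDR; first exact: X2.
apply: integrableDR; first exact: integrableZlR iX.
exact: finite_measure_integrable_cst.
Qed.

(** Since both functions have the same second moment, |f g| <= (f^2 + g^2) / 2 already gives the
    Cauchy-Schwarz bound. *)
Lemma Rintegral_mul_le (f g : Omega -> R) (B : R) :
  measurable_fun setT f -> measurable_fun setT g ->
  P.-integrable setT (EFin \o (fun w => f w ^+ 2)) ->
  P.-integrable setT (EFin \o (fun w => g w ^+ 2)) ->
  \int[P]_w (f w ^+ 2) = B -> \int[P]_w (g w ^+ 2) = B ->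
  `|\int[P]_w (f w * g w)| <= B.
Proof.
move=> mf mg f2 g2 fB gB.
have i2 : P.-integrable setT (EFin \o (fun w => 2^-1 * (f w ^+ 2 + g w ^+ 2))).
  by apply: integrableZlR; exact: integrableDR.
have h w : `|f w * g w| <= 2^-1 * (f w ^+ 2 + g w ^+ 2).
  rewrite normrM -(real_normK (num_real (f w))) -(real_normK (num_real (g w))).
  by have := sqr_ge0 (`|f w| - `|g w|); nra.
have ifg : P.-integrable setT (EFin \o (fun w => f w * g w)).
  by apply: (le_integrableR _ h) => //; exact: measurable_funM.
apply: le_trans (le_normr_Rintegral measurableT ifg) _.
have <- : \int[P]_w (2^-1 * (f w ^+ 2 + g w ^+ 2)) = B.
  rewrite RintegralZl//; last exact: integrableDR.
  by rewrite RintegralDT// fB gB; field.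
apply: le_Rintegral => //.
have /integrable_norm := ifg; exact.
Qed.

End real_covariance.

Section lattice_sums.
Context {R : realType} {n : nat}.
Local Notation Zn := {ffun 'I_n -> int}.
Local Notation cnt := (@counting Zn R).

Lemma Rintegral_counting1 (g : Zn -> R) s : (forall x, x <> s -> g x = 0) ->
  \int[cnt]_x g x = g s.
Proof.
move=> gs; rewrite /Rintegral.
have -> : (\int[cnt]_x (g x)%:E = \int[cnt]_(x in [set s]) cst (g s)%:E x)%E.
  rewrite [RHS]integral_mkcond; apply: eq_integral => x _; rewrite patchE.
  case: ifPn => [|]; first by rewrite inE/= => ->.
  by rewrite notin_setE => /= /gs ->.
by rewrite integral_cst// [X in (_ * X)%E]counting1 mule1.
Qed.

Lemma Zn_sum1 (f : Zn -> R[i]) s : (forall x, x <> s -> f x = 0) -> Zn_sum f = f s.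
Proof.
move=> fs; rewrite /Zn_sum /cintegral !(@Rintegral_counting1 _ s) => [|x /fs ->//|x /fs ->//].
by case: (f s).
Qed.

Lemma normcR (x : R) : ComplexField.Normc.normc x%:C = `|x|.
Proof. by rewrite /ComplexField.Normc.normc/= expr0n/= addr0 sqrtr_sqr. Qed.

Definition deltaZ (s x : Zn) : R := (x == s)%:R.

Lemma rapidly_decreasing_deltaZ s : rapidly_decreasing (fun x => (deltaZ s x)%:C).
Proof.
move=> N; exists ((1 + enorm (@rV_of_Zn R n s)) ^+ N) => x; rewrite normcR /deltaZ.
case: eqP => [->|_]; first by rewrite normr1 mulr1.
by rewrite normr0 mulr0 exprn_ge0// addr_ge0// enorm_ge0.
Qed.

Section process.
Context {dO : measure_display} {Omega : measurableType dO}.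
Variables (P : probability Omega R) (Xi : R.-ker Omega ~> Zn) (beta : Zn -> R[i]).
Hypothesis Xi_pp : point_process P Xi [set K | ebounded (@rV_of_Zn R n @` K)].
Hypothesis Xi_beta : covariance_functional_Zn P Xi beta.

Let ebd1 s : [set K | ebounded (@rV_of_Zn R n @` K)] [set s].
Proof. by exists (enorm (@rV_of_Zn R n s)) => x [y /= -> <-]. Qed.

Lemma point_process_Zn1 s :
  (\int[P]_w (Xi w [set s] * Xi w [set s]) < +oo)%E.
Proof. by apply: (Xi_pp _ _).2 => //; exact: ebd1. Qed.

Let X (s : Zn) w : R := fine (Xi w [set s]).

Let mX s : measurable_fun setT (X s).
Proof. by apply: measurableT_comp => //; exact: measurable_kernel. Qed.

Let XE s w : (X s w)%:E = Xi w [set s].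
Proof. by have [m hm] := (Xi_pp (I : measurable [set s]) (ebd1 s)).1 w; rewrite /X hm. Qed.

Let X2 s : P.-integrable setT (EFin \o (fun w => X s w ^+ 2)).
Proof.
apply/integrableP; split; first by apply/measurable_EFinP; exact: measurable_funX.
rewrite (eq_integral (fun w => Xi w [set s] * Xi w [set s])%E).
  exact: point_process_Zn1.
by move=> w _; rewrite /= ger0_norm ?sqr_ge0// expr2 EFinM XE.
Qed.

Let linE s : linear_statistic Xi (fun x => (deltaZ s x)%:C) = fun w => (X s w)%:C.
Proof.
apply/funext => w; rewrite /linear_statistic /cintegral/=.
congr (_ +i* _); last by rewrite /Rintegral integral0.
rewrite /X -[in RHS](setIT [set s]) -integral_indic// /Rintegral.
congr fine; apply: eq_integral => x _; rewrite indicE /deltaZ.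
by case: eqP => [->|xs]; [rewrite mem_set|rewrite memNset].
Qed.

Let betaE s t : beta (s - t) =
  (\int[P]_w ((X s w - \int[P]_z X s z) * (X t w - \int[P]_z X t z)))%:C.
Proof.
rewrite -ccovariance_real -2!linE.
rewrite (Xi_beta (rapidly_decreasing_deltaZ s) (rapidly_decreasing_deltaZ t)).
have inner x : Zn_sum (fun t0 => (deltaZ s x)%:C * conjc (deltaZ t t0)%:C * beta (x - t0)) =
    (deltaZ s x)%:C * beta (x - t).
  rewrite (@Zn_sum1 _ t); last by move=> y /eqP/negbTE yt; rewrite /deltaZ yt conjc0 mulr0 mul0r.
  by rewrite /deltaZ eqxx conjc1 mulr1.
under eq_fun do rewrite inner.
rewrite (@Zn_sum1 _ s); last by move=> y /eqP/negbTE yt; rewrite /deltaZ yt mul0r.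
by rewrite /deltaZ eqxx mul1r.
Qed.

(** Testing with indicators of points gives beta (s - t) = Cov (X_s, X_t), where X_s counts the
    points at s. So [beta] is real, every X_s has variance [beta 0], and the values are bounded by
    it; the exchange of lattice sums relies on this bound. *)
Lemma beta_real_bounded x :
  beta x = (complex.Re (beta x))%:C /\ `|complex.Re (beta x)| <= complex.Re (beta 0).
Proof.
have b0 s : \int[P]_w ((X s w - \int[P]_z X s z) ^+ 2) = complex.Re (beta 0).
  by rewrite -(subrr s) betaE.
have := betaE x 0; rewrite subr0 => ->; split => //=.
apply: Rintegral_mul_le => //.
- exact: measurable_funB.
- exact: measurable_funB.
- exact: integrable_square.
- exact: integrable_square.
Qed.

End process.

End lattice_sums.

(** * Periodization of functions supported inside a period *)

Section periodization.
Context {R : realType}.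
Implicit Types f : R -> R.

Definition turns (x : R) : int := Num.floor ((x + pi) / (2 * pi)).
Definition wrap (x : R) : R := x - 2 * pi * (turns x)%:~R.
(** The argument is folded into [-pi, pi) instead of summing translates: periodicity and agreement
    with [f] on the period are then immediate, and only smoothness across the seam needs the support
    condition. *)
Definition periodize f (x : R) : R := f (wrap x).

Let pi0 : (0 : R) < pi. Proof. exact: pi_gt0. Qed.
Let pi20 : (0 : R) < 2 * pi. Proof. by rewrite mulr_gt0. Qed.

Lemma wrap_itv x : - pi <= wrap x < pi.
Proof.
have := mem_rg1_floor ((x + pi) / (2 * pi)); rewrite /range1/=.
by rewrite ler_pdivlMr// ltr_pdivrMr// /wrap /turns => /andP[h1 h2]; apply/andP; split; lra.
Qed.

Lemma turns_unique x (m : int) : - pi <= x - 2 * pi * m%:~R < pi -> turns x = m.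
Proof.
move=> /andP[h1 h2]; apply: floor_def.
by rewrite ler_pdivlMr// ltr_pdivrMr// intrD1; apply/andP; split; lra.
Qed.

Lemma turnsD x : turns (x + 2 * pi) = turns x + 1.
Proof.
apply: turns_unique; rewrite intrD1; have := wrap_itv x; rewrite /wrap => /andP[h1 h2].
by apply/andP; split; lra.
Qed.

Lemma periodizeD f x : periodize f (x + 2 * pi) = periodize f x.
Proof. by rewrite /periodize /wrap turnsD intrD1; congr f; ring. Qed.

Lemma periodize_id f x : - pi <= x < pi -> periodize f x = f x.
Proof.
move=> hx; have t0 : turns x = 0 by apply: turns_unique; rewrite mulr0 subr0.
by rewrite /periodize /wrap t0 mulr0 subr0.
Qed.

Variable c : R.
Hypothesis c_ge0 : 0 <= c.
Hypothesis c_pi : c < pi.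

Lemma periodize_local f (x0 x : R) : csupp c f -> `|x0 - x| < pi - c ->
  f (x - 2 * pi * (turns x0)%:~R) = periodize f x.
Proof.
move=> sf; have c0 : 0 <= (c : R) by exact: c_ge0.
 have := wrap_itv x0; rewrite /wrap => /andP[y1 y2].
rewrite ltr_norml => /andP[d1 d2].
set k : R := (turns x0)%:~R in y1 y2 *.
set z := x - 2 * pi * k.
have [z1|z1] := ltP z (- pi).
  have km : (turns x0 - 1)%:~R = k - 1 :> R by rewrite intrB.
  have tx : turns x = turns x0 - 1.
    apply: turns_unique; rewrite km; rewrite /z in z1.
    by apply/andP; split; lra.
  rewrite /periodize /wrap tx km.
  by rewrite !sf// ltr_normr; apply/orP; [left|right]; rewrite /z in z1 *; lra.
have [z2|z2] := ltP z pi.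
  by rewrite /periodize /wrap (@turns_unique x (turns x0))// -/k -/z z1 z2.
have km : (turns x0 + 1)%:~R = k + 1 :> R by rewrite intrD.
have tx : turns x = turns x0 + 1.
  by apply: turns_unique; rewrite km; rewrite /z in z2; apply/andP; split; lra.
rewrite /periodize /wrap tx km.
by rewrite !sf// ltr_normr; apply/orP; [right|left]; rewrite /z in z2 *; lra.
Qed.

Lemma cinf_periodize f : cinf f -> csupp c f -> cinf (periodize f).
Proof.
move=> cf sf; apply: (@cinf_class _ [set h | exists g, [/\ cinf g, csupp c g & h = periodize g]]); last by exists f.
move=> _ [g [cg sg ->]]; exists (periodize (derive1 g)).
  by exists (derive1 g); split => //; [exact: cinf_derive|exact: csupp_derive].
move=> x; have gx : \forall y \near x, g (y - 2 * pi * (turns x)%:~R) = periodize g y.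
  have e0 : 0 < pi - c by rewrite subr_gt0.
  by have := nbhsx_ballx x _ e0; apply: filterS => y; exact: periodize_local.
apply: near_eq_is_derive gx _.
have := is_derive_affine 1 (- (2 * pi * (turns x)%:~R)) x cg.
rewrite !mul1r; congr is_derive.
by apply/funext => y; rewrite mul1r.
Qed.

End periodization.

(** * Exchange and reindexing of lattice sums *)

Section lattice_fubini.
Context {R : realType} {n : nat}.
Local Notation Zn := {ffun 'I_n -> int}.
Local Notation cnt := (@counting Zn R).

Lemma Zn_fubini (h : Zn -> Zn -> R) (A B : Zn -> R) :
  cnt.-integrable setT (EFin \o A) -> cnt.-integrable setT (EFin \o B) ->
  (forall s t, `|h s t| <= A s * B t) ->
  \int[cnt]_s \int[cnt]_t h s t = \int[cnt]_t \int[cnt]_s h s t.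
Proof.
move=> /integrable_Zn iA /integrable_Zn iB hAB.
pose f (z : 'rV[R]_n * 'rV[R]_n) := h (floorZ z.1) (floorZ z.2).
have mf : measurable_fun setT f.
  move=> _ Y _; rewrite setTI.
  have -> : f @^-1` Y = \bigcup_(p : Zn * Zn) (if h p.1 p.2 \in Y then
      (@floorZ R n @^-1` [set p.1]) `*` (@floorZ R n @^-1` [set p.2]) else set0).
    apply/seteqP; split => [z /= Yz|z [p _]].
      by exists (floorZ z.1, floorZ z.2) => //=; rewrite mem_set.
    by case: ifPn => //; rewrite inE => Yp [/= e1 e2]; rewrite /f e1 e2.
  apply: countable_bigcupT_measurable => [|p]; first exact: (@countableP (Zn * Zn)%type).
  by case: ifP => _ //; apply: measurableX; exact: measurable_floorZ1.
have := Rfubini mf iA iB (fun x y => hAB _ _).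
have E (g : Zn -> Zn -> R) : \int[cnt]_s \int[cnt]_t g s t =
    \int[lebesgue_rV R n]_x \int[lebesgue_rV R n]_y g (floorZ x) (floorZ y).
  by rewrite Rintegral_Zn; apply: eq_RintegralT => x; rewrite Rintegral_Zn.
by rewrite E (E (fun t s => h s t)).
Qed.

Lemma Rintegral_Zn_bij (f f' : Zn -> Zn) (g : Zn -> R) : cancel f f' -> cancel f' f ->
  \int[cnt]_v g (f v) = \int[cnt]_v g v.
Proof.
move=> fK f'K.
apply/esym/(Rintegral_mp (@measurable_fun_Zn n _ _ f)); last exact: measurable_fun_Zn.
move=> A _; apply: (@counting_unique R n (fun A => cnt (f @^-1` A))).
- by rewrite preimage_set0 measure0.
- move=> F tF; rewrite preimage_bigcup measure_semi_bigcup//.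
  by apply/trivIsetP => i j _ _ ij; rewrite -preimage_setI; move/trivIsetP : tF => ->.
- move=> v; rewrite (_ : f @^-1` [set v] = [set f' v]) ?counting1//.
  by apply/seteqP; split => u /=; [move=> <-; rewrite fK|move=> ->; rewrite f'K].
Qed.

End lattice_fubini.

(** * Vanishing variance on the lattice *)

Section lattice_case.
Context {R : realType} {n : nat}.
Local Notation Zn := {ffun 'I_n -> int}.
Local Notation cnt := (@counting Zn R).
Local Notation leb := (lebesgue_rV R n).
Variables (W V : R -> R) (c r b : R).
Hypotheses (cW : cinf W) (sW : csupp c W) (WN : forall k, W (- k) = W k).
Hypotheses (cV : cinf V) (sV : csupp c V) (VN : forall k, V (- k) = V k).
Hypothesis p_ge0 : forall x, 0 <= ct W 0 x.
Hypothesis qE : forall x, ct V 0 x = x ^+ 2 * ct W 0 x.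
Hypothesis W0 : 0 < W 0.
Hypothesis r0 : 0 < r.
Hypothesis rVW : n%:R * V 0 < r ^+ 2 * W 0.
Hypothesis c0 : 0 < c.
Hypothesis b0 : 0 <= b.
Hypothesis cb : n%:R * c ^+ 2 < b ^+ 2.
Hypothesis c_pi2 : c + c <= pi.

Local Notation phi := (@phi R n W V r).
Local Notation fhat := (@fhat R n W V r).
Local Notation emb := (@rV_of_Zn R n).

Definition phiZ (v : Zn) : R := phi (emb v).

(* Smooth because the support of [fhat] lies in the interior of the torus. *)
Definition fper : 'rV[R]_n -> R :=
  sepsum (@coef2 R n r) (fun a i => periodize (spec2 W V a i)).

Let c_pi : c < pi.
Proof. by apply: lt_le_trans c_pi2; rewrite ltrDl. Qed.

Let cper a i : cinf (periodize (spec2 W V a (i : 'I_n))).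
Proof.
by apply: (cinf_periodize (ltW c0) c_pi); [exact: cinf_spec2|exact: csupp_spec2].
Qed.

Lemma periodic_smooth_fper : periodic_smooth (fun k => (fper k)%:C).
Proof.
split; first by apply: csmooth_real; exact: smooth_sepsum.
move=> i k; congr (_%:C); apply: eq_bigr => a _; congr (_ * _).
apply: eq_bigr => j _; rewrite !mxE eqxx/=; case: (j == i); last by rewrite mulr0 addr0.
by rewrite mulr1 periodizeD.
Qed.

Lemma fper_torus k : torus k -> fper k = fhat k.
Proof.
move=> tk; apply: eq_bigr => a _; congr (_ * _); apply: eq_bigr => i _.
by rewrite periodize_id//; have [-> ->] := tk i.
Qed.

Lemma measurable_fper : measurable_fun setT fper.
Proof.
apply: measurable_sum => a; apply: measurable_funM => //.
apply: (measurable_prod_coord (f := fun i => periodize (spec2 W V a i))) => i.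
exact: continuous_measurableR (cinf_continuous (cper a i)).
Qed.

Lemma measurable_torus : measurable (@torus R n).
Proof.
have -> : @torus R n = ~` (\bigcup_i (coord_rV i @^-1` ~` `[- pi, pi[%classic)).
  rewrite setC_bigcup; apply/seteqP; split => [k tk i _|k tk i].
    by rewrite /= => /=; apply; rewrite in_itv/=; have [-> ->] := tk i.
  have := tk i I; rewrite /= => /contrapT; rewrite in_itv/= => /andP[].
  by [].
apply: measurableC; apply: fin_bigcup_measurable => // i _.
by rewrite -[X in measurable X]setTI; apply: measurable_coord_rV => //; exact: measurableC.
Qed.

Lemma fhat_torus k : ~ torus k -> fhat k = 0.
Proof.
move=> /existsNP[i ki]; apply: (fhat_supp r sW sV (i := i)).
rewrite ltNge; apply/negP => kc; apply: ki.
by move: kc; rewrite ler_norml => /andP[h1 h2]; split; have := c_pi; lra.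
Qed.

Let Jmap_floor (x : 'rV[R]_n) : Jmap (@floorR R) x = emb (floorZ x).
Proof. by apply/rowP => i; rewrite !mxE ffunE. Qed.

Let floorRD (t : R) : floorR (t + 1) = floorR t + 1.
Proof. by rewrite /floorR floorDrz ?rpred1// floor1 intrD1. Qed.

Let cL : c + c <= pi / (1 : R). Proof. by rewrite divr1. Qed.

Let embD (x v : Zn) : emb (x + v) = emb x + emb v.
Proof. by apply/rowP => i; rewrite !mxE ffunE intrD. Qed.

(** The integral over the torus is one over R^n because [fhat] vanishes off the torus; the
    autocorrelation identity with [iota] the floor function then yields a lattice sum, which is
    Poisson summation. *)
Lemma fourier_torus_fper x : fourier_torus (fun k => (fper k)%:C) x =
  (\int[cnt]_v (phiZ (x + v) * phiZ v))%:C.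
Proof.
have h := @fhat_autocorrelation R n W V c r cW sW WN cV sV VN 1 (@floorR R) ltr01
  (@measurable_floorR R) floorRD (@floorR_close R) cL (emb x).
have dotC k : dot (emb x) k = dot k (emb x) by rewrite /dot; apply: eq_bigr => i _; rewrite mulrC.
have auto : \int[leb]_t (phi (emb x + Jmap (@floorR R) t) * phi (Jmap (@floorR R) t)) =
    \int[cnt]_v (phiZ (x + v) * phiZ v).
  rewrite Rintegral_Zn; apply: eq_RintegralT => t.
  by rewrite Jmap_floor /phiZ embD.
have tor (g : 'rV[R]_n -> R) : \int[leb]_(k in torus) (fper k * g k) = \int[leb]_k (fhat k * g k).
  rewrite /Rintegral integral_mkcond; congr fine; apply: eq_integral => k _.
  rewrite patchE; case: ifPn => [|]; first by rewrite inE => tk; rewrite fper_torus.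
  by rewrite notin_setE => /fhat_torus ->; rewrite mul0r.
rewrite /fourier_torus /cintegral; congr (_ +i* _).
- transitivity (\int[leb]_(k in torus) (fper k * cos (dot k (emb x) + 0))).
    by congr fine; apply: eq_integral => k _; rewrite mulCr_re/= cosN addr0 dotC.
  by rewrite tor h cos0 mul1r auto.
- transitivity (\int[leb]_(k in torus) (fper k * cos (dot k (emb x) + pi / 2))).
    by congr fine; apply: eq_integral => k _; rewrite mulCr_im/= sinN_cosDpihalf dotC.
  by rewrite tor h cos_pihalf mul0r.
Qed.

Lemma rapidly_decreasing_phiZ : rapidly_decreasing (fun v => (phiZ v)%:C).
Proof.
move=> N; have [M hM] := @phi_decay R n W V c r cW sW cV sV N.
by exists M => v; rewrite normcR.
Qed.

(** Decay of order 4 gives the weight twice: in the double sum, one pair of weights is turned into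
    decay in the difference x, the other keeps decay in s. *)
Lemma phiZ_weightZ : exists2 M, 0 <= M & forall v, `|phiZ v| <= M * (weightZ v * weightZ v).
Proof.
have [M hM] := @phi_prod_decay R n W V c r cW sW cV sV 4%N.
exists `|M| => // v; apply: le_trans (hM (emb v)) _.
have -> : weightZ v * weightZ v = \prod_i (1 + `|emb v ord0 i|) ^- 4.
  rewrite /weightZ -big_split/=; apply: eq_bigr => i _.
  by rewrite mxE -invfM -exprD.
by rewrite ler_wpM2r ?ler_norm//; apply: prodr_ge0 => i _; rewrite invr_ge0 exprn_ge0// addr_ge0.
Qed.

Lemma weightZ_le1 (v : Zn) : weightZ v <= 1 :> R.
Proof.
have <- : \prod_(i < n) 1 = 1 :> R by rewrite big1.
apply: ler_prod => i _; by rewrite invr_ge0 exprn_ge0 ?addr_ge0//= invf_le1 ?exprn_gt0 ?ltr_wpDr// exprn_ege1// lerDl.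
Qed.

(** Coordinatewise this is 1 + |d| <= (1 + |a|) (1 + |a - d|), a Peetre-type inequality that
    converts decay at s and s - x into decay in x. *)
Lemma weightZ_sub (s x : Zn) : weightZ s * weightZ (s - x) <= weightZ x :> R.
Proof.
rewrite /weightZ -big_split/=; apply: ler_prod => i _.
set a := (s i)%:~R : R; set d := (x i)%:~R : R.
have -> : ((s - x) i)%:~R = a - d by rewrite !ffunE intrB.
rewrite -invfM -exprMn invr_ge0 exprn_ge0 ?mulr_ge0 ?addr_ge0//=.
have p t : 0 < 1 + `|t| :> R by rewrite ltr_wpDr.
rewrite lef_pV2 ?posrE ?exprn_gt0 ?mulr_gt0// lerXn2r ?nnegrE ?mulr_ge0 ?(ltW (p _))//.
have : `|d| <= `|a| + `|a - d|.
  have {1}-> : d = a - (a - d) by ring.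
  exact: ler_normB.
have := normr_ge0 a; have := normr_ge0 (a - d); nra.
Qed.

Section process.
Context {dO : measure_display} {Omega : measurableType dO}.
Variables (P : probability Omega R) (Xi : R.-ker Omega ~> Zn) (rho : R).
Variables (beta : Zn -> R[i]) (S : {measure set 'rV[R]_n -> \bar R}).
Hypothesis Xi_pp : point_process P Xi [set K | ebounded (emb @` K)].
Hypothesis Xi_inv : translation_invariant P Xi +%R.
Hypothesis rho0 : 0 < rho.
Hypothesis Xi_rho : has_intensity P Xi cnt rho.
Hypothesis Xi_beta : covariance_functional_Zn P Xi beta.
Hypothesis beta_S : structure_function_Zn beta S.
Hypothesis S_b : S (eball 0 b) = 0%E.

Let g (x : Zn) : R := complex.Re (beta x).
Let betaE x : beta x = (g x)%:C := (beta_real_bounded Xi_pp Xi_beta x).1.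
Let g_le x : `|g x| <= g 0 := (beta_real_bounded Xi_pp Xi_beta x).2.

Let Zn_sum_real (f : Zn -> R) : Zn_sum (fun x => (f x)%:C) = (\int[cnt]_x f x)%:C.
Proof. by rewrite /Zn_sum /cintegral/=; congr (_ +i* _); rewrite /Rintegral integral0. Qed.

(** The covariance is a double sum over s and t, whereas the structure function pairs [beta] with a
    function of x = s - t. The substitution t = s - x, an exchange of sums and then s = x + v pass
    from one to the other. *)
Lemma covariance_sum : \int[cnt]_s \int[cnt]_t (phiZ s * phiZ t * g (s - t)) =
  \int[cnt]_x (g x * \int[cnt]_v (phiZ (x + v) * phiZ v)).
Proof.
have [M M0 hM] := phiZ_weightZ.
have g0 : 0 <= g 0 by apply: le_trans (g_le 0).
have w0 (v : Zn) : 0 <= weightZ v :> R by exact: weightZ_ge0.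
have bnd s x : `|phiZ s * phiZ (s - x)| <= M * M * weightZ x * weightZ s.
  rewrite normrM; apply: le_trans (ler_pM _ _ (hM s) (hM (s - x))) _ => //.
  have -> : M * (weightZ s * weightZ s) * (M * (weightZ (s - x) * weightZ (s - x))) =
    M * M * ((weightZ s * weightZ (s - x)) * (weightZ s * weightZ (s - x))) by ring.
  rewrite -[leRHS]mulrA ler_wpM2l ?mulr_ge0// ler_pM ?mulr_ge0 ?weightZ_sub//.
  by rewrite -[leRHS]mulr1 ler_wpM2l// weightZ_le1.
have iw := @integrable_weightZ R n.
transitivity (\int[cnt]_s \int[cnt]_x (phiZ s * phiZ (s - x) * g x)).
  apply: eq_RintegralT => s.
  rewrite -(@Rintegral_Zn_bij _ _ (fun x => s - x) (fun x => s - x)); first last.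
  - by move=> x; rewrite subKr.
  - by move=> x; rewrite subKr.
  by apply: eq_RintegralT => x; rewrite subKr.
rewrite (@Zn_fubini _ _ _ weightZ (fun x => M * M * g 0 * weightZ x)) => //; first last.
- move=> s x; rewrite normrM; apply: le_trans (ler_pM _ _ (bnd s x) (g_le x)) _ => //.
  by rewrite le_eqVlt; apply/orP; left; apply/eqP; ring.
- exact: integrableZlR.
apply: eq_RintegralT => x.
rewrite -(@Rintegral_Zn_bij _ _ (fun v => x + v) (fun s => s - x)); first last.
- by move=> v; rewrite addrC subrK.
- by move=> v; rewrite addrC addKr.
rewrite -RintegralZl//.
  by apply: eq_RintegralT => v; rewrite addrAC subrr add0r mulrC.
rewrite (_ : (fun v => _) = fun v => phiZ v * phiZ (x + v)); last first.
  by apply/funext => v; exact: mulrC.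
apply: (@le_integrableR _ _ _ _ _ (fun v => M * M * weightZ (- x) * weightZ v)).
- exact: measurable_fun_Zn.
- by move=> v; have := bnd v (- x); rewrite opprK addrC.
- exact: integrableZlR.
Qed.

Let var0 : ccovariance P (linear_statistic Xi (fun v => (phiZ v)%:C))
  (linear_statistic Xi (fun v => (phiZ v)%:C)) = 0.
Proof.
have rphi := rapidly_decreasing_phiZ.
rewrite (Xi_beta rphi rphi).
have conjR (a : R) : conjc a%:C = a%:C by rewrite /= oppr0.
have inner s : Zn_sum (fun t => (phiZ s)%:C * conjc (phiZ t)%:C * beta (s - t)) =
    (\int[cnt]_t (phiZ s * phiZ t * g (s - t)))%:C.
  rewrite -Zn_sum_real; congr Zn_sum; apply/funext => t.
  by rewrite betaE conjR -!rmorphM.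
under eq_fun do rewrite inner.
rewrite Zn_sum_real covariance_sum -Zn_sum_real.
rewrite (_ : (fun x => _) = fun x => beta x * fourier_torus (fun k => (fper k)%:C) x); last first.
  by apply/funext => x; rewrite fourier_torus_fper betaE -rmorphM.
rewrite -(beta_S periodic_smooth_fper).2.
apply: (cintegral_null (B := eball 0 b)) => //.
- exact: measurable_torus.
- exact: measurable_eball.
- exact: measurable_fper.
- by move=> k tk kb; rewrite fper_torus//; exact: (fhat_eball r sW sV c0 b0 cb).
Qed.

Lemma no_hole_lattice x : P [set w | Xi w (emb @^-1` eball (emb x) r) = 0%E] = 0%E.
Proof.
have := translation_invariant_eval Xi_inv x (I : measurable (emb @^-1` eball (emb x) r)) (emeasurable_set1 0%E).
rewrite /= => <-.
have -> : [set v | eball (emb x) r (emb (v + x))] = emb @^-1` eball 0 r.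
  by rewrite -(eball_translate r (emb x)); apply/seteqP; split => v /=; rewrite embD.
have [] := integrable_phi_Jmap cW sW cV sV W0 r0 rVW ltr01 (@measurable_floorR R) floorRD (@floorR_close R) cL c0.
have -> : (fun t : 'rV[R]_n => phi (Jmap (@floorR R) t)) = phiZ \o (@floorZ R n).
  by apply/funext => t; rewrite Jmap_floor.
move=> /integrable_Zn iphi; rewrite -(Rintegral_Zn phiZ) => pphi.
apply: (no_hole rho0 Xi_rho iphi pphi _ var0) => //.
- have [M M0 hM] := phiZ_weightZ.
  have hM1 v : `|phiZ v| <= M * weightZ (id v).
    apply: le_trans (hM v) _; rewrite ler_wpM2l//.
    by rewrite -[leRHS]mulr1 ler_wpM2l ?weightZ_ge0// weightZ_le1.
  apply: (second_moment_cells Xi_inv (cell := id) (tr := id)) hM1 => //.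
  exact: point_process_Zn1 Xi_pp 0.
- move=> v /= /eball0 /negP; rewrite -leNgt; exact: phi_le0.
Qed.

End process.

End lattice_case.

(** With y = d kappa (d + 2)^2 the claim reduces to y < (1 + y)^2; taking 1 + y for the constant
    avoids a square root. *)
Lemma radius_large (R : realType) (d : nat) (kappa b W0 V0 : R) : 0 < kappa -> 0 < b -> 0 < W0 ->
  V0 <= kappa / (b / (d%:R + 2)) ^+ 2 * W0 ->
  d%:R * V0 < ((1 + d%:R * kappa * (d%:R + 2) ^+ 2) * b^-1) ^+ 2 * W0.
Proof.
move=> k0 b0 W00 hV; have d0 : 0 <= d%:R :> R by [].
apply: le_lt_trans (ler_wpM2l d0 hV) _.
rewrite mulrA ltr_pM2r// exprMn exprVn expr_div_n invf_div.
have -> : d%:R * (kappa * ((d%:R + 2) ^+ 2 / b ^+ 2)) =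
    (d%:R * kappa * (d%:R + 2) ^+ 2) / b ^+ 2 by ring.
rewrite ltr_pM2r ?invr_gt0 ?exprn_gt0//.
have : 0 <= d%:R * kappa * (d%:R + 2) ^+ 2 by rewrite !mulr_ge0 ?(ltW k0)// exprn_ge0// addr_ge0.
move: (_ * _ * _) => y y0; rewrite sqrrD expr1n mul1r; have := sqr_ge0 y; rewrite -mulr_natl; lra.
Qed.

(** The cube of half-side c = b / (d + 2) has half-diagonal c sqrt d < b, so it lies in the open
    ball on which [S] vanishes. *)
Lemma cube_in_ball (R : realType) (d : nat) (b : R) : 0 < b ->
  d%:R * (b / (d%:R + 2)) ^+ 2 < b ^+ 2.
Proof.
move=> b0; have d0 : 0 <= d%:R :> R by [].
rewrite expr_div_n mulrCA gtr_pMr ?exprn_gt0// ltr_pdivrMr ?exprn_gt0 ?ltr_wpDl// mul1r.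
by nra.
Qed.

Theorem theorem1p2 (R : realType) (d : nat) (hd : (0 < d)%N) :
  exists C : R, 0 < C /\
  (forall (dO : measure_display) (Omega : measurableType dO)
      (P : probability Omega R) (Xi : R.-ker Omega ~> 'rV[R]_d) (rho : R)
      (beta : ('rV[R]_d -> R[i]) -> R[i])
      (S : {measure set 'rV[R]_d -> \bar R}) (b : R),
    point_process P Xi ebounded ->
    translation_invariant P Xi +%R ->
    0 < rho -> has_intensity P Xi (lebesgue_rV R d) rho ->
    covariance_functional P Xi beta ->
    structure_function beta S ->
    stealthy setT S ->
    max_vanishing_radius S b ->
    forall x : 'rV[R]_d,
      P [set w | Xi w (eball x (C * b^-1)) = 0%E] = 0%E) /\
  (forall (dO : measure_display) (Omega : measurableType dO)
      (P : probability Omega R) (Xi : R.-ker Omega ~> {ffun 'I_d -> int})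
      (rho : R) (beta : {ffun 'I_d -> int} -> R[i])
      (S : {measure set 'rV[R]_d -> \bar R}) (b : R),
    point_process P Xi [set K | ebounded (@rV_of_Zn R d @` K)] ->
    translation_invariant P Xi +%R ->
    0 < rho -> has_intensity P Xi (@counting {ffun 'I_d -> int} R) rho ->
    covariance_functional_Zn P Xi beta ->
    structure_function_Zn beta S ->
    stealthy torus S ->
    max_vanishing_radius_torus S b ->
    forall x : {ffun 'I_d -> int},
      P [set w | Xi w (@rV_of_Zn R d @^-1` eball (rV_of_Zn x) (C * b^-1)) = 0%E]
      = 0%E).
Proof.
have [kappa k0 hk] := @profile R.
have d0 : 0 <= d%:R :> R by [].
pose C : R := 1 + d%:R * kappa * (d%:R + 2) ^+ 2.
have C0 : 0 < C by rewrite ltr_wpDr// !mulr_ge0 ?(ltW k0)// exprn_ge0// addr_ge0.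
exists C; split=> //; split.
- move=> dO Omega P Xi rho beta S b pp inv rho0 int cov str _ [b0 Sb _] x.
  have c0 : 0 < b / (d%:R + 2) by rewrite divr_gt0// ltr_wpDl.
  have [W [V [[cW sW WN] [cV sV VN] p0 qE [W0 VW]]]] := hk _ c0.
  have r0 : 0 < C * b^-1 by rewrite mulr_gt0// invr_gt0.
  apply: (no_hole_euclidean cW sW WN cV sV VN p0 qE W0 r0 _ c0 (ltW b0) (cube_in_ball d b0)
    pp inv rho0 int cov str Sb).
  exact: radius_large.
- move=> dO Omega P Xi rho beta S b pp inv rho0 int cov str _ [/andP[b0 bpi] Sb _] x.
  have c0 : 0 < b / (d%:R + 2) by rewrite divr_gt0// ltr_wpDl.
  have [W [V [[cW sW WN] [cV sV VN] p0 qE [W0 VW]]]] := hk _ c0.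
  have r0 : 0 < C * b^-1 by rewrite mulr_gt0// invr_gt0.
  (* On the lattice 2 c must not exceed pi; as 2 / (d + 2) <= 1 and b <= pi, the summand 2 in d + 2
     takes care of it. *)
  have cpi : b / (d%:R + 2) + b / (d%:R + 2) <= pi.
    rewrite -mulrDl ler_pdivrMr ?ltr_wpDl//; have := pi_gt0 R; nra.
  apply: (no_hole_lattice cW sW WN cV sV VN p0 qE W0 r0 _ c0 (ltW b0) (cube_in_ball d b0) cpi
    pp inv rho0 int cov str Sb).
  exact: radius_large.
Qed.
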